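(* For every $0<\epsilon\leq 1$, there is a deterministic $(1+\epsilon, 0)$-approximate decremental all-pairs shortest paths data structure for unweighted undirected graphs with $n$ nodes and $m$ initial edges, with a total update time of $O((mn\log n)/\epsilon)$ and a query time of $O(\log\log n)$.
   Context: A decremental graph is a sequence $G_0, G_1, \ldots, G_k$ of unweighted undirected graphs on a common node set $V$ with $|V|=n$, $m=|E(G_0)|$, where $G_i$ is obtained from $G_{i-1}$ by deleting exactly one edge. $\dist_{G}(x,y)$ is the hop distance in $G$ ($\infty$ if disconnected). An $(\alpha,\beta)$-approximate decremental APSP data structure processes the deletions one by one (operation Delete$(u,v)$) and, after the $i$-th deletion, answers queries Distance$(x,y)$ by returning $\delta_i(x,y)$ with $\dist_{G_i}(x,y)\leq \delta_i(x,y)\leq \alpha\,\dist_{G_i}(x,y)+\beta$. The total update time is the total time for initialization and all $k$ deletions; the query time is the worst-case time for a single query. *)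

(* Defs.v *)
From Stdlib Require List.
From mathcomp Require Import all_boot all_order all_algebra.
From mathcomp Require Import all_classical all_reals all_analysis.

Set Implicit Arguments.
Unset Strict Implicit.
Unset Printing Implicit Defensive.

Import Order.TTheory GRing.Theory Num.Theory.

(** * Graphs *)

(* A graph on the nodes 0, ..., n-1 is its set of edges, an edge {u, v} being
   a two-element set of nodes. *)
Notation graph n := {set {set 'I_n}}.

Definition edge n (u v : 'I_n) : {set 'I_n} := [set u; v]%SET.

Definition simple_graph n (G : graph n) : bool := [forall e in G, #|e| == 2].

Definition adj n (G : graph n) : rel 'I_n := fun u v => edge u v \in G.

(* [ereal_inf] of the empty set is +oo, the distance of disconnected nodes. *)
Definition dist (R : realType) n (G : graph n) (x y : 'I_n) : \bar R :=
  ereal_inf [set ((size p)%:R%:E)%R | p in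
             [set p : seq 'I_n | path (adj G) x p /\ last x p = y]]%classic.

(** * The word RAM *)

(* Programs are deterministic while programs over a finite number of registers
   and a random access memory, both holding [w]-bit words.  Executing a
   program costs one time unit for every operator, memory access, assignment
   and branch that is executed. *)

Inductive binop := Add | Sub | Mul | Div | Mod | Eq | Lt.

Inductive expr :=
  | Lit of nat
  | Reg of nat
  | Read of expr
  | Bin of binop & expr & expr.

Inductive cmd :=
  | Skip
  | Assign of nat & expr
  | Write of expr & expr
  | Seq of cmd & cmd
  | If of expr & cmd & cmd
  | While of expr & cmd.

Record state := State { regs : nat -> nat; mem : nat -> nat }.

Definition upd (f : nat -> nat) (i v : nat) : nat -> nat :=
  fun j => if j == i then v else f j.

(* Overflow wraps around, subtraction is truncated at 0, division by 0 gives 0,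
   and tests return 0 or 1. *)
Definition binop_sem (w : nat) (o : binop) (a b : nat) : nat :=
  (match o with
   | Add => a + b
   | Sub => a - b
   | Mul => a * b
   | Div => a %/ b
   | Mod => a %% b
   | Eq => a == b
   | Lt => a < b
   end) %% 2 ^ w.

Fixpoint eval (w : nat) (s : state) (e : expr) : nat :=
  match e with
  | Lit k => k %% 2 ^ w
  | Reg r => regs s r
  | Read a => mem s (eval w s a)
  | Bin o e1 e2 => binop_sem w o (eval w s e1) (eval w s e2)
  end.

Fixpoint expr_cost (e : expr) : nat :=
  match e with
  | Lit _ | Reg _ => 1
  | Read a => (expr_cost a).+1
  | Bin _ e1 e2 => (expr_cost e1 + expr_cost e2).+1
  end.

(* [exec w c s t s']: from [s], the program [c] halts in [s'] after time [t]. *)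
Inductive exec (w : nat) : cmd -> state -> nat -> state -> Prop :=
  | ExecSkip s : exec w Skip s 1 s
  | ExecAssign r e s :
      exec w (Assign r e) s (expr_cost e).+1
        (State (upd (regs s) r (eval w s e)) (mem s))
  | ExecWrite a e s :
      exec w (Write a e) s (expr_cost a + expr_cost e).+1
        (State (regs s) (upd (mem s) (eval w s a) (eval w s e)))
  | ExecSeq c1 c2 s1 s2 s3 t1 t2 :
      exec w c1 s1 t1 s2 -> exec w c2 s2 t2 s3 ->
      exec w (Seq c1 c2) s1 (t1 + t2) s3
  | ExecIfTrue e c1 c2 s t s' :
      eval w s e != 0 -> exec w c1 s t s' ->
      exec w (If e c1 c2) s (expr_cost e + t).+1 s'
  | ExecIfFalse e c1 c2 s t s' :
      eval w s e = 0 -> exec w c2 s t s' ->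
      exec w (If e c1 c2) s (expr_cost e + t).+1 s'
  | ExecWhileTrue e c s1 s2 s3 t1 t2 :
      eval w s1 e != 0 -> exec w c s1 t1 s2 -> exec w (While e c) s2 t2 s3 ->
      exec w (While e c) s1 (expr_cost e + t1 + t2).+1 s3
  | ExecWhileFalse e c s :
      eval w s e = 0 -> exec w (While e c) s (expr_cost e).+1 s.

Lemma exec_det w c s t1 s1 t2 s2 :
  exec w c s t1 s1 -> exec w c s t2 s2 -> t1 = t2 /\ s1 = s2.
Proof.
move=> h1; elim: h1 t2 s2 => {c s t1 s1}.
- by move=> s t2 s2 h; inversion h.
- by move=> r e s t2 s2 h; inversion h.
- by move=> a e s t2 s2 h; inversion h.
- move=> c1 c2 s1 s2 s3 t1 t2 _ IH1 _ IH2 t s h.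
  inversion h as [| | |? ? ? s' ? ? ? h1 h2| | | |]; subst.
  have [-> E] := IH1 _ _ h1; subst s'.
  by have [-> ->] := IH2 _ _ h2.
- move=> e c1 c2 s t s' ne _ IH t2 s2 h.
  inversion h as [| | | |? ? ? ? ? ? _ h1|? ? ? ? ? ? e0 _| |]; subst.
    by have [-> ->] := IH _ _ h1.
  by rewrite e0 in ne.
- move=> e c1 c2 s t s' e0 _ IH t2 s2 h.
  inversion h as [| | | |? ? ? ? ? ? ne _|? ? ? ? ? ? _ h1| |]; subst.
    by rewrite e0 in ne.
  by have [-> ->] := IH _ _ h1.
- move=> e c s1 s2 s3 t1 t2 ne _ IH1 _ IH2 t s h.
  inversion h as [| | | | | |? ? ? s' ? ? ? _ h1 h2|? ? ? e0]; subst.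
    have [-> E] := IH1 _ _ h1; subst s'.
    by have [-> ->] := IH2 _ _ h2.
  by rewrite e0 in ne.
- move=> e c s e0 t2 s2 h.
  inversion h as [| | | | | |? ? ? ? ? ? ? ne _ _|]; subst => //.
  by rewrite e0 in ne.
Qed.

(** * Decremental data structures *)

(* The programs do not depend on the graph, on n or on the word size. *)
Record data_structure := DataStructure {
  initialize_code : cmd;
  delete_code : cmd;
  distance_code : cmd
}.

Inductive operation n :=
  | Delete of 'I_n & 'I_n
  | Distance of 'I_n & 'I_n.

(* Every deletion removes an edge that is still present; with
   E = G_0 this describes a decremental graph G_0, ..., G_k, together with an
   arbitrary interleaving of queries. *)
Fixpoint valid_operations n (G : graph n) (ops : seq (operation n)) : bool :=
  match ops with
  | [::] => true
  | Delete u v :: ops' =>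
      (edge u v \in G) && valid_operations (G :\ edge u v)%SET ops'
  | Distance _ _ :: ops' => valid_operations G ops'
  end.

Definition edge_listing n (G : graph n) (es : seq ('I_n * 'I_n)) : bool :=
  perm_eq [seq edge e.1 e.2 | e <- es] (enum G).

(* Registers 0 and 1 hold n and m, memory cells 2i and 2i+1 the endpoints of
   the i-th edge, and everything else is 0. *)
Definition input_state n (es : seq ('I_n * 'I_n)) : state :=
  State (nth 0 [:: n; size es])
        (nth 0 (flatten [seq [:: val e.1; val e.2] | e <- es])).

(* Arguments are passed in registers 0 and 1; everything else persists. *)
Definition call n (x y : 'I_n) (s : state) : state :=
  State (upd (upd (regs s) 0 x) 1 y) (mem s).

(* A query returns +oo if register 0 is nonzero, and otherwise the number in
   register 1. *)
Definition answer (R : realType) (s : state) : \bar R :=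
  if regs s 0 == 0 then ((regs s 1)%:R%:E)%R else +oo%E.

(* The graph at the time of the query, its arguments, answer and cost. *)
Record query_record (R : realType) n := QueryRecord {
  q_graph : graph n;
  q_src : 'I_n;
  q_dst : 'I_n;
  q_answer : \bar R;
  q_time : nat
}.

(* [run D w G s ops T L]: starting in state [s] with current graph [G], the
   operations [ops] are all executed to completion, the deletions taking time
   [T] in total and the queries producing the records [L]. *)
Inductive run (R : realType) (D : data_structure) (w n : nat) :
    graph n -> state -> seq (operation n) ->
    nat -> seq (query_record R n) -> Prop :=
  | RunNil G s : run D w G s [::] 0 [::]
  | RunDelete G s u v ops t s' T L :
      exec w (delete_code D) (call u v s) t s' ->
      run D w (G :\ edge u v)%SET s' ops T L ->
      run D w G s (Delete u v :: ops) (t + T) L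
  | RunDistance G s x y ops t s' T L :
      exec w (distance_code D) (call x y s) t s' ->
      run D w G s' ops T L ->
      run D w G s (Distance x y :: ops) T
        (QueryRecord G x y (answer R s') t :: L).

(* As [run], including the initialization, whose time is counted in [T]. *)
Definition full_run (R : realType) (D : data_structure) (w n : nat)
    (G0 : graph n) (es : seq ('I_n * 'I_n)) (ops : seq (operation n))
    (T : nat) (L : seq (query_record R n)) : Prop :=
  exists t0 s0 T1,
    [/\ exec w (initialize_code D) (input_state es) t0 s0,
        run D w G0 s0 ops T1 L & T = t0 + T1].

(* Admissible inputs; words have at least c (log n + 1) bits. *)
Definition admissible (c w n : nat) (G0 : graph n) (es : seq ('I_n * 'I_n))
    (ops : seq (operation n)) : Prop :=
  [/\ c * (trunc_log 2 n).+1 <= w, simple_graph G0, edge_listing G0 es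
    & valid_operations G0 ops].

Definition approximates (R : realType) (alpha beta : R) n
    (q : query_record R n) : Prop :=
  (dist R (q_graph q) (q_src q) (q_dst q) <= q_answer q)%E /\
  (q_answer q
     <= alpha%:E * dist R (q_graph q) (q_src q) (q_dst q) + beta%:E)%E.

Definition approx_decremental_APSP (R : realType) (c : nat) (alpha beta : R)
    (D : data_structure) : Prop :=
  forall w n (G0 : graph n) es ops, admissible c w G0 es ops ->
  exists T (L : seq (query_record R n)), full_run D w G0 es ops T L /\
    List.Forall (fun q => approximates alpha beta q) L.

(* By [exec_det] runs are unique, so the bounds below are about the run whose
   existence is part of [approx_decremental_APSP]. *)
Definition total_update_time_le (R : realType) (c : nat) (D : data_structure)
    (n m : nat) (B : R) : Prop :=
  forall w (G0 : graph n) es ops T (L : seq (query_record R n)),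
  #|G0| = m -> admissible c w G0 es ops -> full_run D w G0 es ops T L ->
  (T%:R <= B)%R.

Definition query_time_le (R : realType) (c : nat) (D : data_structure)
    (n : nat) (B : R) : Prop :=
  forall w (G0 : graph n) es ops T (L : seq (query_record R n)),
  admissible c w G0 es ops -> full_run D w G0 es ops T L ->
  List.Forall (fun q => ((q_time q)%:R <= B)%R) L.

(* Main.v *)
(** For every scale [i < log n] a set of centers is maintained, each the root of
    a BFS tree (Even-Shiloach tree) cut off at depth about [2^i], so that every
    node in a large component is within [2^i / K] of a center, with [K] about
    [4 / eps].  A query for [x] and [y] takes the first scale at which the tree
    of the center [c] of [x] still reaches [y], found by binary search, and
    returns [d(x, c) + d(c, y)].  As [y] was out of reach one scale below,
    [d(x, y)] exceeds [2^(i - 1)] and the additive error [2 d(x, c)] is at most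
    [eps * d(x, y)].

    Centers are opened greedily and never closed, but a center whose component
    has become small moves to the other side of the deletion, keeping the level
    that the new root has, so that levels never decrease.  Disjoint sets of
    about [2^i / (2 K)] nodes can be charged to the centers of a scale: the
    nodes near the center and the small components that it has left.  Hence
    there are at most [O(n K / 2^i)] trees at scale [i], each of which costs
    [O(m 2^i)] in total, and the sum over the scales is [O(m n K log n)]. *)

From Stdlib Require Import PeanoNat FunctionalExtensionality.
From mathcomp Require Import all_boot zify.
Require Import Defs.

Set Implicit Arguments.
Unset Strict Implicit.
Unset Printing Implicit Defensive.

(** * A while language with arrays *)

(** Monotone levels are what pays for an Even-Shiloach tree, so the obstacle is to replace a root
    without lowering any level. This is possible when the last vertex [w] of a level is about to
    rise: the lower levels are then closed under the remaining edges and form the new component of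
    the root, and [w] with its present level is a legitimate root for the other side. One deletion
    splits a component at most once, so one such test per tree and deletion is enough. A move takes
    time linear in n, but it raises the level of the root, which stays below the threshold [h] for
    large components; hence there are at most [h] moves. The threshold is the largest [h] for which
    balls of radius less than [h] around centers more than the covering radius [R] apart are
    disjoint. The cap is [2^i + R + h]: the first two terms make an unreached target farther than
    [2^i], the last one makes up for the level of the root. Vertices isolated in the initial graph
    never become centers, since terms quadratic in n would not be bounded by m n. All stored values
    stay polynomial in n, so no word overflows. *)

Inductive aexpr :=
  | ALit of nat
  | AVar of nat
  | AGet of nat & aexpr
  | ABin of binop & aexpr & aexpr.

Inductive acmd :=
  | ASkip
  | ASet of nat & aexpr
  | APut of nat & aexpr & aexpr
  | ASeq of acmd & acmd
  | AIf of aexpr & acmd & acmd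
  | AWhile of aexpr & acmd.

Record astate := AState { vars : nat -> nat; arrs : nat -> nat -> nat }.

(** [Nat.eqb] computes on closed register and array numbers, so [cbn] resolves every lookup. Cells
    of an array have symbolic indices and are updated with [upd]. *)
Definition fupd T (f : nat -> T) (i : nat) (v : T) (j : nat) : T :=
  if Nat.eqb j i then v else f j.
Arguments fupd T f i v j /.

Definition setv st r v := AState (fupd (vars st) r v) (arrs st).
Definition seta st a k v :=
  AState (vars st) (fupd (arrs st) a (upd (arrs st a) k v)).

Lemma vars_setv st r v : vars (setv st r v) = fupd (vars st) r v.
Proof. by []. Qed.

Lemma arrs_setv st r v : arrs (setv st r v) = arrs st.
Proof. by []. Qed.

Lemma vars_seta st a k v : vars (seta st a k v) = vars st.
Proof. by []. Qed.

Lemma arrs_seta st a k v :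
  arrs (seta st a k v) = fupd (arrs st) a (upd (arrs st a) k v).
Proof. by []. Qed.

Definition abinop (o : binop) (a b : nat) : nat :=
  match o with
  | Add => a + b
  | Sub => a - b
  | Mul => a * b
  | Div => a %/ b
  | Mod => a %% b
  | Eq => a == b
  | Lt => a < b
  end.

(* Array 0 is the input, in the cells below the content of register 2.  Entry
   [k] of any other array [a] is the cell [16 k + a], counted from there. *)
Definition addr (a : nat) (e : expr) : expr :=
  if a is 0 then Bin Mod e (Reg 2)
  else Bin Add (Bin Add (Bin Mul (Lit 16) e) (Lit a)) (Reg 2).

Fixpoint cexpr (e : aexpr) : expr :=
  match e with
  | ALit k => Lit k
  | AVar r => Reg r
  | AGet a e => Read (addr a (cexpr e))
  | ABin o e1 e2 => Bin o (cexpr e1) (cexpr e2)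
  end.

Fixpoint compile (c : acmd) : cmd :=
  match c with
  | ASkip => Skip
  | ASet r e => Assign r (cexpr e)
  | APut a e1 e2 => Write (addr a (cexpr e1)) (cexpr e2)
  | ASeq c1 c2 => Seq (compile c1) (compile c2)
  | AIf e c1 c2 => If (cexpr e) (compile c1) (compile c2)
  | AWhile e c => While (cexpr e) (compile c)
  end.

Definition acost (e : aexpr) : nat := expr_cost (cexpr e).
Definition pcost (a : nat) (e1 e2 : aexpr) : nat :=
  (expr_cost (addr a (cexpr e1)) + acost e2).+1.

Fixpoint vmod (c : acmd) (r : nat) : bool :=
  match c with
  | ASet r' _ => Nat.eqb r r'
  | ASeq c1 c2 | AIf _ c1 c2 => vmod c1 r || vmod c2 r
  | AWhile _ c => vmod c r
  | _ => false
  end.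

Fixpoint amod (c : acmd) (a : nat) : bool :=
  match c with
  | APut a' _ _ => Nat.eqb a a'
  | ASeq c1 c2 | AIf _ c1 c2 => amod c1 a || amod c2 a
  | AWhile _ c => amod c a
  | _ => false
  end.

(** A syntactic frame condition: [vmod] and [amod] compute on concrete programs, so that each
    preservation fact is obtained with [erefl]. *)
Definition aframe (c : acmd) (st st' : astate) : Prop :=
  (forall r, vmod c r = false -> vars st' r = vars st r) /\
  (forall a, amod c a = false -> arrs st' a = arrs st a).

(* An expression whose leaves are at most [q] has value at most
   [q ^ adeg e]. *)
Fixpoint adeg (e : aexpr) : nat :=
  match e with
  | ALit _ | AVar _ => 1
  | AGet _ e => adeg e + 4
  | ABin _ e1 e2 => adeg e1 + adeg e2
  end.

Fixpoint wfe (e : aexpr) : bool :=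
  match e with
  | ALit k => k <= 16
  | AVar _ => true
  | AGet a e => (a < 16) && wfe e
  | ABin _ e1 e2 => wfe e1 && wfe e2
  end.

(** A closed boolean test, settled by computation. The gap between 40 and the exponent 50 of the
    word bound leaves room for the address arithmetic. *)
Definition okexpr e := wfe e && (adeg e <= 40).

(** * A logic for total correctness, running time and word size *)

Section Logic.

Variables (w q base : nat).
Hypothesis q16 : 16 <= q.
Hypothesis qw : forall x, x <= q ^ 50 -> x < 2 ^ w.
Hypothesis base_gt0 : 0 < base.

Definition bounded (st : astate) : Prop :=
  (forall r, vars st r <= q) /\ (forall a k, arrs st a k <= q).

Definition represents (st : astate) (s : state) : Prop :=
  [/\ regs s =1 vars st, vars st 2 = base, bounded st,
      forall k, k < base -> mem s k = arrs st 0 k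
    & forall a k, 0 < a < 16 -> mem s (16 * k + a + base) = arrs st a k].

(** Reading array 0 modulo [base], as [addr] does, keeps every access to it inside the input, so
    that reads need no range condition. *)
Fixpoint aeval (st : astate) (e : aexpr) : nat :=
  match e with
  | ALit k => k
  | AVar r => vars st r
  | AGet a e => arrs st a (if a is 0 then aeval st e %% base else aeval st e)
  | ABin o e1 e2 => abinop o (aeval st e1) (aeval st e2)
  end.

Lemma leq_exp d1 d2 x : d1 <= d2 -> x <= q ^ d1 -> x <= q ^ d2.
Proof. by move=> h hx; apply: leq_trans hx _; rewrite leq_pexp2l //; lia. Qed.

Lemma exp_small d x : d <= 50 -> x <= q ^ d -> x %% 2 ^ w = x.
Proof.
by move=> hd hx; apply/modn_small/qw; exact: leq_exp hd hx.
Qed.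

(** Both powers are at least 2, and then their sum is at most their product. Hence an addition costs
    no more degree than a multiplication. *)
Lemma leq_addexp d1 d2 x y : 0 < d1 -> 0 < d2 ->
  x <= q ^ d1 -> y <= q ^ d2 -> x + y <= q ^ (d1 + d2).
Proof.
move=> h1 h2 hx hy; rewrite expnD.
have : q <= q ^ d1 by rewrite -{1}(expn1 q) leq_pexp2l //; lia.
have : q <= q ^ d2 by rewrite -{1}(expn1 q) leq_pexp2l //; lia.
by move: (q ^ d1) (q ^ d2) hx hy => A B; nia.
Qed.

Lemma adeg_gt0 e : 0 < adeg e.
Proof. by elim: e => //= *; lia. Qed.

Lemma abinop_le o x y d1 d2 : 0 < d1 -> 0 < d2 -> x <= q ^ d1 -> y <= q ^ d2 ->
  abinop o x y <= q ^ (d1 + d2).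
Proof.
move=> h1 h2 hx hy.
have e0 : 0 < q ^ (d1 + d2) by rewrite expn_gt0; lia.
have hx' : x <= q ^ (d1 + d2) by apply: leq_exp hx; lia.
case: o => /=.
- exact: leq_addexp.
- by rewrite (leq_trans (leq_subr _ _)).
- by rewrite expnD leq_mul.
- by rewrite (leq_trans (leq_div _ _)).
- by rewrite (leq_trans (leq_mod _ _)).
- by case: (x == y).
- by case: (x < y).
Qed.

Lemma binop_semE o a b : binop_sem w o a b = abinop o a b %% 2 ^ w.
Proof. by case: o. Qed.

Lemma addr_eval st s a e : represents st s -> a < 16 -> adeg e <= 40 ->
  eval w s (cexpr e) = aeval st e -> aeval st e <= q ^ adeg e ->
  eval w s (addr a (cexpr e)) =
  (if a is 0 then aeval st e %% base else 16 * aeval st e + a + base).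
Proof.
case=> hr h2 [hv _] _ _ ha hd he hq.
have hb : base <= q ^ 1 by rewrite expn1 -h2.
have d0 := adeg_gt0 e.
case: a ha => [|a] ha /=; rewrite he hr h2 !binop_semE /=.
  apply: (@exp_small (adeg e)); first by lia.
  exact: leq_trans (leq_mod _ _) hq.
have l16 : 16 %% 2 ^ w = 16 by apply: (@exp_small 1) => //; rewrite expn1.
have la : a.+1 %% 2 ^ w = a.+1 by apply: (@exp_small 1) => //; rewrite expn1; lia.
have b1 : 16 * aeval st e <= q ^ (1 + adeg e).
  by rewrite expnD leq_mul // expn1.
have b2 : 16 * aeval st e + a.+1 <= q ^ (1 + adeg e + 1).
  by apply: leq_addexp => //; rewrite expn1; lia.
have b3 : 16 * aeval st e + a.+1 + base <= q ^ (1 + adeg e + 1 + 1).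
  by apply: leq_addexp => //; lia.
rewrite l16 la (exp_small _ b1); last by lia.
rewrite (exp_small _ b2); last by lia.
by rewrite (exp_small _ b3) //; lia.
Qed.

Lemma cexpr_eval st s e : represents st s -> okexpr e ->
  eval w s (cexpr e) = aeval st e /\ aeval st e <= q ^ adeg e.
Proof.
move=> hrep /andP[].
have [hr h2 [hv ha] hi hm] := hrep.
elim: e => [k|r|a e IH|o e1 IH1 e2 IH2] /=.
- move=> hk _; have hq : k <= q ^ 1 by rewrite expn1; lia.
  by rewrite (exp_small _ hq).
- by rewrite hr expn1.
- move=> /andP[a16 wf] hd.
  have [|he hq] := IH wf; first by lia.
  rewrite (addr_eval hrep a16 _ he hq); last by lia.
  split; last first.
    by apply: (@leq_exp 1); [rewrite addn_gt0 adeg_gt0|rewrite expn1].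
  case: a a16 => [|a] a16; first by rewrite hi // ltn_mod.
  exact: hm.
- move=> /andP[w1 w2] hd.
  have [|E1 B1] := IH1 w1; first by lia.
  have [|E2 B2] := IH2 w2; first by lia.
  have B : abinop o (aeval st e1) (aeval st e2) <= q ^ (adeg e1 + adeg e2).
    by apply: abinop_le => //; exact: adeg_gt0.
  rewrite E1 E2 binop_semE; split=> //; apply: exp_small B; lia.
Qed.

(** Runs are unique, so the existence of a run amounts to total correctness. The postcondition sees
    the exact time; [represents] carries the bound [q] on all stored values over to the final
    state. *)
Definition wp (c : acmd) (st : astate) (P : nat -> astate -> Prop) : Prop :=
  forall s, represents st s -> exists t s' st',
    [/\ exec w (compile c) s t s', represents st' s', aframe c st st'
      & P t st'].

Lemma wp_conseq c st (P P' : nat -> astate -> Prop) : wp c st P ->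
  (forall t st', aframe c st st' -> bounded st' -> P t st' -> P' t st') ->
  wp c st P'.
Proof.
move=> h imp s /h[t [s' [st' [ex rp fr p]]]].
by exists t, s', st'; split=> //; apply: imp => //; case: rp.
Qed.

Lemma wp_bounded c st P : (bounded st -> wp c st P) -> wp c st P.
Proof. by move=> h s hr; apply: h (hr); case: hr. Qed.

Lemma wp_skip st (P : nat -> astate -> Prop) : P 1 st -> wp ASkip st P.
Proof. by move=> h s hs; exists 1, s, st; split=> //; exact: ExecSkip. Qed.

Lemma wp_set r e st (P : nat -> astate -> Prop) :
  okexpr e && (r != 2) -> (bounded st -> aeval st e <= q) ->
  P (acost e).+1 (setv st r (aeval st e)) -> wp (ASet r e) st P.
Proof.
case/andP=> ok r2 + h s hs; move=> /(_ (let: And5 _ _ b _ _ := hs in b)) hq.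
exists (acost e).+1, (State (upd (regs s) r (eval w s (cexpr e))) (mem s)).
exists (setv st r (aeval st e)); split=> //; first exact: ExecAssign.
- have [-> _] := cexpr_eval hs ok.
  case: hs => hr h2 [hv ha] hi hm; split=> //.
  + by move=> k; rewrite /=  /upd /fupd -hr; case: eqP; case: PeanoNat.Nat.eqb_spec.
  + rewrite vars_setv /fupd; case: PeanoNat.Nat.eqb_spec => // E.
    by rewrite -E in r2.
  + by split=> // k; rewrite vars_setv /fupd; case: ifP.
- by split=> // k /= hk; rewrite /fupd hk.
Qed.

Lemma wp_put a e1 e2 st (P : nat -> astate -> Prop) :
  [&& okexpr e1, okexpr e2 & 0 < a < 16] ->
  (bounded st -> aeval st e2 <= q) ->
  P (pcost a e1 e2) (seta st a (aeval st e1) (aeval st e2)) ->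
  wp (APut a e1 e2) st P.
Proof.
case/and3P=> ok1 ok2 ha + h s hs; move=> /(_ (let: And5 _ _ b _ _ := hs in b)) hq.
exists (pcost a e1 e2), (State (regs s) (upd (mem s)
  (eval w s (addr a (cexpr e1))) (eval w s (cexpr e2)))).
exists (seta st a (aeval st e1) (aeval st e2)).
split=> //; first exact: ExecWrite.
- have [E1 B1] := cexpr_eval hs ok1; have [-> _] := cexpr_eval hs ok2.
  rewrite (addr_eval hs _ _ E1 B1); [|by case/andP: ha|by case/andP: ok1].
  case: hs {h} => hr h2 [hv hA] hi hm; split=> //=.
  + split=> //= a' k; rewrite /fupd; case: ifP => // _; rewrite /upd.
    by case: ifP.
  + move=> k hk; rewrite /upd /fupd.
    case: a ha => // a ha /=.
    case: eqP => [E|_]; [by lia|exact: hi].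
  + move=> a' k ha'; rewrite /upd /fupd.
    case: a ha => // a ha.
    case: PeanoNat.Nat.eqb_spec => [->|na].
      have -> : (16 * k + a.+1 + base == 16 * aeval st e1 + a.+1 + base) =
                (k == aeval st e1) by apply/eqP/eqP; lia.
      by case: ifP => // _; exact: hm.
    by case: eqP => [E|_]; [lia|exact: hm].
- by split=> // k /= hk; rewrite /fupd hk.
Qed.

Lemma aframe_seq c1 c2 st1 st2 st3 :
  aframe c1 st1 st2 -> aframe c2 st2 st3 -> aframe (ASeq c1 c2) st1 st3.
Proof.
case=> v1 a1 [v2 a2]; split=> k /= /norP[/negPf h1 /negPf h2].
  by rewrite v2 // v1.
by rewrite a2 // a1.
Qed.

Lemma wp_seq c1 c2 st (P : nat -> astate -> Prop) :
  wp c1 st (fun t1 st1 => wp c2 st1 (fun t2 st2 => P (t1 + t2) st2)) ->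
  wp (ASeq c1 c2) st P.
Proof.
move=> h s /h[t1 [s1 [st1 [ex1 rp1 fr1]]]] /(_ s1 rp1).
case=> t2 [s2 [st2 [ex2 rp2 fr2 p]]].
exists (t1 + t2), s2, st2; split=> //; first exact: ExecSeq ex1 ex2.
exact: aframe_seq fr1 fr2.
Qed.

Lemma aframe_if b e c1 c2 st st' :
  aframe (if b : bool then c1 else c2) st st' -> aframe (AIf e c1 c2) st st'.
Proof.
case=> v1 a1; split=> k /= /norP[/negPf h1 /negPf h2].
  by apply: v1; case: (b).
by apply: a1; case: (b).
Qed.

Lemma wp_if e c1 c2 st (P : nat -> astate -> Prop) : okexpr e ->
  (aeval st e != 0 -> wp c1 st (fun t => P (acost e + t).+1)) ->
  (aeval st e = 0 -> wp c2 st (fun t => P (acost e + t).+1)) ->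
  wp (AIf e c1 c2) st P.
Proof.
move=> ok h1 h2 s hs; have [E _] := cexpr_eval hs ok.
have [e0|e0] := eqVneq (aeval st e) 0.
  have [t [s' [st' [ex rp fr p]]]] := h2 e0 s hs.
  exists (acost e + t).+1, s', st'; split=> //.
    by apply: ExecIfFalse => //; rewrite E.
  exact: (@aframe_if false).
have [t [s' [st' [ex rp fr p]]]] := h1 e0 s hs.
exists (acost e + t).+1, s', st'; split=> //.
  by apply: ExecIfTrue => //; rewrite E.
exact: (@aframe_if true).
Qed.

(* Time is paid for by the potential [pot], which therefore also proves
   termination. *)
Lemma wp_while (I : astate -> Prop) (pot : astate -> nat) e c st
    (P : nat -> astate -> Prop) : okexpr e -> I st ->
  (forall st1, I st1 -> aframe c st st1 -> bounded st1 -> aeval st1 e != 0 ->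
     wp c st1 (fun t st2 => I st2 /\ acost e + t + pot st2 < pot st1)) ->
  (forall t st1, I st1 -> aframe c st st1 -> bounded st1 -> aeval st1 e = 0 ->
     t + pot st1 <= pot st + (acost e).+1 -> P t st1) ->
  wp (AWhile e c) st P.
Proof.
move=> ok I0 step fin s hs.
suff H : forall k st1 s1, pot st1 <= k -> I st1 -> aframe c st st1 ->
    represents st1 s1 ->
    exists t s' st', [/\ exec w (compile (AWhile e c)) s1 t s',
      represents st' s', aframe c st st',
      [/\ I st', bounded st' & aeval st' e = 0]
      & t + pot st' <= pot st1 + (acost e).+1].
  have [|t [s' [st' [ex rp fr [i bd z] le]]]] := H (pot st) st s (leqnn _) I0 _ hs.
    by split.
  by exists t, s', st'; split=> //; apply: fin.
elim=> [|k IH] st1 s1 hk i1 fr1 rp1; have [E _] := cexpr_eval rp1 ok;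
  (have bd1 : bounded st1 by case: rp1);
  have [e0|e0] := eqVneq (aeval st1 e) 0.
- exists (acost e).+1, s1, st1; split=> //; last by lia.
  by apply: ExecWhileFalse; rewrite E.
- have [t [s' [st' [_ _ _ [_ lt]]]]] := step st1 i1 fr1 bd1 e0 s1 rp1; lia.
- exists (acost e).+1, s1, st1; split=> //; last by lia.
  by apply: ExecWhileFalse; rewrite E.
- have [t [s2 [st2 [ex2 rp2 fr2 [i2 lt]]]]] := step st1 i1 fr1 bd1 e0 s1 rp1.
  have fr2' : aframe c st st2.
    case: fr1 fr2 => v1 a1 [v2 a2]; split=> r hr.
      by rewrite v2 // v1.
    by rewrite a2 // a1.
  have [|t' [s' [st' [ex rp fr h le]]]] := IH st2 s2 _ i2 fr2' rp2.
    by move: lt hk; lia.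
  exists (acost e + t + t').+1, s', st'; split=> //; last by move: lt le; lia.
  by apply: ExecWhileTrue ex2 ex; rewrite E.
Qed.

End Logic.

Declare Scope aexpr_scope.
Delimit Scope aexpr_scope with A.
Arguments AGet a e%_A.
Arguments ABin o (e1 e2)%_A.
Arguments ASet r e%_A.
Arguments APut a (e1 e2)%_A.
Arguments AIf e%_A c1 c2.
Arguments AWhile e%_A c.
Notation "# k" := (ALit k) (at level 1, format "# k") : aexpr_scope.
Notation "$ r" := (AVar r) (at level 1, format "$ r") : aexpr_scope.
Notation "a @[ e ]" := (AGet a e) (at level 2, format "a @[ e ]") : aexpr_scope.
Infix "+" := (ABin Add) : aexpr_scope.
Infix "-" := (ABin Defs.Sub) : aexpr_scope.
Infix "*" := (ABin Mul) : aexpr_scope.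
Infix "%/" := (ABin Div) : aexpr_scope.
Infix "==" := (ABin Eq) : aexpr_scope.
Infix "<" := (ABin Lt) : aexpr_scope.
Notation "c1 ;; c2" := (ASeq c1 c2) (at level 90, right associativity).

Ltac asimp := cbn [aeval abinop];
  rewrite ?vars_setv ?arrs_setv ?vars_seta ?arrs_seta; cbn [fupd Nat.eqb].

Ltac costs := rewrite /pcost; repeat match goal with
  | |- context [acost ?e] =>
    let k := eval vm_compute in (acost e) in change (acost e) with k
  | |- context [expr_cost ?e] =>
    let k := eval vm_compute in (expr_cost e) in change (expr_cost e) with k
  end.

(** * Levels in a graph *)

Ltac clia := cbv beta delta [reverse_coercion] in *; lia.

Section Levels.

Variable n : nat.
Implicit Types (e : rel 'I_n) (L : nat -> nat) (x y z : 'I_n).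

Definition walk e x y k := exists2 p, path e x p & last x p = y /\ size p = k.

Definition lipschitz e L := forall x y, e x y -> L y <= (L x).+1.

(** Together with [lipschitz] this is the Even-Shiloach invariant: below the cap [M], [L x - L rt]
    is the distance from the root. The level of the root may be positive, because a moved root keeps
    its level. *)
Definition stable e M (rt : nat) L :=
  forall x, x != rt :> nat -> L x < M -> exists2 y, e x y & L y < L x.

Definition comp e x := [set y | connect e x y].

Lemma walk0 e x : walk e x x 0.
Proof. by exists [::]. Qed.

Lemma walk_connect e x y k : walk e x y k -> connect e x y.
Proof. by case=> p hp [<- _]; apply/connectP; exists p. Qed.

Lemma walk_rcons e x y z k : walk e x y k -> e y z -> walk e x z k.+1.
Proof.
case=> p hp [ly sp] yz; exists (rcons p z).
  by rewrite rcons_path hp ly.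
by rewrite last_rcons size_rcons sp.
Qed.

Lemma walk_cat e x y z k l : walk e x y k -> walk e y z l -> walk e x z (k + l).
Proof.
case=> p hp [ly sp] [r hr [lz sr]]; exists (p ++ r).
  by rewrite cat_path hp ly.
by rewrite last_cat ly lz size_cat sp sr.
Qed.

Lemma walk_sym e x y k : symmetric e -> walk e x y k -> walk e y x k.
Proof.
move=> se [p hp [<- <-]]; elim: p x hp => [|z p IH] x /=; first by exists [::].
by case/andP=> xz /IH/walk_rcons; apply; rewrite se.
Qed.

Lemma lipschitz_walk e L x y k : lipschitz e L -> walk e x y k -> L y <= L x + k.
Proof.
move=> lip [p hp [<- <-]]; elim: p x hp => [|z p IH] x /=; first by rewrite addn0.
by case/andP=> /lip xz /IH; move: xz; lia.
Qed.

(** By the Lipschitz condition a lower neighbor is exactly one level lower, and the descent can stop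
    only at the root. *)
Lemma stable_walk e L M (rt : 'I_n) x :
  symmetric e -> lipschitz e L -> stable e M rt L ->
  (forall y, L rt <= L y) -> L x < M -> walk e rt x (L x - L rt).
Proof.
move=> se lip st low; have [k] := ubnP (L x).
elim: k x => // k IH x hk hM; have [->|nx] := eqVneq x rt.
  by rewrite subnn; exact: walk0.
have [y xy yx] := st x nx hM.
have yx' : e y x by rewrite se.
have := lip _ _ yx' => l1.
have -> : L x - L rt = (L y - L rt).+1 by have := low y; lia.
by apply: walk_rcons yx'; apply: IH => //; lia.
Qed.

Lemma connect_small_walk e x y :
  connect e x y -> exists2 k, k < #|comp e x| & walk e x y k.
Proof.
case/connectP=> p hp ->; case/shortenP: hp => p' hp' up' _.
exists (size p'); last by exists p'.
rewrite -[(size p').+1]/(size (x :: p')) -(card_uniqP up').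
apply/subset_leq_card/subsetP=> z; rewrite !inE => /orP[/eqP->|].
  exact: connect0.
move=> zin; apply/connectP; case/splitPr: zin hp' => p1 p2.
rewrite cat_path /= => /and3P[h1 h2 _].
by exists (rcons p1 z); rewrite ?rcons_path ?h1 ?last_rcons.
Qed.

(** A discrete intermediate value theorem, as the level rises by at most one along an edge. *)
Lemma level_between e L x y l : lipschitz e L -> connect e x y ->
  L x <= l <= L y -> exists2 z, connect e x z & L z = l.
Proof.
move=> lip /connectP[p hp ->]; elim: p x hp => [|z p IH] x /=.
  by move=> _ h; exists x => //; lia.
case/andP=> xz hp h; have [xl|xl] := eqVneq (L x) l.
  by exists x.
case/andP: h => h1 h2; have [|t zt tl] := IH z hp.
  by rewrite h2 andbT (leq_trans (lip _ _ xz)) // ltn_neqAle xl.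
by exists t => //; apply: connect_trans zt; exact: connect1.
Qed.

Lemma card_levels (S : {set 'I_n}) L a b :
  (forall l, a <= l < b -> exists2 z, z \in S & L z = l) -> b - a <= #|S|.
Proof.
move=> h; rewrite -(size_iota a (b - a)) cardE -(size_map (fun x : 'I_n => L x)).
apply: uniq_leq_size; first exact: iota_uniq.
move=> l; rewrite mem_iota => hl; have [|z zS <-] := h l; first by lia.
by apply/mapP; exists z; rewrite // mem_enum.
Qed.

(** Either the whole component lies below level [k], or it reaches level [k] and then has a vertex
    on each level from [L x] up to [k - 1]. *)
Lemma ball_card e L x k : lipschitz e L ->
  minn #|comp e x| (k - L x) <= #|[set y in comp e x | L y < k]|.
Proof.
move=> lip; have [/forallP all|] :=
    boolP [forall y, (y \in comp e x) ==> (L y < k)].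
  rewrite geq_min; apply/orP; left; apply/subset_leq_card/subsetP=> y yc.
  by rewrite inE yc; have := all y; rewrite yc.
rewrite negb_forall => /existsP[y]; rewrite negb_imply inE -leqNgt => /andP[xy ky].
rewrite geq_min; apply/orP; right; apply: (@card_levels _ L) => l hl.
have [|z xz zl] := level_between (l := l) lip xy; first by lia.
by exists z => //; rewrite !inE xz; lia.
Qed.

Lemma closed_connect e (S : pred 'I_n) x y :
  (forall x y, e x y -> S x -> S y) -> connect e x y -> S x -> S y.
Proof.
move=> cl /connectP[p hp ->]; elim: p x hp => [|z p IH] x //=.
by case/andP=> /cl h /IH h' /h.
Qed.

Lemma comp_eq e x y : symmetric e -> connect e x y -> comp e x = comp e y.
Proof.
move=> se xy; apply/setP=> z; rewrite !inE.
exact: (same_connect (sym_connect_sym se)).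
Qed.

End Levels.

Arguments walk {n}.
Arguments lipschitz {n}.
Arguments stable {n}.
Arguments comp {n}.

(** * Charging the centers *)

Section Charge.

Variable n : nat.
Implicit Types (e : rel 'I_n) (L : nat -> nat) (x y z : 'I_n).

Definition del_edge e0 e (u v : 'I_n) :=
  (forall x y, e x y -> e0 x y) /\
  (forall x y, e0 x y -> [\/ e x y, x = u /\ y = v | x = v /\ y = u]).

Lemma del_comp_sub e0 e u v x : del_edge e0 e u v -> comp e x \subset comp e0 x.
Proof.
case=> sub _; apply/subsetP=> y; rewrite !inE.
by apply: connect_sub => a b /sub; exact: connect1.
Qed.

(** Extending a path of [e0] edge by edge: crossing the deleted edge for a second time leads back to
    an endpoint that is already connected to [a] in [e]. *)
Lemma del_connect e0 e u v a x : del_edge e0 e u v -> connect e0 a x ->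
  [\/ connect e a x, connect e a u /\ connect e v x
    | connect e a v /\ connect e u x].
Proof.
case=> _ del /connectP[p hp ->]; elim/last_ind: p hp => [|p y IH] /=.
  by move=> _; constructor 1.
rewrite rcons_path last_rcons => /andP[/IH H /del hy].
case: hy => [zy|[zu ->]|[zv ->]].
- have cy := connect1 zy; case: H => [H|[H1 H2]|[H1 H2]].
  + by constructor 1; exact: connect_trans H cy.
  + by constructor 2; split=> //; exact: connect_trans H2 cy.
  + by constructor 3; split=> //; exact: connect_trans H2 cy.
- case: H => [H|[H1 H2]|[H1 H2]].
  + by constructor 2; rewrite -zu.
  + by constructor 2.
  + by constructor 1.
- case: H => [H|[H1 H2]|[H1 H2]].
  + by constructor 3; rewrite -zv.
  + by constructor 1.
  + by constructor 3.
Qed.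

(** The old component falls into at most two parts, so two separated vertices [a] and [w] identify
    both of them. *)
Lemma del_connect3 e0 e u v a w x : symmetric e -> del_edge e0 e u v ->
  connect e0 a w -> connect e0 a x -> ~~ connect e a w ->
  connect e a x \/ connect e w x.
Proof.
move=> se del aw ax naw.
have cs := sym_connect_sym se.
have tr a' b' c' : connect e a' b' -> connect e b' c' -> connect e a' c'.
  by move=> h; exact: connect_trans h.
case: (del_connect del aw) => [|[au vw]|[av uw]]; first by rewrite (negPf naw).
- case: (del_connect del ax) => [|[_ vx]|[av ux]]; first by left.
    by right; apply: tr vx; rewrite cs.
  by move: naw; rewrite (tr _ _ _ av vw).
- case: (del_connect del ax) => [|[au vx]|[_ ux]]; first by left.
    by move: naw; rewrite (tr _ _ _ au uw).
  by right; apply: tr ux; rewrite cs.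
Qed.

Lemma cardsU_disj (A B : {set 'I_n}) : [disjoint A & B] -> #|A :|: B| = #|A| + #|B|.
Proof. by rewrite -leq_card_setU => /eqP. Qed.

(** [Ret] collects vertices of small components that the center has left. A root of level [L rt]
    lacks that many of the levels below [h], and the retired vertices replace them. Once [h]
    vertices are retired, they pay for the center whatever happens to it later. *)
Definition retired_ok e h (Ret : {set 'I_n}) (rt : 'I_n) L :=
  (forall x, x \in Ret -> #|comp e x| < h) /\
  (h <= #|Ret| \/ (L rt <= #|Ret| /\ h <= #|comp e rt|)).

Definition used h L (Ret : {set 'I_n}) := [set x : 'I_n | L x < h] :|: Ret.

Lemma disjoint_retired e h (Ret : {set 'I_n}) (A : {set 'I_n}) :
  (forall x, x \in Ret -> #|comp e x| < h) ->
  (forall x, x \in A -> h <= #|comp e x|) -> [disjoint Ret & A].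
Proof.
move=> hr hA; apply/pred0P=> x /=; apply/negP=> /andP[/hr h1 /hA]; clia.
Qed.

(** At least [h - L rt] vertices of the component of the root have level below [h], and at least
    [L rt] are retired. The two sets are disjoint, since the former lie in a large component and the
    latter in small ones. *)
Lemma used_card e h L (Ret : {set 'I_n}) (rt : 'I_n) : symmetric e ->
  lipschitz e L -> retired_ok e h Ret rt L -> h <= #|used h L Ret|.
Proof.
move=> se lip [sm [big|[lo hb]]].
  by apply: leq_trans big _; apply/subset_leq_card/subsetUr.
set B := [set x in comp e rt | L x < h].
have dis : [disjoint Ret & B].
  apply: disjoint_retired sm _ => x; rewrite !inE => /andP[cx _].
  by rewrite -(comp_eq se cx).
have hB : h - L rt <= #|B|.
  by have := ball_card rt h lip; rewrite -/B; clia.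
apply: (@leq_trans #|Ret :|: B|).
  by rewrite cardsU_disj //; apply: leq_trans (leq_add lo hB); rewrite -leq_subLR.
apply/subset_leq_card; rewrite subUset subsetUr /=.
by apply: subset_trans (subsetUl _ _); apply/subsetP=> x; rewrite !inE => /andP[].
Qed.

(** Holds until a level is vacated for the first time. A vertex of the old tree that has reached the
    cap then leaves all levels below it occupied, which shows that the component of the center is
    still large. *)
Definition nogap M L0 L (rt : 'I_n) :=
  forall x, L0 x < M -> forall l, L rt <= l -> l <= L x -> l < M ->
  exists y : 'I_n, L y = l.

(* The levels [Lt] when a vertex [w] of level [l] was about to be raised while
   no other vertex had its level, so that the component of the center is the
   set of the vertices of level less than [l]. *)
Definition triggered e h M L0 (rt0 : 'I_n) L (rt : 'I_n) :=
  exists (Lt : nat -> nat) (w : 'I_n) (l : nat),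
  [/\ [/\ forall x, L0 x <= Lt x, Lt rt0 = L0 rt0,
          Lt w = l, L0 rt0 < l & l < M],
      [/\ lipschitz e Lt, nogap M L0 Lt rt0,
          forall x, L0 rt0 <= Lt x,
          forall x, Lt x <= L x
        & forall x y, e x y -> Lt x < l -> Lt y < l]
    & [/\ rt = rt0, L rt = L0 rt0
        & h <= l \/ h <= #|[set x : 'I_n | Lt x < l]|] \/
      [/\ l < h, #|[set x : 'I_n | Lt x < l]| < h, rt = w & L w = l]].

(** Levels never decrease and only vertices whose old level is below [h] are newly retired.
    Therefore the used set can only shrink, and used sets of different centers stay disjoint. *)
Lemma retired_step e0 e u v h M L0 (rt0 : 'I_n) L (rt : 'I_n) (Ret : {set 'I_n}) :
  symmetric e0 -> symmetric e -> del_edge e0 e u v ->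
  lipschitz e0 L0 -> stable e0 M rt0 L0 -> (forall x, L0 rt0 <= L0 x) ->
  L0 rt0 < h -> h + h <= M -> retired_ok e0 h Ret rt0 L0 ->
  lipschitz e L -> stable e M rt L -> (forall x, L rt <= L x <= M) ->
  (forall x, L0 x <= L x) ->
  ([/\ rt = rt0, L rt = L0 rt0 & nogap M L0 L rt] \/
   triggered e h M L0 rt0 L rt) ->
  exists Ret', retired_ok e h Ret' rt L /\ used h L Ret' \subset used h L0 Ret.
Proof.
move=> se0 se del lip0 st0 low0 oh hM [sm rok] lip st low up hist.
have sm' x : x \in Ret -> #|comp e x| < h.
  move/sm; apply: leq_ltn_trans; exact/subset_leq_card/(del_comp_sub _ del).
have usub (R : {set 'I_n}) : (forall x, x \in R -> x \in Ret \/ L0 x < h) ->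
    used h L R \subset used h L0 Ret.
  move=> hR; apply/subsetP=> x; rewrite !inE => /orP[lx|].
    by rewrite (leq_ltn_trans (up x) lx).
  by case/hR => ->; rewrite ?orbT.
case: rok => [big|[oRet C0]].
  exists Ret; split; first by split=> //; left.
  by apply: usub => x; left.
have reach0 x : L0 x < M -> connect e0 rt0 x.
  by move=> hx; exact: walk_connect (stable_walk se0 lip0 st0 low0 hx).
have reach x : L x < M -> connect e rt x.
  move=> hx; apply: walk_connect (stable_walk se lip st _ hx).
  by move=> y; case/andP: (low y).
case: hist => [[Ert Lrt ng]|].
  exists Ret; split; last by apply: usub => x; left.
  split=> //; right; rewrite Lrt; split=> //; subst rt.
  (* If a vertex of the old tree has reached the cap, each level from [L rt] to [M - 1] is occupied
     by a vertex reachable from [rt], and [M - L rt >= h]. Otherwise the tree has lost no vertex. *)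
  have [/existsP[x /andP[x0 xM]]|] := boolP [exists x : 'I_n, (L0 x < M) && (M <= L x)].
    apply: (@leq_trans (M - L0 rt0)); first by clia.
    apply: (@card_levels _ _ L) => l hl.
    have [||//|y yl] := ng x x0 l; [by clia|by clia|by clia|].
    by exists y => //; rewrite inE; apply: reach; clia.
  rewrite negb_exists => /forallP all.
  have := ball_card rt0 M lip0.
  have : #|[set y in comp e0 rt0 | L0 y < M]| <= #|comp e rt0|.
    apply/subset_leq_card/subsetP=> y; rewrite !inE => /andP[_ y0].
    by apply: reach; have := all y; rewrite y0 /= -ltnNge.
  by clia.
case=> Lt [w [l [[up0 Ltrt Ltw ol lM] [lipt ng lowt upt cl] mv]]].
set S := [set x : 'I_n | Lt x < l] in mv.
set A := comp e rt0; set B := comp e w.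
have cs := sym_connect_sym se.
have cl' x y : connect e x y -> Lt x < l -> Lt y < l.
  by apply: (closed_connect (S := fun z : 'I_n => Lt z < l)) => a b /cl.
(* The set [S] of the lower levels is closed and contains the root but not [w]. So the deletion has
   separated the two, and [A] and [B] are the parts of the old component. *)
have naw : ~~ connect e rt0 w.
  by apply/negP=> /cl'; rewrite Ltw Ltrt; clia.
have rw : connect e0 rt0 w by apply: reach0; have := up0 w; clia.
have AB x : connect e0 rt0 x -> x \in A \/ x \in B.
  by move=> hx; rewrite !inE; exact: del_connect3 se del rw hx naw.
have SA : S = A.
  apply/setP=> x; apply/idP/idP; rewrite !inE => hx.
    have [||] := AB x; rewrite ?inE //.
      by apply: reach0; have := up0 x; clia.
    by rewrite cs => /cl' /(_ hx); rewrite Ltw; clia.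
  by apply: cl' hx _; rewrite Ltrt.
have bigcomp x : x \in A \/ x \in B -> connect e0 rt0 x.
  rewrite !inE => -[hx|hx].
    by have /subsetP := del_comp_sub rt0 del; move/(_ x); rewrite !inE; apply.
  apply: connect_trans rw _.
  by have /subsetP := del_comp_sub w del; move/(_ x); rewrite !inE; apply.
have disR (R : {set 'I_n}) : (forall x, x \in R -> x \in A \/ x \in B) ->
    [disjoint Ret & R].
  move=> hR; apply: (disjoint_retired (e := e0)) sm _ => x /hR /bigcomp hx.
  by rewrite -(comp_eq se0 hx).
have smA x : x \in A -> comp e x = A.
  by rewrite inE => hx; rewrite -(comp_eq se hx).
have smB x : x \in B -> comp e x = B.
  by rewrite inE => hx; rewrite -(comp_eq se hx).
have lev k : L0 rt0 <= k <= l -> exists y : 'I_n, Lt y = k.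
  by move=> hk; apply: (ng w) => //; rewrite ?Ltrt ?Ltw; have := up0 w; clia.
(* A center moves only if [S], which equals [A], is small; for large [A] it stays and nothing is
   retired. *)
have [hA|hA] := leqP h #|A|.
  case: mv => [[Ert Lrt _]|[_]]; last by rewrite SA; clia.
  exists Ret; split; last by apply: usub => x; left.
  by split=> //; right; rewrite Lrt Ert.
(* If the center stayed in a small component, the vacated level [l] is at least [h]. Then all levels
   from [L0 rt0] to [h - 1] are occupied inside [A], and retiring these vertices completes [Ret] to
   [h] elements. *)
case: mv => [[Ert Lrt]|[lh _ Ert Lw]].
  rewrite SA => -[hl|]; last by clia.
  set A' := [set x in A | Lt x < h].
  have hA' : h - L0 rt0 <= #|A'|.
    apply: (@card_levels _ _ Lt) => k hk.
    have [|y yk] := lev k; first by clia.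
    by exists y => //; rewrite inE yk -SA inE yk; clia.
  exists (Ret :|: A'); split; last first.
    apply: usub => x; rewrite !inE => /orP[|/andP[_ hx]]; first by left.
    by right; exact: leq_ltn_trans (up0 x) hx.
  split=> [x|].
    by rewrite !in_setU => /orP[/sm'//|]; rewrite inE => /andP[/smA-> _].
  left; rewrite cardsU_disj; first by apply: leq_trans (leq_add oRet hA'); rewrite -leq_subLR.
  by apply: disR => x; rewrite inE => /andP[]; left.
(* The center has moved from level [L0 rt0] to [l]. The levels in between are occupied inside [A],
   so retiring [A] pays for the rise of the root. *)
have hA' : l - L0 rt0 <= #|A|.
  apply: (@card_levels _ _ Lt) => k hk.
  have [|y yk] := lev k; first by clia.
  by exists y => //; rewrite -SA inE yk; clia.
have Alow x : x \in A -> L0 x < h.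
  by rewrite -SA inE; have := up0 x; clia.
have dRA : [disjoint Ret & A] by apply: disR => x; left.
have [hB|hB] := leqP h #|B|.
  exists (Ret :|: A); split; last first.
    by apply: usub => x; rewrite in_setU => /orP[|/Alow]; [left|right].
  split=> [x|]; first by rewrite in_setU => /orP[/sm'//|/smA->].
  by right; rewrite Ert Lw cardsU_disj //; split=> //; clia.
(* Both parts are small, and vertices of [B] are retired as well: either all of [B], where [A] and
   [B] together have at least [h] elements, or at least [h - l] of them in addition to the at least
   [l] elements of [Ret] and [A]. *)
set B' := [set x in B | Lt x < h].
have hB' := ball_card w h lipt; rewrite -/B -/B' Ltw in hB'.
have hAB : h <= #|A| + #|B|.
  apply: leq_trans C0 _; rewrite -cardsUI -[X in X <= _]addn0 leq_add //.
  by apply/subset_leq_card/subsetP=> x; rewrite inE in_setU => /AB[]->; rewrite ?orbT.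
have dAB' : [disjoint A & B'].
  apply/pred0P=> x /=; apply/negP=> /andP[]; rewrite !inE => h1 /andP[h2 _].
  by case/negP: naw; apply: connect_trans h1 _; rewrite cs.
have dRB : [disjoint Ret & B'].
  by apply: disR => x; rewrite inE => /andP[]; right.
have dRAB : [disjoint Ret :|: A & B'].
  apply/pred0P=> x /=; rewrite in_setU; apply/negP=> /andP[/orP[] h1 h2].
    by move/pred0P: dRB => /(_ x) /=; rewrite h1 h2.
  by move/pred0P: dAB' => /(_ x) /=; rewrite h1 h2.
exists (Ret :|: A :|: B'); split; last first.
  apply: usub => x; rewrite in_setU in_setU => /orP[/orP[|/Alow]|].
  - by left.
  - by right.
  - by rewrite inE => /andP[_ hx]; right; exact: leq_ltn_trans (up0 x) hx.
split=> [x|].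
  rewrite in_setU in_setU => /orP[/orP[/sm'//|/smA->//]|].
  by rewrite inE => /andP[/smB-> _].
by left; rewrite cardsU_disj // cardsU_disj //; clia.
Qed.

End Charge.

(** * Maintaining the levels of one center *)

(* The levels, the positions of the scans of the adjacency lists, the numbers
   of vertices per level, the center, and the number of vertices whose level is
   less than the cap. *)
Record tree := Tree {
  tL : nat -> nat; tP : nat -> nat; tC : nat -> nat; tR : nat; tN : nat
}.

Lemma sum_upd n (F : nat -> nat -> nat) (L : nat -> nat) (v : 'I_n) a :
  \sum_(x < n) F x (upd L v a x) + F v (L v) = \sum_(x < n) F x (L x) + F v a.
Proof.
rewrite (bigD1 v) //= (bigD1 v (F := fun x : 'I_n => F x (L x))) //=.
rewrite /upd eqxx.
rewrite (eq_bigr (fun x : 'I_n => F x (L x))); first by lia.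
by move=> x /negPf nx; rewrite -[(x : nat) == v]/(x == v) nx.
Qed.

Lemma sum_one n (p : pred nat) (v : 'I_n) : p v ->
  \sum_(x < n) (p x : nat) = 1 -> forall y : 'I_n, p y -> y = v.
Proof.
move=> pv; rewrite (bigD1 v) //= pv => -[] /eqP; rewrite sum_nat_eq0.
move=> /forallP h y py; apply/eqP; apply: contraTT py => ny.
by have := h y; rewrite ny /=; case: (p y).
Qed.

Lemma sum_other n (p : pred nat) (v : 'I_n) : p v ->
  \sum_(x < n) (p x : nat) != 1 -> exists2 y : 'I_n, p y & y != v.
Proof.
move=> pv; rewrite (bigD1 v) //= pv add1n eqSS sum_nat_eq0 negb_forall.
case/existsP=> y; rewrite negb_imply => /andP[ny py]; exists y => //.
by case: (p y) py.
Qed.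

Lemma sum_card n (p : pred nat) :
  \sum_(x < n) (p x : nat) = #|[set x : 'I_n | p x]|.
Proof. by rewrite -sum1dep_card [RHS]big_mkcond; apply: eq_bigr => x; case: (p x). Qed.

Section Run.

Variables (n M h : nat) (e : rel 'I_n) (off nb : nat -> nat).
Hypothesis esym : symmetric e.

Definition deg x := off x.+1 - off x.

Definition adjacency_lists (e : rel 'I_n) :=
  [/\ forall x, x < n -> off x <= off x.+1,
      forall x k, x < n -> off x <= k < off x.+1 -> nb k < n
    & forall x y : 'I_n, e x y -> exists2 k, k < deg x & nb (off x + k) = y].

Hypothesis csr : adjacency_lists e.

(** Since levels only rise, a neighbor passed by the scan stays at least as high as [x] until [x]
    itself rises; a list is thus scanned once per level. The premise [e x y] is there because
    deleted edges stay in the lists. *)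
Definition scanned (L P : nat -> nat) :=
  forall x : 'I_n, P x <= deg x /\
  forall k (y : 'I_n), k < P x -> nb (off x + k) = y -> e x y -> L x <= L y.

Definition accurate (tr : tree) :=
  (forall l, l < M -> tC tr l = \sum_(x < n) (tL tr x == l)) /\
  tN tr = \sum_(x < n) (tL tr x < M).

Record tree_pre (tr : tree) (r : 'I_n) : Prop := TreePre {
  tp_root : tR tr = r;
  tp_rooth : tL tr r < h;
  tp_low : forall x : 'I_n, tL tr r <= tL tr x <= M;
  tp_lip : lipschitz e (tL tr);
  tp_scan : scanned (tL tr) (tP tr);
  tp_acc : accurate tr
}.

(** Bounds all future pushes, as raising [x] pushes [deg x] entries. It keeps the stack small enough
    for its size to be stored. *)
Definition tree_space (tr : tree) := \sum_(x < n) (M - tL tr x) * deg x.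

(** The 1200 per list entry and level split into 200 for the entry pushed on the stack, 400 for the
    new scan and 600 for the raise itself. The last term pays for moves, which take time linear in
    [n] and raise the root below [h]. *)
Definition tree_pot (tr : tree) :=
  1200 * \sum_(x < n) (M - tL tr x) * (deg x).+1 +
  400 * \sum_(x < n) (deg x - tP tr x) +
  500 * ((h - tL tr (tR tr)) * n.+1).

Variables (L0 : nat -> nat) (r0 : 'I_n) (f0 SB : nat).

(** The flag [f] records that a vacated level has been dealt with; from then on gaps are allowed and
    no further move happens. A new center starts with [f0 = 1], so it cannot move while its tree is
    built. *)
Definition history (f : nat) (r : 'I_n) (L : nat -> nat) :=
  [\/ [/\ f = 0, f0 = 0, r = r0, L r = L0 r0 & nogap M L0 L r],
      [/\ f = 1, f0 = 1, r = r0 & L r = L0 r0]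
    | [/\ f = 1, f0 = 0 & triggered e h M L0 r0 L r]].

Record run_inv (tr : tree) (sp : nat) (stk : nat -> nat) (f : nat) (r : 'I_n)
    : Prop := RunInv {
  ri_pre : tree_pre tr r;
  ri_stk : forall k, k < sp -> stk k < n;
  ri_bad : forall x : 'I_n, x != r :> nat -> tL tr x < M ->
    (exists2 y, e x y & tL tr y < tL tr x) \/ (exists2 k, k < sp & stk k = x);
  ri_space : sp + tree_space tr <= SB;
  ri_up : forall x : 'I_n, L0 x <= tL tr x;
  ri_hist : history f r (tL tr)
}.

(** The last term pays for the single summation over levels below [h] that a deletion can cause in a
    tree. *)
Definition run_pot (tr : tree) (sp f : nat) :=
  200 * sp + tree_pot tr + 1000 * ((1 - f) * h.+1).

Lemma inv_pop tr sp stk f r (v : 'I_n) : run_inv tr sp.+1 stk f r ->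
  stk sp = v ->
  [\/ v = r :> nat, tL tr v = M | exists2 y, e v y & tL tr y < tL tr v] ->
  run_inv tr sp stk f r.
Proof.
case=> pre hs hb hsp up hi sv ok; split=> //; last by lia.
  by move=> k hk; apply: hs; lia.
move=> x xr xM; case: (hb x xr xM) => [|[k hk kx]]; first by left.
have [ksp|ksp] := eqVneq k sp; last by right; exists k => //; lia.
have xv : x = v by apply: val_inj; rewrite /= -kx ksp.
move: xr xM; rewrite xv; case: ok => [->|->|]; rewrite ?eqxx ?ltnn //.
by left.
Qed.

Lemma inv_scan tr sp stk f r (v : 'I_n) P' : run_inv tr sp stk f r ->
  tP tr v < deg v ->
  ~~ [exists y : 'I_n, [&& nb (off v + tP tr v) == y, e v y & tL tr y < tL tr v]] ->
  P' = upd (tP tr) v (tP tr v).+1 ->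
  run_inv (Tree (tL tr) P' (tC tr) (tR tr) (tN tr)) sp stk f r.
Proof.
case=> -[hr hrh hlow hlip hsc hacc] hs hb hsp up hi hP hn ->.
split=> //; split=> //= x; rewrite /upd.
case: ifP => [/eqP/val_inj ->|_]; last exact: hsc.
split=> // k y hk ky vy.
have [kP|kP] := eqVneq k (tP tr v); last first.
  by case: (hsc v) => _; apply; [|exact: ky|]; [lia|].
rewrite leqNgt; apply: contra hn => lt; apply/existsP; exists y.
by rewrite -kP ky eqxx vy.
Qed.

Lemma scanned_nbr tr r (v y : 'I_n) : tree_pre tr r -> tP tr v = deg v ->
  e v y -> tL tr v <= tL tr y.
Proof.
case=> _ _ _ _ hsc _ hP vy; have [_ _ cpl] := csr.
have [k kd ky] := cpl _ _ vy.
by case: (hsc v) => _ /(_ k y); rewrite hP; apply.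
Qed.

Lemma sum_cnt tr l : accurate tr -> l <= M ->
  \sum_(k < l) tC tr k = \sum_(x < n) (tL tr x < l).
Proof.
case=> hC _; elim: l => [|l IH] hl.
  by rewrite big_ord0 big1.
rewrite big_ord_recr /= IH 1?hC; try lia.
rewrite -big_split /=; apply: eq_bigr => x _.
by rewrite ltnS; case: (ltngtP (tL tr x) l).
Qed.

(** All neighbors have been scanned, so none is below [v] and the Lipschitz condition survives. [v]
    stays on the stack, and its neighbors are pushed as [v] may have been their only lower neighbor.
    While the flag is 0, another vertex on the old level of [v] prevents a gap. *)
Lemma inv_raise tr sp stk f r (v : 'I_n) tr' stk' :
  run_inv tr sp.+1 stk f r -> stk sp = v -> v != r :> nat -> tL tr v < M ->
  tP tr v = deg v -> (f = 0 -> tC tr (tL tr v) != 1) ->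
  (forall k, k < sp.+1 -> stk' k = stk k) ->
  (forall k, k < deg v -> stk' (sp.+1 + k) = nb (off v + k)) ->
  tL tr' = upd (tL tr) v (tL tr v).+1 ->
  tP tr' = upd (tP tr) v 0 ->
  (forall l, l < M -> tC tr' l = tC tr l - (l == tL tr v) + (l == (tL tr v).+1)) ->
  tR tr' = tR tr -> tN tr' = tN tr - ((tL tr v).+1 == M) ->
  run_inv tr' (sp.+1 + deg v) stk' f r /\
  run_pot tr' (sp.+1 + deg v) f + 1000 + 600 * deg v <= run_pot tr sp.+1 f.
Proof.
move=> inv; have [pre hs hb hsp up hi] := inv.
have [hr hrh hlow hlip hsc hacc] := pre.
move=> sv vr vM hP hf hk1 hk2 EL EP EC ER EN.
have [offm nbn _] := csr.
have nbr y : e v y -> tL tr v <= tL tr y by exact: scanned_nbr pre hP.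
have Ev : tL tr' v = (tL tr v).+1 by rewrite EL /upd eqxx.
have Ene (x : 'I_n) : x != v -> tL tr' x = tL tr x.
  by move=> /negPf nx; rewrite EL /upd -[(x : nat) == v]/(x == v) nx.
have ge x : tL tr x <= tL tr' x.
  by rewrite EL /upd; case: eqP => // ->; lia.
have rv : r != v by rewrite eq_sym.
have Er : tL tr' r = tL tr r by exact: Ene.
have S1 F := sum_upd F (tL tr) v (tL tr v).+1.
rewrite -EL in S1.
have S2 := sum_upd (fun x a => deg x - a) (tP tr) v 0; rewrite -EP hP in S2.
have dn k : k < deg v -> nb (off v + k) < n.
  by move=> hk; apply: (nbn v) => //; have := offm v; rewrite /deg in hk; lia.
split; last first.
  rewrite /run_pot /tree_pot ER hr Er.
  have := S1 (fun x a => (M - a) * (deg x).+1); rewrite /= in S2 *.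
  have -> : M - tL tr v = (M - (tL tr v).+1).+1 by lia.
  by rewrite mulSn; lia.
split.
- split=> //.
  + by rewrite ER.
  + by rewrite Er.
  + move=> x; rewrite Er; have := hlow x; have := ge x.
    by have [->|nx] := eqVneq x v; [rewrite Ev; lia|rewrite Ene].
  + move=> x y xy; have := hlip _ _ xy; have := ge x.
    have [yv|ny] := eqVneq y v; last by rewrite (Ene y ny); lia.
    have : tL tr v <= tL tr x by apply: nbr; rewrite -yv esym.
    by rewrite yv Ev; lia.
  + move=> x; rewrite EP /upd; have [xv|nx] := eqVneq (x : nat) v; first by split.
    case: (hsc x) => h1 h2; split=> // k y hk ky xy.
    by rewrite Ene //; apply: leq_trans (ge y); exact: h2 ky xy.
  + case: hacc => hC hN; split=> [l lM|].
      rewrite EC // hC //; have := S1 (fun _ a => a == l : nat).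
      have : (tL tr v == l) <= \sum_(x < n) (tL tr x == l).
        by rewrite (bigD1 v) //= leq_addr.
      by rewrite /= ![l == _]eq_sym; lia.
    rewrite EN hN; have := S1 (fun _ a => a < M : nat).
    by rewrite /= vM; lia.
- move=> k hk; have [ksp|ksp] := ltnP k sp.+1; first by rewrite hk1 // hs.
  by rewrite -(subnKC ksp) hk2; [apply: dn|]; lia.
- move=> x xr; have [->|nx] := eqVneq x v.
    by move=> _; right; exists sp; [lia|rewrite hk1].
  rewrite (Ene x nx) => xM; case: (hb x xr xM) => [[y xy yx]|[k hk kx]]; last first.
    by right; exists k; [lia|rewrite hk1].
  have [yv|ny] := eqVneq y v; last by left; exists y => //; rewrite Ene.
  have vx : e v x by rewrite esym -yv.
  have [_ _ cpl] := csr; have [k kd kx] := cpl _ _ vx.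
  by right; exists (sp.+1 + k); [lia|rewrite hk2].
- rewrite /tree_space; have := S1 (fun x a => (M - a) * deg x).
  rewrite /tree_space /= in hsp *.
  have -> : M - tL tr v = (M - (tL tr v).+1).+1 by lia.
  by rewrite mulSn; lia.
- by move=> x; apply: leq_trans (up x) (ge x).
- case: hi => [[f00 f000 rr0 Lr ng]|[f1 f01 rr0 Lr]|[f1 f00 tg]].
  + constructor 1; split=> //; first by rewrite Er.
    have other : exists2 y : 'I_n, tL tr y == tL tr v & y != v.
      apply: (sum_other (p := fun x => tL tr x == tL tr v)) => //.
      by case: hacc => hC _; rewrite -hC // hf.
    have old (x : 'I_n) l : L0 x < M -> tL tr r <= l -> l <= tL tr x -> l < M ->
        exists y : 'I_n, tL tr' y = l.
      move=> h1 h2 h3 h4; have [y yl] := ng x h1 l h2 h3 h4.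
      have [yv|ny] := eqVneq y v; last by exists y; rewrite Ene.
      by case: other => z /eqP zl nz; exists z; rewrite Ene // zl -yv.
    move=> x xM l; rewrite Er => h1 h2 h3.
    have [xv|nx] := eqVneq x v; last by apply: (old x) => //; rewrite -Ene.
    move: h2; rewrite xv Ev leq_eqVlt => /orP[/eqP->|]; first by exists v.
    by rewrite ltnS => h2; apply: (old x) => //; rewrite xv.
  + by constructor 2; split=> //; rewrite Er.
  + constructor 3; split=> //.
    case: tg => Lt [w [l [H1 [T1 T2 T3 T4 T5] mv]]].
    exists Lt, w, l; split=> //.
      by split=> // x; apply: leq_trans (T4 x) (ge x).
    case: mv => [[T6 T7 T8]|[T6 T7 T8 T9]].
      by left; split=> //; rewrite Er.
    right; split=> //.
    have [wv|nw] := eqVneq w v; last by rewrite Ene.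
    by move: rv; rewrite T8 wv eqxx.
Qed.

(** An edge leaving the lower levels would end on the level of [v], hence at [v] itself, the only
    vertex there; but [v] has been scanned completely and has no lower neighbor. *)
Lemma inv_trigger tr sp stk r (v : 'I_n) :
  run_inv tr sp.+1 stk 0 r -> stk sp = v -> v != r :> nat -> tL tr v < M ->
  tP tr v = deg v -> tC tr (tL tr v) = 1 ->
  [/\ f0 = 0 /\ tL tr r < tL tr v, r = r0, tL tr r = L0 r0,
      nogap M L0 (tL tr) r
    & forall x y, e x y -> tL tr x < tL tr v -> tL tr y < tL tr v].
Proof.
move=> inv; have [pre hs hb hsp up hi] := inv.
have [hr hrh hlow hlip hsc hacc] := pre.
move=> sv vr vM hP C1.
have nbr y : e v y -> tL tr v <= tL tr y by exact: scanned_nbr pre hP.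
have one (y : 'I_n) : tL tr y == tL tr v -> y = v.
  apply: (sum_one (p := fun x => tL tr x == tL tr v)) => //.
  by case: hacc => hC _; rewrite -hC.
case: hi => [[_ f00 rr0 Lr ng]|[] //|[] //].
split=> //.
  split=> //; rewrite ltn_neqAle; have /andP[-> _] := hlow v; rewrite andbT.
  by apply/negP=> /one rv; rewrite rv eqxx in vr.
move=> x y xy xl; have := hlip _ _ xy => yx.
have : tL tr y <= tL tr v by lia.
rewrite leq_eqVlt => /orP[/one yv|//].
by have := nbr x; rewrite esym -yv => /(_ xy); rewrite yv; lia.
Qed.

Lemma inv_flag tr sp stk r (v : 'I_n) :
  run_inv tr sp.+1 stk 0 r -> stk sp = v -> v != r :> nat -> tL tr v < M ->
  tP tr v = deg v -> tC tr (tL tr v) = 1 ->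
  h <= tL tr v \/ h <= \sum_(x < n) (tL tr x < tL tr v) ->
  run_inv tr sp.+1 stk 1 r.
Proof.
move=> inv sv vr vM hP C1 big.
have [[f00 ol] rr0 Lr ng cl] := inv_trigger inv sv vr vM hP C1.
have [pre hs hb hsp up hi] := inv.
have [hr hrh hlow hlip hsc hacc] := pre.
split=> //; constructor 3; split=> //.
exists (tL tr), v, (tL tr v); split.
- by split=> //; rewrite -?Lr -?rr0.
- split=> //; first by rewrite -rr0.
  by move=> x; rewrite -Lr; case/andP: (hlow x).
- by left; split=> //; rewrite -?rr0 //; rewrite -(sum_card n (fun x => tL tr x < tL tr v)).
Qed.

(** No edge joins the lower levels to the rest, so lifting them to the cap respects the Lipschitz
    condition and the scanned prefixes. The new root is strictly higher than the old one, which
    releases potential of order [n]. *)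
Lemma inv_move tr sp stk r (v : 'I_n) tr' :
  run_inv tr sp.+1 stk 0 r -> stk sp = v -> v != r :> nat -> tL tr v < M ->
  tP tr v = deg v -> tC tr (tL tr v) = 1 ->
  tL tr v < h -> \sum_(x < n) (tL tr x < tL tr v) < h ->
  (forall x : 'I_n, tL tr' x = if tL tr x < tL tr v then M else tL tr x) ->
  tP tr' = tP tr -> accurate tr' -> tR tr' = v ->
  run_inv tr' sp.+1 stk 1 v /\
  run_pot tr' sp.+1 1 + 1000 * h.+1 + 500 * n.+1 <= run_pot tr sp.+1 0.
Proof.
move=> inv sv vr vM hP C1 lh sml EL EP acc ER.
have [[f00 ol] rr0 Lr ng cl] := inv_trigger inv sv vr vM hP C1.
have [pre hs hb hsp up hi] := inv.
have [hr hrh hlow hlip hsc hacc] := pre.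
have ge (x : 'I_n) : tL tr x <= tL tr' x.
  by rewrite EL; case: ifP => // _; case/andP: (hlow x).
have Ev : tL tr' v = tL tr v by rewrite EL ltnn.
have clE x y : e x y -> (tL tr x < tL tr v) = (tL tr y < tL tr v).
  by move=> xy; apply/idP/idP; apply: cl; rewrite // esym.
split; last first.
  rewrite /run_pot /tree_pot ER hr Ev EP.
  have : \sum_(x < n) (M - tL tr' x) * (deg x).+1 <=
         \sum_(x < n) (M - tL tr x) * (deg x).+1.
    by apply: leq_sum => x _; rewrite leq_mul // leq_sub2l.
  have -> : h - tL tr r = (h - tL tr v) + (tL tr v - tL tr r) by lia.
  have : n.+1 <= (tL tr v - tL tr r) * n.+1 by rewrite leq_pmull // subn_gt0.
  by rewrite mulnDl; lia.
split=> //.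
- split=> //.
  + by rewrite Ev.
  + move=> x; rewrite Ev EL; have := hlow x.
    by case: ltnP => // *; lia.
  + move=> x y xy; rewrite !EL (clE _ _ xy); case: ifP => // _; exact: hlip.
  + move=> x; rewrite EP; case: (hsc x) => h1 h2; split=> // k y hk ky xy.
    rewrite !EL (clE _ _ xy); case: ifP => // _; exact: h2 ky xy.
- move=> x xv; rewrite EL; case: ifP; first by rewrite ltnn.
  move=> /negbT nS xM.
  have xr : x != r :> nat.
    by apply: contraNN nS => /eqP/val_inj->.
  case: (hb x xr xM) => [[y xy yx]|]; [left|by right].
  by exists y => //; rewrite EL -(clE _ _ xy) (negPf nS).
- apply: leq_trans hsp; rewrite leq_add2l; apply: leq_sum => x _.
  by rewrite leq_mul // leq_sub2l.
- by move=> x; apply: leq_trans (up x) (ge x).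
constructor 3; split=> //.
exists (tL tr), v, (tL tr v); split.
- by split=> //; rewrite -?Lr -?rr0.
- split=> //; first by rewrite -rr0.
  by move=> x; rewrite -Lr; case/andP: (hlow x).
- by right; split=> //; rewrite -(sum_card n (fun x => tL tr x < tL tr v)).
Qed.

End Run.

(** * The program maintaining the levels *)

(* Registers: 3 = n, 4 = m, 5 = K, 6 = number of scales, 7 = scale, 8 = h,
   9 = level cap, 10 = covering radius, 11 = center, 12 = index of the tree,
   13 = stack size, 14 = flag, 15 = vertex, 16 = its level, 17 = position,
   18 = moved, 19 = loop counter, 20 = sum, 21 = vertex to be covered,
   22 = whether its component is large, 26 and 27 = interval of the search.
   Arrays: 1, 2 = adjacency lists, 3 = adjacency matrix, 4 = number of centers
   of a scale, 5 = center of a vertex, 6 = root, 7 = number of vertices below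
   the cap, 8 = levels, 9 = scan positions, 10 = vertices per level, 11 = stack,
   12, 13, 14 = covering radius, h and cap of a scale. *)

Definition sum_below : acmd :=
  ASet 19 #0 ;; ASet 20 #0 ;;
  AWhile ($19 < $16)
    (ASet 20 ($20 + 10@[$12 * (#4 * $3) + $19]) ;; ASet 19 ($19 + #1)).

Definition move_center : acmd :=
  APut 6 $12 $15 ;; ASet 19 #0 ;;
  AWhile ($19 < $3)
    (AIf (8@[$12 * $3 + $19] < $16)
       (APut 10 ($12 * (#4 * $3) + 8@[$12 * $3 + $19])
          (10@[$12 * (#4 * $3) + 8@[$12 * $3 + $19]] - #1) ;;
        APut 8 ($12 * $3 + $19) $9 ;;
        APut 7 $12 (7@[$12] - #1))
       ASkip ;;
     ASet 19 ($19 + #1)) ;;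
  ASet 18 #1.

Definition push_neighbors : acmd :=
  ASet 19 (1@[$15]) ;;
  AWhile ($19 < 1@[$15 + #1])
    (APut 11 $13 (2@[$19]) ;; ASet 13 ($13 + #1) ;; ASet 19 ($19 + #1)).

Definition raise : acmd :=
  APut 10 ($12 * (#4 * $3) + $16) (10@[$12 * (#4 * $3) + $16] - #1) ;;
  APut 8 ($12 * $3 + $15) ($16 + #1) ;;
  APut 9 ($12 * $3 + $15) #0 ;;
  AIf ($16 + #1 == $9) (APut 7 $12 (7@[$12] - #1))
    (APut 10 ($12 * (#4 * $3) + ($16 + #1))
       (10@[$12 * (#4 * $3) + ($16 + #1)] + #1)) ;;
  push_neighbors.

Definition check_split : acmd :=
  ASet 14 #1 ;;
  AIf ($16 < $8) (sum_below ;; AIf ($20 < $8) move_center ASkip) ASkip.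

Definition exhausted : acmd :=
  ASet 18 #0 ;;
  AIf (($14 == #0) * (10@[$12 * (#4 * $3) + $16] == #1)) check_split ASkip ;;
  AIf $18 ASkip raise.

Definition relax : acmd :=
  ASet 15 (11@[$13 - #1]) ;;
  ASet 16 (8@[$12 * $3 + $15]) ;;
  AIf (($15 == 6@[$12]) + ($16 == $9)) (ASet 13 ($13 - #1))
    (ASet 17 (1@[$15] + 9@[$12 * $3 + $15]) ;;
     AIf ($17 == 1@[$15 + #1]) exhausted
       (AIf (3@[$15 * $3 + 2@[$17]] * (8@[$12 * $3 + 2@[$17]] < $16))
          (ASet 13 ($13 - #1))
          (APut 9 ($12 * $3 + $15) (9@[$12 * $3 + $15] + #1)))).

Definition run_tree : acmd := AWhile (#0 < $13) relax.

(** Erasing the values out of range makes two trees equal as functions as soon as the relevant array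
    segments agree. *)
Definition guard b (f : nat -> nat) : nat -> nat := fun k => if k < b then f k else 0.

(** Rows of levels and positions are indexed by vertices; rows of counters are indexed by levels
    below the cap, which is less than [4 * n]. *)
Definition tree_of n (st : astate) (T : nat) : tree :=
  Tree (guard n (fun v => arrs st 8 (T * n + v)))
       (guard n (fun v => arrs st 9 (T * n + v)))
       (guard (4 * n) (fun l => arrs st 10 (T * (4 * n) + l)))
       (arrs st 6 T) (arrs st 7 T).

Arguments tree_of : simpl never.

Lemma guardE b f k : k < b -> guard b f k = f k.
Proof. by rewrite /guard => ->. Qed.

Lemma flat_eq b T T' v v' : v < b -> v' < b ->
  (T * b + v == T' * b + v') = (T == T') && (v == v').
Proof.
move=> hv hv'; apply/eqP/andP=> [E|[/eqP-> /eqP->] //].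
have b0 : 0 < b by lia.
have := congr1 (divn^~ b) E; have := congr1 (modn^~ b) E.
rewrite /= !modnMDl !modn_small // !divnMDl // !divn_small // !addn0.
by move=> -> ->.
Qed.

Lemma guard_upd b f T T' v a : v < b ->
  guard b (fun x => upd f (T * b + v) a (T' * b + x)) =
  if T' == T then upd (guard b (fun x => f (T' * b + x))) v a
  else guard b (fun x => f (T' * b + x)).
Proof.
move=> hv; apply: functional_extensionality => x.
case: (eqVneq T' T) => [->|/negPf nT]; rewrite /guard /upd; case: (ltnP x b) => hx //.
- by rewrite flat_eq // eqxx.
- by case: (eqVneq x v) => // E; move: hx; rewrite E leqNgt hv.
- by rewrite flat_eq // nT.
Qed.

Definition set_tL tr f := Tree f (tP tr) (tC tr) (tR tr) (tN tr).
Definition set_tP tr f := Tree (tL tr) f (tC tr) (tR tr) (tN tr).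
Definition set_tC tr f := Tree (tL tr) (tP tr) f (tR tr) (tN tr).
Definition set_tR tr r := Tree (tL tr) (tP tr) (tC tr) r (tN tr).
Definition set_tN tr k := Tree (tL tr) (tP tr) (tC tr) (tR tr) k.

Lemma tree_setv n st r a T : tree_of n (setv st r a) T = tree_of n st T.
Proof. by []. Qed.

Lemma tree_put8 n st T T' v a : v < n ->
  tree_of n (seta st 8 (T * n + v) a) T' =
  let tr := tree_of n st T' in
  if T' == T then set_tL tr (upd (tL tr) v a) else tr.
Proof.
move=> hv; rewrite /tree_of arrs_seta; cbn [fupd Nat.eqb].
by rewrite guard_upd //; case: ifP.
Qed.

Lemma tree_put9 n st T T' v a : v < n ->
  tree_of n (seta st 9 (T * n + v) a) T' =
  let tr := tree_of n st T' in
  if T' == T then set_tP tr (upd (tP tr) v a) else tr.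
Proof.
move=> hv; rewrite /tree_of arrs_seta; cbn [fupd Nat.eqb].
by rewrite guard_upd //; case: ifP.
Qed.

Lemma tree_put10 n st T T' l a : l < 4 * n ->
  tree_of n (seta st 10 (T * (4 * n) + l) a) T' =
  let tr := tree_of n st T' in
  if T' == T then set_tC tr (upd (tC tr) l a) else tr.
Proof.
move=> hv; rewrite /tree_of arrs_seta; cbn [fupd Nat.eqb].
by rewrite guard_upd //; case: ifP.
Qed.

Lemma tree_put6 n st T T' a : tree_of n (seta st 6 T a) T' =
  if T' == T then set_tR (tree_of n st T') a else tree_of n st T'.
Proof.
by rewrite /tree_of arrs_seta; cbn [fupd Nat.eqb]; rewrite /upd; case: ifP.
Qed.

Lemma tree_put7 n st T T' a : tree_of n (seta st 7 T a) T' =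
  if T' == T then set_tN (tree_of n st T') a else tree_of n st T'.
Proof.
by rewrite /tree_of arrs_seta; cbn [fupd Nat.eqb]; rewrite /upd; case: ifP.
Qed.

Lemma tree_L n st T v : v < n -> arrs st 8 (T * n + v) = tL (tree_of n st T) v.
Proof. by move=> hv; rewrite /tree_of /= guardE. Qed.

Lemma tree_P n st T v : v < n -> arrs st 9 (T * n + v) = tP (tree_of n st T) v.
Proof. by move=> hv; rewrite /tree_of /= guardE. Qed.

Lemma tree_C n st T l : l < 4 * n ->
  arrs st 10 (T * (4 * n) + l) = tC (tree_of n st T) l.
Proof. by move=> hv; rewrite /tree_of /= guardE. Qed.

Lemma accurate_retire n M tr tr' (x : 'I_n) : accurate n M tr -> tL tr x < M ->
  tL tr' = upd (tL tr) x M ->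
  tC tr' = upd (tC tr) (tL tr x) (tC tr (tL tr x) - 1) ->
  tN tr' = tN tr - 1 -> accurate n M tr'.
Proof.
move=> [hC hN] xM EL EC EN; split=> [l hl|].
  have := sum_upd (fun _ a => a == l : nat) (tL tr) x M; rewrite -EL -(hC l hl).
  have -> : (M == l) = false by apply/eqP; lia.
  by rewrite EC /upd; case: (eqVneq (tL tr x) l) => [<-|nl]; lia.
have := sum_upd (fun _ a => a < M : nat) (tL tr) x M; rewrite -EL -hN ltnn xM.
by rewrite EN; lia.
Qed.

Section RunTree.

Variables w q base : nat.
Hypothesis q16 : 16 <= q.
Hypothesis qw : forall x, x <= q ^ 50 -> x < 2 ^ w.
Hypothesis base_gt0 : 0 < base.

Notation wp := (wp w q base).
Let wset := @wp_set w q base q16 qw base_gt0.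
Let wput := @wp_put w q base q16 qw base_gt0.
Let wif := @wp_if w q base q16 qw base_gt0.
Let wwhile := @wp_while w q base q16 qw base_gt0.

Lemma wp_sum_below st l n T : bounded q st ->
  vars st 16 = l -> vars st 3 = n -> vars st 12 = T ->
  \sum_(k < l) arrs st 10 (T * (4 * n) + k) <= q ->
  wp sum_below st (fun t st' => t <= 60 * l.+1 /\
    vars st' 20 = \sum_(k < l) arrs st 10 (T * (4 * n) + k)).
Proof.
move=> bd0 El En ET hq.
apply: wp_seq; apply: wset => //.
apply: wp_seq; apply: wset => //; asimp.
apply: (wwhile (I := fun s => vars s 19 <= l /\
    vars s 20 = \sum_(k < vars s 19) arrs st 10 (T * (4 * n) + k))
  (pot := fun s => 60 * (l - vars s 19))) => //.
- by asimp; rewrite big_ord0.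
- move=> st1 [i1 i2] [fv fa] _; asimp.
  move: (fv 3 erefl) (fv 12 erefl) (fv 16 erefl) (fa 10 erefl); asimp.
  rewrite En ET El => E3 E12 E16 A10; rewrite E16 => lt.
  have lt' : vars st1 19 < l by case: ltnP lt.
  have le : \sum_(k < (vars st1 19).+1) arrs st 10 (T * (4 * n) + k) <= q.
    apply: leq_trans hq; rewrite -(subnKC lt') big_split_ord /=.
    exact: leq_addr.
  rewrite big_ord_recr /= -i2 in le.
  apply: wp_seq; apply: wset => //; asimp; rewrite E12 E3 A10 //.
  apply: wset => //; asimp.
    by move=> _; have [/(_ 16)] := bd0; rewrite El; lia.
  rewrite addn1; split; last by costs; lia.
  by split=> //; rewrite big_ord_recr /= -i2.
- move=> t st1 [i1 i2] [fv fa] _; asimp; rewrite (fv 16 erefl); asimp.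
  rewrite El => ge; have E : vars st1 19 = l by case: ltnP ge => //; lia.
  by rewrite i2 E; costs; split=> //; lia.
Qed.

Lemma wp_push st v : bounded q st -> vars st 15 = v -> arrs st 1 v <= arrs st 1 v.+1 ->
  vars st 13 + (arrs st 1 v.+1 - arrs st 1 v) <= q ->
  wp push_neighbors st (fun t st' =>
    [/\ t <= 60 * (arrs st 1 v.+1 - arrs st 1 v).+1,
      vars st' 13 = vars st 13 + (arrs st 1 v.+1 - arrs st 1 v),
      forall k, k < vars st 13 -> arrs st' 11 k = arrs st 11 k
    & forall k, k < arrs st 1 v.+1 - arrs st 1 v ->
        arrs st' 11 (vars st 13 + k) = arrs st 2 (arrs st 1 v + k)]).
Proof.
move=> bd0 Ev hoff hq; set a := arrs st 1 v; set b := arrs st 1 v.+1.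
apply: wp_seq; apply: wset => //; first by case=> _ ba; exact: ba.
asimp; rewrite Ev -/a.
apply: (wwhile (I := fun s => [/\ a <= vars s 19 <= b,
    vars s 13 + a = vars st 13 + vars s 19,
    forall k, k < vars st 13 -> arrs s 11 k = arrs st 11 k
    & forall k, a + k < vars s 19 ->
        arrs s 11 (vars st 13 + k) = arrs st 2 (a + k)])
  (pot := fun s => 60 * (b - vars s 19))) => //.
- asimp; split=> //; first by rewrite leqnn.
  by move=> k; lia.
- move=> st1 [i1 i2 i3 i4] [fv fa] bd1; asimp.
  move: (fv 15 erefl) (fa 1 erefl) (fa 2 erefl); asimp; rewrite Ev.
  move=> E15 A1 A2; rewrite E15 A1 addn1 -/b => lt.
  have lt' : vars st1 19 < b by case: ltnP lt.
  apply: wp_seq; apply: wput => //; first by case=> _ ba; exact: ba.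
  asimp; rewrite A2; apply: wp_seq; apply: wset => //; asimp.
    by move=> _; move: hq; rewrite -/a -/b; lia.
  apply: wset => //; asimp.
    by move=> _; case: bd0 => _ /(_ 1 v.+1); rewrite -/b; lia.
  rewrite !addn1; split; last by costs; lia.
  split; [lia|lia| |].
  + by move=> k hk; rewrite /upd; case: eqP => [E|_]; [lia|exact: i3].
  + move=> k hk; rewrite /upd; case: eqP => [E|E].
      by congr (arrs st 2 _); lia.
    by apply: i4; lia.
- move=> t st1 [i1 i2 i3 i4] [fv fa] _.
  move: (fv 15 erefl) (fa 1 erefl); asimp; rewrite Ev => E15 A1.
  rewrite E15 A1 addn1 -/b => ge.
  have E : vars st1 19 = b by case: ltnP ge => //; lia.
  rewrite E in i2 i4 *; costs => ht; split=> //; try lia.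
  by move=> k hk; apply: i4; rewrite /a /b in hk *; lia.
Qed.

Lemma wp_move_center st n T v lv M : bounded q st -> vars st 3 = n -> vars st 12 = T ->
  vars st 15 = v -> vars st 16 = lv -> vars st 9 = M -> lv < M -> M < 4 * n ->
  v < n -> accurate n M (tree_of n st T) ->
  (forall x : 'I_n, tL (tree_of n st T) x <= M) ->
  wp move_center st (fun t st' =>
    [/\ t <= 200 * n.+1, vars st' 18 = 1,
      forall x : 'I_n, tL (tree_of n st' T) x =
        if tL (tree_of n st T) x < lv then M else tL (tree_of n st T) x,
      [/\ tP (tree_of n st' T) = tP (tree_of n st T),
        accurate n M (tree_of n st' T) & tR (tree_of n st' T) = v]
    & forall T', T' != T -> tree_of n st' T' = tree_of n st T']).
Proof.
move=> bd0 En ET Ev El EM lM Mn vn acc hM; set tr := tree_of n st T.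
apply: wp_seq; apply: wput => //; first by case=> bv _; exact: bv.
apply: wp_seq; apply: wset => //.
apply: wp_seq; asimp.
set st0 := setv _ _ _.
apply: (wwhile (I := fun s => [/\ vars s 19 <= n,
    forall x : 'I_n, tL (tree_of n s T) x =
      if (x < vars s 19) && (tL tr x < lv) then M else tL tr x,
    tR (tree_of n s T) = v,
    accurate n M (tree_of n s T)
    & forall T', T' != T -> tree_of n s T' = tree_of n st T'])
  (pot := fun s => 150 * (n - vars s 19))) => //.
- rewrite /st0; asimp; split=> //.
  + by rewrite /tree_of; asimp; rewrite ET Ev /upd eqxx.
  + move=> T' nT; rewrite /tree_of; asimp.
    by rewrite /upd ET (negPf nT).
- move=> st1 [i1 i2 i3 i4 i5] [fv fa] bd1; rewrite /st0 in fv fa *; asimp.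
  move: (fv 3 erefl) (fv 12 erefl) (fv 16 erefl) (fv 9 erefl); asimp.
  rewrite En ET El EM => E3 E12 E16 E9; rewrite E3 => lt.
  have lt' : vars st1 19 < n by case: ltnP lt.
  pose x0 := Ordinal lt'.
  have L0 : arrs st1 8 (T * n + vars st1 19) = tL tr x0.
    have := i2 x0; rewrite {1}/tree_of {1}/tL guardE //= => ->.
    by rewrite ltnn.
  apply: wp_seq; apply: wif => //; asimp; rewrite E12 E3 E16 L0.
    case: (ltnP (tL tr x0) lv) => // xl _.
    apply: wp_seq; apply: wput => //; asimp.
      by case=> _ ba; apply: leq_trans (leq_subr _ _) (ba _ _).
    apply: wp_seq; apply: wput => //; first by case=> bv _; exact: bv.
    asimp; apply: wput => //; asimp.
      by case=> _ ba; apply: leq_trans (leq_subr _ _) (ba 7 _).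
    apply: wset => //; asimp.
      by move=> _; case: bd0 => /(_ 3) + _; rewrite En; lia.
    rewrite E12 E3 E9 L0.
    have xM := leq_ltn_trans (hM x0) Mn.
    rewrite tree_C // !addn1; split; last by costs; lia.
    have Lx : tL (tree_of n st1 T) x0 = tL tr x0 by rewrite i2 /= ltnn.
    have TE T' := tree_put7 n (seta (seta st1 10 (T * (4 * n) + tL tr x0)
        (tC (tree_of n st1 T) (tL tr x0) - 1)) 8 (T * n + vars st1 19) M) T T'
        (arrs st1 7 T - 1).
    split=> //.
    + move=> x; rewrite tree_setv TE eqxx tree_put8 // eqxx tree_put10 // eqxx /=.
      rewrite /upd; case: (eqVneq (x : nat) (vars st1 19)) => [E|nx].
        have -> : x = x0 by apply: val_inj.
        by rewrite /= ltnSn xl.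
      have -> : (x < (vars st1 19).+1) = (x < vars st1 19) by lia.
      exact: i2.
    + rewrite tree_setv TE eqxx tree_put8 // eqxx tree_put10 // eqxx.
      apply: (accurate_retire (x := x0)) i4 _ _ _ _; rewrite ?Lx //.
      exact: ltn_trans xl lM.
    + move=> T' nT; rewrite tree_setv TE (negPf nT) tree_put8 // (negPf nT).
      by rewrite tree_put10 // (negPf nT) i5.
  move=> xl; apply: wp_skip; apply: wset => //; asimp.
    by move=> _; case: bd0 => /(_ 3) + _; rewrite En; lia.
  rewrite addn1; split; last by costs; lia.
  split=> // x; rewrite tree_setv i2.
  case: (eqVneq (x : nat) (vars st1 19)) => [E|nx]; last first.
    by have -> : (x < (vars st1 19).+1) = (x < vars st1 19) by lia.
  have -> : x = x0 by apply: val_inj.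
  by rewrite /= ltnn ltnSn /=; case: ltnP xl.
- move=> t st1 [i1 i2 i3 i4 i5] [fv fa] _; rewrite /st0 in fv fa *; asimp.
  rewrite (fv 3 erefl); asimp; rewrite En => ge.
  have E : vars st1 19 = n by case: ltnP ge => //; lia.
  costs => ht; apply: wset => //; asimp; first by move=> _; lia.
  costs.
  split=> //; first by lia.
    by move=> x; rewrite tree_setv i2 E ltn_ord.
  by split=> //; rewrite tree_setv /tree_of (fa 9 erefl).
Qed.

End RunTree.

Lemma tree_frame n st st' T : arrs st' 6 = arrs st 6 -> arrs st' 7 = arrs st 7 ->
  arrs st' 8 = arrs st 8 -> arrs st' 9 = arrs st 9 -> arrs st' 10 = arrs st 10 ->
  tree_of n st' T = tree_of n st T.
Proof. by rewrite /tree_of => -> -> -> -> ->. Qed.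

Section RunTreeSpec.

Variables w q base : nat.
Hypothesis q16 : 16 <= q.
Hypothesis qw : forall x, x <= q ^ 50 -> x < 2 ^ w.
Hypothesis base_gt0 : 0 < base.

Notation wp := (wp w q base).
Let wset := @wp_set w q base q16 qw base_gt0.
Let wput := @wp_put w q base q16 qw base_gt0.
Let wif := @wp_if w q base q16 qw base_gt0.
Let wwhile := @wp_while w q base q16 qw base_gt0.

Variables (n M h T SB : nat) (e : rel 'I_n) (off nb : nat -> nat).
Hypothesis esym : symmetric e.
Hypothesis csr : adjacency_lists off nb e.
Hypothesis M4n : M < 4 * n.
Hypothesis SBq : SB <= q.

Record tree_static (st : astate) : Prop := TreeStatic {
  s_n : vars st 3 = n;
  s_h : vars st 8 = h;
  s_M : vars st 9 = M;
  s_T : vars st 12 = T;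
  s_off : arrs st 1 = off;
  s_nb : arrs st 2 = nb;
  s_adj : forall x y : 'I_n, arrs st 3 (x * n + y) = e x y
}.

Lemma tree_static_frame st st' : tree_static st ->
  vars st' 3 = vars st 3 -> vars st' 8 = vars st 8 -> vars st' 9 = vars st 9 ->
  vars st' 12 = vars st 12 -> arrs st' 1 = arrs st 1 -> arrs st' 2 = arrs st 2 ->
  arrs st' 3 = arrs st 3 -> tree_static st'.
Proof. by case=> *; split; congruence. Qed.

Lemma wp_raise st (v : 'I_n) : tree_static st -> bounded q st ->
  let tr := tree_of n st T in
  vars st 15 = v -> vars st 16 = tL tr v -> tL tr v < M -> accurate n M tr ->
  vars st 13 + deg off v <= q ->
  wp raise st (fun t st' =>
   [/\ [/\ t <= 400 + 60 * deg off v, vars st' 13 = vars st 13 + deg off v,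
        forall k, k < vars st 13 -> arrs st' 11 k = arrs st 11 k
      & forall k, k < deg off v -> arrs st' 11 (vars st 13 + k) = nb (off v + k)],
    let tr' := tree_of n st' T in
      [/\ tL tr' = upd (tL tr) v (tL tr v).+1, tP tr' = upd (tP tr) v 0,
        forall l, l < M ->
          tC tr' l = tC tr l - (l == tL tr v) + (l == (tL tr v).+1),
        tR tr' = tR tr & tN tr' = tN tr - ((tL tr v).+1 == M)]
    & forall T', T' != T -> tree_of n st' T' = tree_of n st T']).
Proof.
move=> [En Eh EM ET Eoff Enb _] bd tr.
have Etr : tree_of n st T = tr by [].
clearbody tr; move=> Ev El vM [hC hN] spq.
have [offm _ _] := csr.
apply: wp_seq; apply: wput => //; asimp.
  by case=> _ ba; apply: leq_trans (leq_subr _ _) (ba _ _).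
rewrite ET En El.
apply: wp_seq; apply: wput => //; asimp.
  rewrite El; case=> bv _; have := bv 9; asimp; rewrite EM; lia.
rewrite ET En El Ev.
apply: wp_seq; apply: wput => //; asimp; rewrite ET En Ev.
have lC : tL tr v < 4 * n by exact: ltn_trans vM M4n.
rewrite tree_C // Etr.
set st1 := seta _ _ _ _.
have E1 T' : tree_of n st1 T' = if T' == T then
    Tree (upd (tL tr) v (tL tr v).+1) (upd (tP tr) v 0)
      (upd (tC tr) (tL tr v) (tC tr (tL tr v) - 1)) (tR tr) (tN tr)
    else tree_of n st T'.
  rewrite /st1 tree_put9 // tree_put8 // tree_put10 // addn1.
  by case: eqP => [->|] //; rewrite Etr.
have fv r : vars st1 r = vars st r by [].
have cpush st2 (P : nat -> astate -> Prop) : bounded q st2 ->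
    vars st2 15 = v -> vars st2 13 = vars st 13 -> arrs st2 1 = off ->
    arrs st2 2 = nb -> arrs st2 11 = arrs st 11 ->
    (forall t st', 
      [/\ t <= 60 * (deg off v).+1, vars st' 13 = vars st 13 + deg off v,
        forall k, k < vars st 13 -> arrs st' 11 k = arrs st 11 k
      & forall k, k < deg off v -> arrs st' 11 (vars st 13 + k) = nb (off v + k)] ->
      (forall T', tree_of n st' T' = tree_of n st2 T') -> P t st') ->
    wp push_neighbors st2 P.
  move=> bd2 E15 E13 A1 A2 A11 hP.
  apply: wp_conseq (wp_push q16 qw base_gt0 bd2 E15 _ _) _; rewrite ?A1 ?E13 //.
    exact: offm.
  move=> t st' [_ fa] _; rewrite A2 A11 => H; apply: hP => // T'.
  by apply: tree_frame; apply: fa.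
apply: wp_seq; apply: wif => //; asimp; rewrite El EM addn1.
  case: (eqVneq (tL tr v).+1 M) => // vM1 _; apply: wput => //; asimp.
    by case=> _ ba; apply: leq_trans (leq_subr _ _) (ba 7 _).
  rewrite ET; set st2 := seta _ _ _ _.
  apply: wp_bounded => bd2.
  have E2 T' : tree_of n st2 T' = if T' == T then
      set_tN (tree_of n st1 T') (tN tr - 1) else tree_of n st1 T'.
    have -> : tN tr = arrs st 7 T by rewrite -Etr.
    exact: tree_put7.
  apply: cpush => //; rewrite -?En //; asimp => //.
  move=> t st' [H1 H2 H3 H4] H5; split.
  - by split=> //; costs; lia.
  - rewrite H5 E2 eqxx E1 eqxx /= ?vM1 ?eqxx; split=> // l lM.
    rewrite /upd; case: (eqVneq l (tL tr v)) => [->|nl].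
      by have -> : (tL tr v == M) = false by [apply/eqP; lia]; lia.
    by rewrite ?vM1 (ltn_eqF lM) addn0 subn0.
  - by move=> T' nT; rewrite H5 E2 (negPf nT) E1 (negPf nT).
case: (eqVneq (tL tr v).+1 M) => // vM1 _; have vM2 : (tL tr v).+1 < M by lia.
have lC' : (tL tr v).+1 < 4 * n by exact: ltn_trans vM2 M4n.
have C1 : upd (arrs st 10) (T * (4 * n) + tL tr v) (tC tr (tL tr v) - 1)
    (T * (4 * n) + (tL tr v).+1) = tC tr (tL tr v).+1.
  by rewrite /upd flat_eq // (gtn_eqF (ltnSn _)) andbF tree_C // Etr.
apply: wput => //; asimp; rewrite ET En El !addn1 C1.
  (* The incremented counter must not exceed [q]: [v] is not yet on the next level, so at most
     [n - 1] vertices are. *)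
  move=> _; rewrite hC //; apply: (@leq_ltn_trans (\sum_(x < n | x != v) 1)).
    rewrite (bigD1 v) //= (_ : _ == _ = false) ?add0n; last by apply/eqP; lia.
    by apply: leq_sum => x _; case: (_ == _).
  rewrite sum1_card cardC1 card_ord; case: bd => /(_ 3) + _; rewrite En.
  by have := ltn_ord v; lia.
set st2 := seta _ _ _ _.
apply: wp_bounded => bd2.
have E2 T' : tree_of n st2 T' = if T' == T then
    set_tC (tree_of n st1 T') (upd (tC (tree_of n st1 T')) (tL tr v).+1
      (tC tr (tL tr v).+1).+1) else tree_of n st1 T'.
  exact: tree_put10.
apply: cpush => //; rewrite -?En //; asimp => //.
move=> t st' [H1 H2 H3 H4] H5; split.
- by split=> //; costs; lia.
- rewrite H5 E2 eqxx E1 eqxx /= ?(negPf vM1).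
  split=> //; last by rewrite subn0.
  move=> l lM; rewrite /upd; case: (eqVneq l (tL tr v).+1) => [->|nl].
    by have -> : ((tL tr v).+1 == tL tr v) = false by [apply/eqP; lia]; lia.
  by case: (eqVneq l (tL tr v)) => [->|]; lia.
- by move=> T' nT; rewrite H5 E2 (negPf nT) E1 (negPf nT).
Qed.

Section Invariant.

Variables (L0 : nat -> nat) (r0 : 'I_n) (f0 : nat).

Notation inv := (run_inv M h e off nb L0 r0 f0 SB).
Notation pot := (run_pot n M h off).

(** Either the center has moved to [v], or the tree is unchanged and a raise is safe: the flag is
    set, or [v] is not alone on its level. *)
Lemma wp_check st k r f (v : 'I_n) : tree_static st -> bounded q st ->
  let tr := tree_of n st T in
  vars st 13 = k.+1 -> vars st 14 = f -> vars st 15 = v ->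
  vars st 16 = tL tr v -> vars st 18 = 0 -> inv tr k.+1 (arrs st 11) f r ->
  arrs st 11 k = v -> v != r :> nat -> tL tr v < M -> tP tr v = deg off v ->
  wp (AIf (($14 == #0) * (10@[$12 * (#4 * $3) + $16] == #1)) check_split ASkip)
    st (fun t st' =>
    (forall T', T' != T -> tree_of n st' T' = tree_of n st T') /\
    ([/\ vars st' 18 = 1, vars st' 14 = 1,
        inv (tree_of n st' T) k.+1 (arrs st 11) 1 v
      & t + 500 + pot (tree_of n st' T) k.+1 1 <= pot tr k.+1 f] \/
     [/\ vars st' 18 = 0, tree_of n st' T = tr, inv tr k.+1 (arrs st 11) (vars st' 14) r,
        vars st' 14 = 0 -> tC tr (tL tr v) != 1
      & t + pot tr k.+1 (vars st' 14) <= pot tr k.+1 f + 200])).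
Proof.
move=> hst bd tr; have [En Eh EM ET Eoff Enb _] := hst.
have Etr : tree_of n st T = tr by [].
clearbody tr; move=> E13 E14 E15 E16 E18 hi sk vr vM hP.
have vn : tL tr v < 4 * n by exact: ltn_trans vM M4n.
have nq : n <= q by rewrite -En; case: bd.
have pot01 : pot tr k.+1 1 + 1000 * h.+1 = pot tr k.+1 0.
  by rewrite /run_pot subnn subn0 mul0n mul1n; lia.
apply: wif => //; asimp; rewrite E14 ET En E16 tree_C // Etr; last first.
  move=> c0; apply: wp_skip; split=> //; right; rewrite E14; split=> //.
    by move=> f00; move: c0; rewrite f00 eqxx mul1n; case: eqP.
  by costs; lia.
move=> c1; have f00 : f = 0 by case: (eqVneq f 0) c1.
have C1 : tC tr (tL tr v) = 1 by case: (eqVneq (tC tr (tL tr v)) 1) c1; rewrite ?muln0.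
rewrite {c1} f00 in hi E14 *.
have [[_ _ _ _ _ acc] _ _ _ _ _] := hi.
apply: wp_seq; apply: wset => //; first by move=> _; asimp; lia.
set st1 := setv _ _ _.
have nomove st' t : h <= tL tr v \/ h <= \sum_(x < n) (tL tr x < tL tr v) ->
    vars st' 18 = 0 -> vars st' 14 = 1 ->
    (forall T', tree_of n st' T' = tree_of n st T') -> t <= 60 * h.+1 + 200 ->
    (forall T', T' != T -> tree_of n st' T' = tree_of n st T') /\
    ([/\ vars st' 18 = 1, vars st' 14 = 1,
        inv (tree_of n st' T) k.+1 (arrs st 11) 1 v
      & t + 500 + pot (tree_of n st' T) k.+1 1 <= pot tr k.+1 0] \/
     [/\ vars st' 18 = 0, tree_of n st' T = tr, inv tr k.+1 (arrs st 11) (vars st' 14) r,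
        vars st' 14 = 0 -> tC tr (tL tr v) != 1
      & t + pot tr k.+1 (vars st' 14) <= pot tr k.+1 0 + 200]).
  move=> big F18 F14 Ft ht; split=> //; right; rewrite F14; split=> //.
  - by rewrite Ft.
  - exact: (inv_flag esym csr hi sk vr vM hP C1).
  - by lia.
apply: wif => //; rewrite /st1; asimp; rewrite E16 Eh; last first.
  move=> hl; apply: wp_skip; apply: nomove => //.
    by left; case: leqP hl.
  by costs; lia.
move=> lh; have {}lh : tL tr v < h by case: ltnP lh.
have Es : \sum_(i < tL tr v) arrs st 10 (T * (4 * n) + i) =
    \sum_(x < n) (tL tr x < tL tr v).
  rewrite -(sum_cnt acc (ltnW vM)); apply: eq_bigr => i _.
  by rewrite tree_C ?Etr //; exact: ltn_trans (ltn_ord i) vn.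
apply: wp_seq; apply: wp_bounded => bd1.
apply: wp_conseq (wp_sum_below q16 qw base_gt0 (l := tL tr v) (n := n) (T := T) bd1 _ _ _ _) _ => //.
  asimp; rewrite Es; apply: leq_trans nq.
  by rewrite -[X in _ <= X]card_ord -sum1_card leq_sum // => x _; case: (_ < _).
move=> t2 st2 [fv2 fa2] bd2; asimp => -[ht2 E20]; rewrite Es in E20.
have t2h : t2 <= 60 * h.+1 by apply: leq_trans ht2 _; rewrite leq_mul2l ltnS ltnW.
apply: wif => //; asimp; rewrite E20 (fv2 8 erefl); asimp; rewrite Eh.
  move=> sh; have {}sh : \sum_(x < n) (tL tr x < tL tr v) < h by case: ltnP sh.
  have Et2 T' : tree_of n st2 T' = tree_of n st T'.
    by apply: tree_frame; apply: fa2.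
  apply: wp_conseq (wp_move_center q16 qw base_gt0 (v := v) (lv := tL tr v) (n := n)
    (T := T) (M := M) bd2 _ _ _ _ _ _ _ _ _ _) _; rewrite ?fv2 ?Et2 ?Etr //.
    by case: hi => -[_ _ low _ _ _] _ _ _ _ _ x; case/andP: (low x).
  move=> t3 st3 [fv3 fa3] _ [ht3 F18]; rewrite ?Et2 ?Etr => F1 [F2 F3 F4] F5.
  split; first by move=> T' nT; rewrite F5 // ?Et2.
  left; have F14 : vars st3 14 = 1 by rewrite (fv3 14 erefl) (fv2 14 erefl).
  have [I1 I2] := inv_move esym csr hi sk vr vM hP C1 lh sh F1 F2 F3 F4.
  by split=> //; costs; lia.
move=> sh; apply: wp_skip; apply: nomove.
- by right; case: leqP sh.
- by rewrite (fv2 18 erefl); asimp.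
- by rewrite (fv2 14 erefl); asimp.
- by move=> T'; apply: tree_frame; rewrite fa2.
- by costs; lia.
Qed.

Lemma wp_exhausted st k r f (v : 'I_n) : tree_static st -> bounded q st ->
  let tr := tree_of n st T in
  vars st 13 = k.+1 -> vars st 14 = f -> vars st 15 = v ->
  vars st 16 = tL tr v -> inv tr k.+1 (arrs st 11) f r ->
  arrs st 11 k = v -> v != r :> nat -> tL tr v < M -> tP tr v = deg off v ->
  wp exhausted st (fun t st' =>
    (forall T', T' != T -> tree_of n st' T' = tree_of n st T') /\
    exists2 r', inv (tree_of n st' T) (vars st' 13) (arrs st' 11) (vars st' 14) r' &
      t + 200 + pot (tree_of n st' T) (vars st' 13) (vars st' 14) <= pot tr k.+1 f).
Proof.
move=> hst bd tr; have Etr : tree_of n st T = tr by [].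
clearbody tr; move=> E13 E14 E15 E16 hi sk vr vM hP.
apply: wp_seq; apply: wset => //; set st1 := setv _ _ _.
have hst1 : tree_static st1 by exact: (tree_static_frame hst).
apply: wp_seq; apply: wp_bounded => bd1.
apply: wp_conseq (wp_check (k := k) (r := r) (f := f) (v := v) hst1 bd1 _ _ _ _ _ _ _ _ _ _) _;
  rewrite /st1 ?tree_setv ?Etr //.
move=> t2 st2 [fv2 fa2] bd2 [F1 F2].
have hst2 : tree_static st2.
  by apply: (tree_static_frame hst1); first [exact: fv2|exact: fa2].
have E13' : vars st2 13 = k.+1 by rewrite (fv2 13 erefl).
have A11 : arrs st2 11 = arrs st 11 by rewrite (fa2 11 erefl).
case: F2 => [[F18 F14 F3 F4]|[F18 F3 F4 F5 F6]].
  apply: wif => //; asimp; rewrite F18 // => _; apply: wp_skip.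
  split=> //; exists v; rewrite E13' F14 ?A11 //.
  by costs; lia.
apply: wif => //; asimp; rewrite F18 // => _.
have [[_ _ _ _ _ acc] _ _ hsp _ _] := hi.
have hs : k.+1 + deg off v <= SB.
  apply: leq_trans hsp; rewrite leq_add2l /tree_space (bigD1 v) //=.
  by apply: leq_trans (leq_addr _ _); rewrite leq_pmull // subn_gt0.
apply: wp_conseq (wp_raise (v := v) hst2 bd2 _ _ _ _ _) _; rewrite ?F3 //.
- by rewrite (fv2 15 erefl); asimp.
- by rewrite (fv2 16 erefl); asimp.
- by rewrite E13'; exact: leq_trans hs SBq.
move=> t3 st3 [fv3 fa3] _ [[H1 H2 H3 H4] [G1 G2 G3 G4 G5] G6].
split; first by move=> T' nT; rewrite G6 // F1.
have E14' : vars st3 14 = vars st2 14 by rewrite (fv3 14 erefl).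
rewrite E13' in H2 H3 H4; rewrite A11 in H3.
have [I1 I2] := inv_raise esym csr F4 sk vr vM hP F5 H3 H4 G1 G2 G3 G4 G5.
exists r; rewrite H2 E14' //.
by costs; lia.
Qed.

(** The top of the stack is popped only if it is the root, is at the cap, or has a lower neighbor.
    Otherwise the scan advances, or the center moves, or the vertex rises. The summand 20 covers the
    loop test. *)
Lemma wp_relax st r : tree_static st -> bounded q st -> 0 < vars st 13 ->
  let tr := tree_of n st T in
  inv tr (vars st 13) (arrs st 11) (vars st 14) r ->
  wp relax st (fun t st' =>
    (forall T', T' != T -> tree_of n st' T' = tree_of n st T') /\
    exists2 r', inv (tree_of n st' T) (vars st' 13) (arrs st' 11) (vars st' 14) r' &
      t + 20 + pot (tree_of n st' T) (vars st' 13) (vars st' 14) <=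
      pot tr (vars st 13) (vars st 14)).
Proof.
move=> hst bd; case E13: (vars st 13) => [//|k] _.
move=> tr; have Etr : tree_of n st T = tr by [].
clearbody tr; move=> hi; have [En Eh EM ET Eoff Enb Eadj] := hst.
have [[hr hrh hlow hlip hsc hacc] hstk hbad hsp hup hh] := hi.
have [offm nbn _] := csr.
have vn : arrs st 11 k < n by exact: hstk.
pose v := Ordinal vn.
have sk : arrs st 11 k = v by [].
have vM : tL tr v <= M by case/andP: (hlow v).
apply: wp_seq; apply: wset => //; first by case=> _ ba; exact: ba.
asimp; rewrite E13 subn1 /= sk.
apply: wp_seq; apply: wset => //; first by case=> _ ba; exact: ba.
asimp; rewrite En ET tree_L // Etr.
have pop t st' : (forall T', tree_of n st' T' = tree_of n st T') ->
    vars st' 13 = k -> arrs st' 11 = arrs st 11 -> vars st' 14 = vars st 14 ->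
    [\/ v = r :> nat, tL tr v = M | exists2 y, e v y & tL tr y < tL tr v] ->
    t <= 150 ->
    (forall T', T' != T -> tree_of n st' T' = tree_of n st T') /\
    exists2 r', inv (tree_of n st' T) (vars st' 13) (arrs st' 11) (vars st' 14) r' &
      t + 20 + pot (tree_of n st' T) (vars st' 13) (vars st' 14) <=
      pot tr k.+1 (vars st 14).
  move=> Et F13 A11 F14 ok ht; split=> //; exists r; rewrite Et Etr F13 ?A11 F14.
    exact: inv_pop hi sk ok.
  by rewrite /run_pot; lia.
have kq : k <= q by have := bd.1 13; rewrite E13; lia.
have ER : arrs st 6 T = r by rewrite -hr -Etr.
apply: wif => //; asimp; rewrite ET ER EM.
  move=> c1; apply: wset => //; asimp; rewrite E13 subn1 //=.
  apply: pop => //.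
  case: (eqVneq (v : nat) r) c1 => [-> _|nr]; first by constructor 1.
  by case: (eqVneq (tL tr v) M) => // -> _; constructor 2.
move=> c0; have vr : v != r :> nat by case: (eqVneq (v : nat) r) c0.
have {c0}vM' : tL tr v < M by move: c0; rewrite (negPf vr) add0n; case: eqVneq => //; lia.
have [hPv hscv] := hsc v.
have Poff : off v + tP tr v <= off v.+1 by have := offm v vn; rewrite /deg in hPv; lia.
apply: wp_seq; apply: wset => //; asimp; rewrite En ET Eoff tree_P // Etr.
  by case=> _ /(_ 1 v.+1); asimp; rewrite Eoff; apply: leq_trans.
apply: wif => //; asimp; rewrite Eoff addn1.
  move=> c1; have hP : tP tr v = deg off v.
    by rewrite /deg; case: (eqVneq (off v + tP tr v) (off v.+1)) c1 => // <-; lia.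
  set st2 := setv _ _ _; have hst2 : tree_static st2 by exact: (tree_static_frame hst).
  apply: wp_bounded => bd2.
  apply: wp_conseq (wp_exhausted (k := k) (r := r) (f := vars st 14) (v := v) hst2 bd2 _ _ _ _ _ _ _ _ _) _;
    rewrite ?tree_setv ?Etr //.
  move=> t st' _ _ [F1 [r' I1 I2]]; split; first exact: F1.
  by exists r' => //; costs; lia.
move=> c0; have lt : off v + tP tr v < off v.+1.
  by rewrite ltn_neqAle Poff andbT; case: eqVneq c0.
have un : nb (off v + tP tr v) < n by apply: (nbn v) => //; lia.
pose u := Ordinal un.
have ltP : tP tr v < deg off v by rewrite /deg; lia.
apply: wif => //; asimp; rewrite En ET Enb (Eadj v u) (tree_L _ _ un) Etr.
  move=> c1; apply: wset => //; asimp; rewrite E13 subn1 //=.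
  apply: pop => //.
  constructor 3; exists u.
    by case: (e v u) c1.
  by rewrite ltnNge; apply: contraNN c1 => le; rewrite ltnNge le muln0.
move=> c1; apply: wput => //; asimp.
  rewrite En ET tree_P // Etr.
  by case=> _ /(_ 1 v.+1); asimp; rewrite Eoff /deg in ltP *; lia.
rewrite En ET tree_P // Etr addn1.
set st' := seta _ _ _ _.
have Et T' : tree_of n st' T' =
    if T' == T then set_tP (tree_of n st T') (upd (tP (tree_of n st T')) v (tP tr v).+1)
    else tree_of n st T' by exact: tree_put9.
split; first by move=> T' nT; rewrite Et (negPf nT).
rewrite Et eqxx Etr /st'; asimp; rewrite E13.
exists r; last first.
  have := sum_upd (fun x a => deg off x - a) (tP tr) v (tP tr v).+1.
  by move: ltP; rewrite /run_pot /tree_pot /set_tP /=; costs; lia.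
apply: inv_scan hi ltP _ _ => //.
rewrite negb_exists; apply/forallP=> y; rewrite !negb_and.
case: eqVneq => //= E; have -> : y = u by apply: val_inj.
by case: (e v u) c1 => //; rewrite mul1n; case: (_ < _).
Qed.

Lemma wp_run_tree st r : tree_static st ->
  inv (tree_of n st T) (vars st 13) (arrs st 11) (vars st 14) r ->
  wp run_tree st (fun t st' =>
    (forall T', T' != T -> tree_of n st' T' = tree_of n st T') /\
    exists2 r', inv (tree_of n st' T) 0 (arrs st' 11) (vars st' 14) r' &
      t + pot (tree_of n st' T) 0 (vars st' 14) <=
      pot (tree_of n st T) (vars st 13) (vars st 14) + 10).
Proof.
move=> hst hi.
apply: (wwhile (I := fun s =>
    (forall T', T' != T -> tree_of n s T' = tree_of n st T') /\
    exists r', inv (tree_of n s T) (vars s 13) (arrs s 11) (vars s 14) r')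
  (pot := fun s => pot (tree_of n s T) (vars s 13) (vars s 14))) => //.
- by split=> //; exists r.
- move=> st1 [i1 [r1 i2]] [fv fa] bd1; asimp => c.
  have hst1 : tree_static st1.
    by apply: (tree_static_frame hst); first [exact: fv|exact: fa].
  have sp : 0 < vars st1 13 by case: (0 < _) c.
  apply: wp_conseq (wp_relax hst1 bd1 sp i2) _.
  move=> t st2 _ _ [F1 [r' I1 I2]]; split; last by costs; lia.
  by split; [move=> T' nT; rewrite F1 // i1|exists r'].
- move=> t st1 [i1 [r1 i2]] _ _; asimp => c.
  have sp : vars st1 13 = 0 by case: posnP c.
  rewrite sp in i2 *; move=> ht; split=> //; exists r1 => //.
  by move: ht; costs; lia.
Qed.

End Invariant.

End RunTreeSpec.

(** * The centers of one scale *)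

(* The number of centers, the first center which may cover a vertex, and the
   trees of the centers. *)
Record scale := Scale { sc_n : nat; sc_ctr : nat -> nat; sc_tree : nat -> tree }.

Section Scales.

Variables (n : nat) (off nb : nat -> nat).

(** [off] describes the lists of the initial graph, which never shrink. Counting only nonempty lists
    bounds the used vertices by [2 * m] as well as by [n], which turns terms of order [n * n] into
    [m * n]. *)
Definition active := [set x : 'I_n | 0 < deg off x].

Section OneScale.

Variables (M h R : nat).

Definition settled e (tr : tree) (r : 'I_n) :=
  tree_pre M h e off nb tr r /\ stable e M r (tL tr).

Definition good_tree e (tr : tree) (Ret : {set 'I_n}) :=
  exists2 r : 'I_n, settled e tr r & retired_ok e h Ret r (tL tr).

Lemma settled_walk e tr r x : symmetric e -> settled e tr r -> tL tr x < M ->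
  forall x' : 'I_n, x' = x :> nat -> walk e r x' (tL tr x - tL tr r).
Proof.
move=> se [[_ _ low lip _ _] st] xM x' Ex; rewrite -Ex in xM *.
by apply: stable_walk se lip st _ xM => y; case/andP: (low y).
Qed.

Section Deletion.

Variables (e0 e : rel 'I_n) (u v : 'I_n).
Hypotheses (se0 : symmetric e0) (se : symmetric e) (del : del_edge e0 e u v).

(** Only the endpoints of the deleted edge can lose their lower neighbor, so these two are pushed.
    The old levels have no gaps by the intermediate value property along a path from the root. *)
Lemma start_delete tr r (stk : nat -> nat) SB : settled e0 tr r ->
  stk 0 = u -> stk 1 = v -> 2 + tree_space n M off tr <= SB ->
  run_inv M h e off nb (tL tr) r 0 SB tr 2 stk 0 r.
Proof.
move=> hset s0 s1 hsp; have [[hr hrh low lip sc acc] st] := hset.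
have [sub dele] := del.
split=> //.
- split=> //; first by move=> x y /sub; exact: lip.
  move=> x; case: (sc x) => h1 h2; split=> // k y hk ky /sub; exact: h2 ky.
- by case=> [|[|k]] //= _; rewrite ?s0 ?s1.
- move=> x xr xM; have [y xy yx] := st x xr xM.
  case: (dele _ _ xy) => [xy'|[xu _]|[xv _]].
  + by left; exists y.
  + by right; exists 0; rewrite ?s0 ?xu.
  + by right; exists 1; rewrite ?s1 ?xv.
- constructor 1; split=> // x xM l rl lx lM.
  have rx := walk_connect (settled_walk se0 hset xM erefl).
  have [|z _ zl] := level_between (l := l) lip rx; first by rewrite rl.
  by exists z.
Qed.

Lemma end_delete tr r Ret tr' r' f' stk SB : h + h <= M -> settled e0 tr r ->
  retired_ok e0 h Ret r (tL tr) ->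
  run_inv M h e off nb (tL tr) r 0 SB tr' 0 stk f' r' ->
  exists Ret', [/\ good_tree e tr' Ret',
    used h (tL tr') Ret' \subset used h (tL tr) Ret
    & forall x : 'I_n, tL tr x <= tL tr' x].
Proof.
move=> hM [[hr hrh low lip sc acc] st] ret [pre' _ hbad _ hup hh].
have [hr' hrh' low' lip' sc' acc'] := pre'.
have st' : stable e M r' (tL tr').
  by move=> x xr xM; case: (hbad x xr xM) => [|[k]] //.
have hh' : [/\ r' = r, tL tr' r' = tL tr r & nogap M (tL tr) (tL tr') r'] \/
    triggered e h M (tL tr) r (tL tr') r'.
  by case: hh => [[_ _ h1 h2 h3]|[_ h1]|[_ _ h1]] //; [left|right].
have [|Ret' [ok sub]] := retired_step se0 se del lip st _ hrh hM ret lip' st' low' hup hh'.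
  by move=> x; case/andP: (low x).
by exists Ret'; split=> //; exists r'.
Qed.

End Deletion.

(** A tree is built by the same loop: constant levels are Lipschitz, and with all vertices on the
    stack nothing else is required. The flag is set, which keeps the root at level 0. *)
Lemma start_open e tr (x : 'I_n) stk SB : 0 < h -> 0 < M ->
  tL tr = (fun=> 0) -> tP tr = (fun=> 0) ->
  (forall l, tC tr l = if l == 0 then n else 0) -> tR tr = x -> tN tr = n ->
  (forall k, k < n -> stk k = k) -> n + tree_space n M off tr <= SB ->
  run_inv M h e off nb (fun=> 0) x 1 SB tr n stk 1 x.
Proof.
move=> h0 M0 EL EP EC ER EN hs hsp; split=> //.
- split=> //; rewrite ?EL //.
  + by move=> y; rewrite EP; split.
  + split=> [l lM|].
      rewrite EC EL; case: eqP => [->|/eqP l0].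
        by rewrite (eq_bigr (fun=> 1)) // sum1_card card_ord.
      by rewrite big1 // => y _; rewrite eq_sym (negPf l0).
    by rewrite EN EL M0 sum1_card card_ord.
- by move=> k hk; rewrite hs.
- by move=> y _ _; right; exists y; rewrite ?hs.
- by constructor 2; rewrite EL.
Qed.

Lemma end_open e tr' (x r' : 'I_n) f' stk SB :
  run_inv M h e off nb (fun=> 0) x 1 SB tr' 0 stk f' r' ->
  settled e tr' x /\ tL tr' x = 0.
Proof.
case=> pre _ hbad _ _ hh.
have [Er Lr] : r' = x /\ tL tr' r' = 0 by case: hh => -[].
rewrite Er in pre hbad Lr *; split=> //; split=> //.
by move=> y yr yM; case: (hbad y yr yM) => [|[k]] //.
Qed.

(** The sets [Ret j] are ghosts: no program stores them. *)
Definition charged e (sc : scale) (Ret : nat -> {set 'I_n}) :=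
  [/\ forall j, j < sc_n sc -> good_tree e (sc_tree sc j) (Ret j),
      forall j, j < sc_n sc -> used h (tL (sc_tree sc j)) (Ret j) \subset active
    & forall j j', j < sc_n sc -> j' < sc_n sc -> j != j' ->
      [disjoint used h (tL (sc_tree sc j)) (Ret j)
              & used h (tL (sc_tree sc j')) (Ret j')]].

Lemma count_disjoint (U : nat -> {set 'I_n}) (V : {set 'I_n}) N :
  (forall j, j < N -> h <= #|U j|) -> (forall j, j < N -> U j \subset V) ->
  (forall j j', j < N -> j' < N -> j != j' -> [disjoint U j & U j']) ->
  N * h <= #|V|.
Proof.
elim: N V => // N IH V hc hs hd.
have /IH : forall j, j < N -> U j \subset V :\: U N.
  move=> j jN; rewrite subsetD hs ?hd //; try lia.
have h1 : #|V :&: U N| = #|U N|.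
  by congr #|pred_of_set _|; apply/setIidPr/hs.
have := hc N (ltnSn _); rewrite -h1 -(cardsID (U N) V) => h2 h3.
rewrite mulSn leq_add //; apply: h3 => [j jN|j j' jN jN'].
  by apply: hc; lia.
by apply: hd; lia.
Qed.

Lemma charged_count e sc Ret : symmetric e -> charged e sc Ret ->
  sc_n sc * h <= #|active|.
Proof.
move=> se [good sub dis]; apply: count_disjoint sub dis => j /good[r [pre st] ok].
by apply: used_card se _ ok; case: pre.
Qed.

Lemma active_connect e y z : symmetric e -> adjacency_lists off nb e ->
  connect e y z -> y \in active -> z \in active.
Proof.
move=> se [_ _ cpl] /connectP[p hp ->]; elim/last_ind: p hp => [|p a IH] //=.
rewrite rcons_path last_rcons => /andP[_ ea] _; rewrite inE.
have [k kd _] : exists2 k, k < deg off a & nb (off a + k) = last y p.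
  by apply: cpl; rewrite se.
by lia.
Qed.

(** A vertex of level below [h] in both trees would put [y] at level at most
    [(h - 1) + (h - 1) <= R] in an old tree. A retired vertex lies in a small component, whereas the
    component of [y] is large. *)
Lemma charged_open e sc Ret sc' (y : 'I_n) : symmetric e ->
  adjacency_lists off nb e -> charged e sc Ret ->
  h + h <= R.+2 -> y \in active -> h <= #|comp e y| ->
  (forall j, j < sc_n sc -> R < tL (sc_tree sc j) y) ->
  sc_n sc' = (sc_n sc).+1 ->
  (forall j, j < sc_n sc -> sc_tree sc' j = sc_tree sc j) ->
  settled e (sc_tree sc' (sc_n sc)) y -> tL (sc_tree sc' (sc_n sc)) y = 0 ->
  h <= M -> charged e sc' (fun j => if j == sc_n sc then set0 else Ret j).
Proof.
move=> se csr [good sub dis] hR yact hy far En Et hset Ly hM.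
set N := sc_n sc; set tr := sc_tree sc' N in hset Ly *.
have [[hr hrh low lip scn acc] st] := hset.
have ok0 : retired_ok e h set0 y (tL tr).
  by split=> [x|]; rewrite ?inE // Ly; right.
have inT x : x \in used h (tL tr) set0 -> walk e y x (tL tr x) /\ tL tr x < h.
  rewrite in_setU in_set0 orbF inE => hx; split=> //.
  have := settled_walk se hset (leq_trans hx hM) erefl.
  by rewrite Ly subn0.
have disN j : j < N -> [disjoint used h (tL (sc_tree sc j)) (Ret j) & used h (tL tr) set0].
  move=> jN; apply/pred0P=> x /=; apply/negP=> /andP[+ /inT[wx xh]].
  have [r [pre _] [small _]] := good j jN.
  rewrite in_setU inE => /orP[Lx|/small].
    have [_ _ _ lipj _ _] := pre.
    have := lipschitz_walk lipj (walk_sym se wx); have := far j jN.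
    by move: hR Lx xh; lia.
  by rewrite -(comp_eq se (walk_connect wx)) ltnNge hy.
split.
- move=> j; rewrite En ltnS leq_eqVlt => /orP[/eqP->|jN].
    by rewrite eqxx; exists y.
  by rewrite (ltn_eqF jN) Et //; apply: good.
- move=> j; rewrite En ltnS leq_eqVlt => /orP[/eqP->|jN].
    rewrite eqxx; apply/subsetP=> x /inT[wx _].
    exact: active_connect se csr (walk_connect wx) yact.
  by rewrite (ltn_eqF jN) Et //; apply: sub.
- move=> j j'; rewrite En !ltnS leq_eqVlt => /orP[/eqP->|jN].
    rewrite eqxx leq_eqVlt => /orP[/eqP->|jN']; first by rewrite eqxx.
    by move=> _; rewrite (ltn_eqF jN') (Et _ jN') disjoint_sym; exact: disN.
  rewrite leq_eqVlt => /orP[/eqP->|jN'] nj.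
    by rewrite eqxx (ltn_eqF jN) (Et _ jN); exact: disN.
  by rewrite (ltn_eqF jN) (ltn_eqF jN') (Et _ jN) (Et _ jN'); exact: dis.
Qed.

(** Levels never decrease, so a center that has become too far for [x] stays too far, and the
    pointer of [x] only advances. *)
Definition pointers (sc : scale) := forall x : 'I_n,
  sc_ctr sc x <= sc_n sc /\
  forall j, j < sc_ctr sc x -> R < tL (sc_tree sc j) x.

(** Unopened slots still hold the zeros of the initial memory, so opening a center needs no
    clearing. There are [n + 1] slots per scale, hence slot [sc_n sc] exists even with [n]
    centers. *)
Definition fresh (tr : tree) :=
  [/\ tL tr = (fun=> 0), tP tr = (fun=> 0) & tC tr = (fun=> 0)].

Definition good_scale e sc :=
  [/\ exists Ret, charged e sc Ret,
      forall j, sc_n sc <= j <= n -> fresh (sc_tree sc j)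
    & pointers sc].

Definition covered (sc : scale) (x : nat) :=
  (sc_ctr sc x < sc_n sc) && (tL (sc_tree sc (sc_ctr sc x)) x <= R).

(** The vertices for which no center is opened. An isolated vertex counts as dead even for [h = 1],
    where its component is not smaller than [h]. *)
Definition dead e (x : 'I_n) := (x \notin active) || (#|comp e x| < h).

Definition full_scale e sc :=
  good_scale e sc /\ forall x : 'I_n, covered sc x || dead e x.

Lemma settled_comp e tr r (x : 'I_n) : symmetric e -> settled e tr r ->
  tL tr x < M -> comp e x = comp e r.
Proof.
by move=> se hset hx; rewrite (comp_eq se (walk_connect (settled_walk se hset hx erefl))).
Qed.

(** The tree lies inside the component. If it misses a vertex, it has a vertex on each level from
    that of the root to the cap, hence at least [M - tL tr r >= k] vertices, as the level of the
    root is below [h]. *)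
Lemma settled_size e tr r (x : 'I_n) k : symmetric e -> settled e tr r ->
  tL tr x < M -> k + h <= M -> (k <= tN tr) = (k <= #|comp e x|).
Proof.
move=> se hset xM kM; have [[hr hrh low lip scn [_ hN]] st] := hset.
rewrite (settled_comp se hset xM) hN (sum_card n (fun x => tL tr x < M)).
have := ball_card r M lip.
have : #|[set y in comp e r | tL tr y < M]| <= #|[set y : 'I_n | tL tr y < M]|.
  by apply/subset_leq_card/subsetP=> y; rewrite !inE => /andP[].
have : #|[set y : 'I_n | tL tr y < M]| <= #|comp e r|.
  apply/subset_leq_card/subsetP=> y; rewrite !inE => yM.
  exact: walk_connect (settled_walk se hset yM erefl).
by clia.
Qed.

End OneScale.

End Scales.

(** * Processing a deletion in the trees of one scale *)

Definition update_trees : acmd :=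
  ASet 11 #0 ;;
  AWhile ($11 < 4@[$7])
    (ASet 12 ($7 * ($3 + #1) + $11) ;;
     APut 11 #0 $0 ;; APut 11 #1 $1 ;; ASet 13 #2 ;; ASet 14 #0 ;;
     run_tree ;;
     ASet 11 ($11 + #1)).

Definition tix n i j := i * n.+1 + j.

Definition blank := Tree (fun=> 0) (fun=> 0) (fun=> 0) 0 0.

(** As with [guard], values out of range are fixed so that equality of scales depends on relevant
    cells only. *)
Definition scale_of n (st : astate) (i : nat) : scale :=
  Scale (arrs st 4 i) (guard n (fun x => arrs st 5 (i * n + x)))
    (fun j => if j <= n then tree_of n st (tix n i j) else blank).

Arguments scale_of : simpl never.

Lemma tix_eq n i j i' j' : j <= n -> j' <= n ->
  (tix n i j == tix n i' j') = (i == i') && (j == j').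
Proof. by move=> hj hj'; rewrite /tix flat_eq. Qed.

Lemma scale_of_eq n st st' i : arrs st' 4 i = arrs st 4 i ->
  (forall x, x < n -> arrs st' 5 (i * n + x) = arrs st 5 (i * n + x)) ->
  (forall j, j <= n -> tree_of n st' (tix n i j) = tree_of n st (tix n i j)) ->
  scale_of n st' i = scale_of n st i.
Proof.
move=> h1 h2 h3; rewrite /scale_of h1; congr Scale.
  by apply: functional_extensionality => x; rewrite /guard; case: ifP => // /h2.
by apply: functional_extensionality => j; case: ifP => // /h3.
Qed.

Lemma scale_tree n st i j : j <= n -> sc_tree (scale_of n st i) j = tree_of n st (tix n i j).
Proof. by move=> hj; rewrite /scale_of /= hj. Qed.

Lemma scale_ctr n st i x : x < n -> sc_ctr (scale_of n st i) x = arrs st 5 (i * n + x).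
Proof. by move=> hx; rewrite /scale_of /= guardE. Qed.

Section Update.

Variables w q base : nat.
Hypothesis q16 : 16 <= q.
Hypothesis qw : forall x, x <= q ^ 50 -> x < 2 ^ w.
Hypothesis base_gt0 : 0 < base.

Notation wp := (wp w q base).
Let wset := @wp_set w q base q16 qw base_gt0.
Let wput := @wp_put w q base q16 qw base_gt0.
Let wwhile := @wp_while w q base q16 qw base_gt0.

Variables (n M h R i SB : nat) (e : rel 'I_n) (off nb : nat -> nat).
Hypothesis esym : symmetric e.
Hypothesis csr : adjacency_lists off nb e.
Hypothesis M4n : M < 4 * n.
Hypothesis hM : h + h <= M.
Hypothesis SBq : SB <= q.
Hypothesis space : 2 + n + \sum_(x < n) M * deg off x <= SB.
Hypothesis tixq : i.+1 * n.+1 <= q.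

Lemma tree_space_le tr : tree_space n M off tr <= \sum_(x < n) M * deg off x.
Proof. by apply: leq_sum => x _; rewrite leq_mul // leq_subr. Qed.

Record scale_static (st : astate) : Prop := ScaleStatic {
  ss_n : vars st 3 = n;
  ss_i : vars st 7 = i;
  ss_h : vars st 8 = h;
  ss_M : vars st 9 = M;
  ss_R : vars st 10 = R;
  ss_off : arrs st 1 = off;
  ss_nb : arrs st 2 = nb;
  ss_adj : forall x y : 'I_n, arrs st 3 (x * n + y) = e x y
}.

Lemma scale_static_frame st st' : scale_static st ->
  vars st' 3 = vars st 3 -> vars st' 7 = vars st 7 -> vars st' 8 = vars st 8 ->
  vars st' 9 = vars st 9 -> vars st' 10 = vars st 10 ->
  arrs st' 1 = arrs st 1 -> arrs st' 2 = arrs st 2 -> arrs st' 3 = arrs st 3 ->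
  scale_static st'.
Proof. by case=> *; split; congruence. Qed.

Notation pot := (tree_pot n M h off).
Notation gscale := (good_scale nb M h R).

(** The alternative without centers serves the initialization, where no edge has been deleted. *)
Lemma wp_update_trees st e0 : symmetric e0 -> scale_static st ->
  arrs st 4 i <= n ->
  (arrs st 4 i = 0 \/ exists u v : 'I_n,
     [/\ vars st 0 = u, vars st 1 = v & del_edge e0 e u v]) ->
  good_scale off nb M h R e0 (scale_of n st i) ->
  wp update_trees st (fun t st' =>
    [/\ good_scale off nb M h R e (scale_of n st' i),
        forall i', i' != i -> scale_of n st' i' = scale_of n st i'
      & t + \sum_(j < arrs st 4 i) pot (sc_tree (scale_of n st' i) j) <=
        \sum_(j < arrs st 4 i) pot (sc_tree (scale_of n st i) j) +
        arrs st 4 i * (1000 * h.+1 + 700) + 100]).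
Proof.
move=> se0 hst cn hdel [[Ret0 [good0 sub0 dis0]] fr0 ptr0].
have [En Ei Eh EM ER Eoff Enb Eadj] := hst.
set N := arrs st 4 i in cn hdel *.
have sN : sc_n (scale_of n st i) = N by [].
rewrite sN in good0 sub0 dis0 fr0.
have T0 j : j < N -> sc_tree (scale_of n st i) j = tree_of n st (tix n i j).
  by move=> jN; rewrite scale_tree //; lia.
apply: wp_seq; apply: wset => //.
set st0 := setv _ _ _.
(* Trees before the counter fit the new graph, the others still the old one. All used sets stay
   inside the original ones, from which they inherit disjointness. *)
pose I (s : astate) := [/\ vars s 11 <= N,
  exists Ret : nat -> {set 'I_n},
  [/\ forall j, j < vars s 11 -> good_tree off nb M h e (tree_of n s (tix n i j)) (Ret j),
      forall j, vars s 11 <= j < N ->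
        good_tree off nb M h e0 (tree_of n s (tix n i j)) (Ret j)
    & forall j, j < N -> used h (tL (tree_of n s (tix n i j))) (Ret j) \subset
        used h (tL (tree_of n st (tix n i j))) (Ret0 j)],
  forall j (x : 'I_n), j < N ->
    tL (tree_of n st (tix n i j)) x <= tL (tree_of n s (tix n i j)) x
  & forall T', (forall j, j < N -> T' != tix n i j) -> tree_of n s T' = tree_of n st T'].
apply: (wwhile (I := I) (pot := fun s =>
  \sum_(j < N) pot (tree_of n s (tix n i j)) +
  (N - vars s 11) * (1000 * h.+1 + 700))) => //.
- split=> //; exists Ret0; split=> // j hj; rewrite tree_setv -T0 //; try lia.
  by apply: good0; lia.
- move=> st1 [i1 [Ret [i2 i3 i4]] i5 i6] [fv fa] bd1; asimp.
  move: (fv 3 erefl) (fv 7 erefl) (fv 0 erefl) (fv 1 erefl) (fa 4 erefl).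
  rewrite /st0; asimp; rewrite En Ei => E3 E7 E0 E1 A4.
  rewrite E7 A4 -/N => c; have jN : vars st1 11 < N by case: ltnP c.
  have E8 : vars st1 8 = h by rewrite (fv 8 erefl).
  have E9 : vars st1 9 = M by rewrite (fv 9 erefl).
  have A1 : arrs st1 1 = off by rewrite (fa 1 erefl).
  have A2 : arrs st1 2 = nb by rewrite (fa 2 erefl).
  have A3 : arrs st1 3 = arrs st 3 by rewrite (fa 3 erefl).
  set j := vars st1 11 in i1 i2 i3 jN *.
  have [N0|[u [v [Eu Ev del]]]] := hdel; first by lia.
  set T := tix n i j.
  apply: wp_seq; apply: wset => //; asimp.
    by move=> _; rewrite E7 E3 addn1; move: tixq; rewrite mulSn; lia.
  rewrite E7 E3 addn1 -/j -/(tix n i j) -/T.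
  apply: wp_seq; apply: wput => //; first by case=> bv _; exact: bv.
  asimp; apply: wp_seq; apply: wput => //; first by case=> bv _; exact: bv.
  asimp; apply: wp_seq; apply: wset => //; first by move=> _; asimp; lia.
  asimp; apply: wp_seq; apply: wset => //; asimp.
  apply: wp_seq.
  set st2 := setv _ _ _.
  have hst2 : tree_static M h T e off nb st2.
    by split; rewrite /st2; asimp; rewrite ?E8 ?E9 ?A1 ?A2 ?A3.
  have Tr2 T' : tree_of n st2 T' = tree_of n st1 T' by [].
  have [r rset rret] : good_tree off nb M h e0 (tree_of n st1 T) (Ret j).
    by apply: i3; rewrite leqnn jN.
  have [pre _] := rset.
  have inv2 : run_inv M h e off nb (tL (tree_of n st1 T)) r 0 SB (tree_of n st2 T)
      (vars st2 13) (arrs st2 11) (vars st2 14) r.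
    rewrite Tr2 /st2; asimp.
    apply: (start_delete se0 del rset).
    - by rewrite /upd E0.
    - by rewrite /upd E1.
    - by apply: leq_trans space; rewrite -addnA leq_add2l; apply: leq_trans (leq_addl _ _); exact: tree_space_le.
  apply: wp_conseq (wp_run_tree q16 qw base_gt0 esym csr M4n SBq hst2 inv2) _.
  move=> t st3 [fv3 fa3] bd3 [F1 [r' I1 I2]].
  have [Ret' [g1 g2 g3]] := end_delete se0 esym del hM rset rret I1.
  have F1' j' : j' < N -> j' != j -> tree_of n st3 (tix n i j') = tree_of n st1 (tix n i j').
    by move=> h1 h2; rewrite F1 ?Tr2 // /T tix_eq ?(negPf h2) ?andbF //; lia.
  have E11 : vars st3 11 = j by rewrite (fv3 11 erefl).
  apply: wset => //; asimp; rewrite E11 addn1.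
    by move=> _; have := bd1.1 3; rewrite E3; lia.
  split; last first.
    have P1 : \sum_(j0 < N) pot (tree_of n st3 (tix n i j0)) + pot (tree_of n st1 T) =
              \sum_(j0 < N) pot (tree_of n st1 (tix n i j0)) + pot (tree_of n st3 T).
      rewrite (bigD1 (Ordinal jN)) // [in RHS](bigD1 (Ordinal jN)) //=.
      rewrite (eq_bigr (fun j0 : 'I_N => pot (tree_of n st1 (tix n i j0)))).
        by rewrite -/T; lia.
      by move=> j0 nj; rewrite F1'.
    have := I2; rewrite Tr2 /run_pot /st2; asimp => I2'.
    have -> : N - j = (N - j.+1).+1 by lia.
    rewrite [X in _ < _ + X]mulSn /=.
    have -> : \sum_(j0 < N) pot (tree_of n (setv st3 11 j.+1) (tix n i j0)) =
      \sum_(j0 < N) pot (tree_of n st3 (tix n i j0)) by [].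
    move: P1 I2'; rewrite subn0 mul1n.
    move: ((1 - _) * _) ((N - j.+1) * _) => X Y; costs.
    move: (\sum_(j0 < N) pot (tree_of n st3 (tix n i j0))) => S3.
    move: (\sum_(j0 < N) pot (tree_of n st1 (tix n i j0))) => S1.
    move: (pot (tree_of n st3 T)) (pot (tree_of n st1 T)) => p3 p1; lia.
  split; [by asimp; lia| | |].
  + exists (fun j' => if j' == j then Ret' else Ret j'); asimp.
    split=> j' hj'; rewrite tree_setv.
    * move: hj'; rewrite ltnS leq_eqVlt => /orP[/eqP->|hj']; first by rewrite eqxx.
      by rewrite (ltn_eqF hj') F1' ?(ltn_eqF hj') //; [apply: i2|lia].
    * have nj : j' != j by lia.
      by rewrite (negPf nj) F1' //; [apply: i3; lia|lia].
    * case: (eqVneq j' j) => [->|nj]; last by rewrite F1' // i4.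
      by apply: subset_trans g2 _; exact: i4.
  + move=> j' x hj'; rewrite tree_setv.
    case: (eqVneq j' j) => [->|nj]; last by rewrite F1' // i5.
    by apply: leq_trans (i5 _ _ jN) _; exact: g3.
  + move=> T' hT'; rewrite tree_setv F1 ?Tr2 ?i6 //; exact: hT'.
- move=> t st1 [i1 [Ret [i2 i3 i4]] i5 i6] [fv fa] _; asimp.
  rewrite (fv 7 erefl) (fa 4 erefl) /st0; asimp; rewrite Ei -/N => c.
  have jN : vars st1 11 = N by case: ltnP c => //; lia.
  rewrite jN in i2 i3 *.
  have Sc : sc_n (scale_of n st1 i) = N by rewrite /scale_of /= (fa 4 erefl).
  have Tj j : j < N -> sc_tree (scale_of n st1 i) j = tree_of n st1 (tix n i j).
    by move=> hj; rewrite scale_tree //; lia.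
  have Ctr x : sc_ctr (scale_of n st1 i) x = sc_ctr (scale_of n st i) x.
    by rewrite /scale_of /= (fa 5 erefl).
  move=> ht; split.
  + split.
    * exists Ret; split; rewrite Sc => j.
      - by move=> hj; rewrite Tj //; apply: i2.
      - move=> hj; rewrite Tj //; apply: subset_trans (i4 _ hj) _.
        by rewrite -T0 // sub0.
      - move=> j' hj hj' nj; rewrite !Tj //.
        apply: disjointWl (i4 _ hj) _; apply: disjointWr (i4 _ hj') _.
        by rewrite -!T0 // dis0.
    * move=> j; rewrite Sc => hj; rewrite scale_tree; last by lia.
      rewrite i6; last by move=> j' hj'; rewrite tix_eq ?eqxx; lia.
      by rewrite -scale_tree; [apply: fr0|lia].
    * move=> x; rewrite Sc Ctr; have [h1 h2] := ptr0 x; split=> // j hj.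
      have jN' : j < N by apply: leq_trans hj h1.
      by rewrite Tj //; apply: leq_trans (i5 _ _ jN'); rewrite -T0 // h2.
  + move=> i' ni; apply: scale_of_eq; rewrite ?(fa 4 erefl) ?(fa 5 erefl) // => j hj.
    by rewrite i6 // => j' hj'; rewrite tix_eq ?(negPf ni) //; lia.
  + rewrite (eq_bigr (fun j : 'I_N => pot (tree_of n st1 (tix n i j)))).
      rewrite [X in _ <= X + _ + _](eq_bigr (fun j : 'I_N => pot (tree_of n st (tix n i j)))).
        move: ht; rewrite subnn mul0n /st0.
        have -> : \sum_(j < N) pot (tree_of n (setv st 11 (aeval base st (#0)%A)) (tix n i j)) =
          \sum_(j < N) pot (tree_of n st (tix n i j)) by [].
        asimp; rewrite subn0; costs.
        move: (N * _) (\sum_(j < N) pot (tree_of n st (tix n i j))).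
        move: (\sum_(j < N) pot (tree_of n st1 (tix n i j))) => S1 X S0; lia.
      by move=> j _; rewrite T0.
    by move=> j _; rewrite Tj.
Qed.

End Update.

(** * Covering the vertices of one scale *)

Definition advance : acmd :=
  AWhile ((5@[$7 * $3 + $21] < 4@[$7]) *
          ($10 < 8@[($7 * ($3 + #1) + 5@[$7 * $3 + $21]) * $3 + $21]))
    (APut 5 ($7 * $3 + $21) (5@[$7 * $3 + $21] + #1)).

(* Whether the component of the vertex is large is read off the tree of its
   center in the previous scale. *)
Definition test_big : acmd :=
  ASet 22 #0 ;;
  AIf (1@[$21] < 1@[$21 + #1])
    (AIf ($7 == #0) (ASet 22 #1)
       (ASet 17 (5@[($7 - #1) * $3 + $21]) ;;
        AIf (($17 < 4@[$7 - #1]) *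
             (8@[(($7 - #1) * ($3 + #1) + $17) * $3 + $21] < 12@[$7 - #1] + #1))
          (ASet 22 ($8 < 7@[($7 - #1) * ($3 + #1) + $17] + #1)) ASkip))
    ASkip.

Definition fill_stack : acmd :=
  ASet 13 #0 ;;
  AWhile ($13 < $3) (APut 11 $13 $13 ;; ASet 13 ($13 + #1)).

Definition open_center : acmd :=
  ASet 12 ($7 * ($3 + #1) + 4@[$7]) ;;
  APut 6 $12 $21 ;; APut 7 $12 $3 ;; APut 10 ($12 * (#4 * $3) + #0) $3 ;;
  fill_stack ;;
  ASet 14 #1 ;;
  APut 4 $7 (4@[$7] + #1) ;;
  run_tree.

Definition cover : acmd :=
  ASet 21 #0 ;;
  AWhile ($21 < $3)
    (advance ;;
     AIf (5@[$7 * $3 + $21] == 4@[$7])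
       (test_big ;; AIf $22 open_center ASkip) ASkip ;;
     ASet 21 ($21 + #1)).

Section Cover.

Variables w q base : nat.
Hypothesis q16 : 16 <= q.
Hypothesis qw : forall x, x <= q ^ 50 -> x < 2 ^ w.
Hypothesis base_gt0 : 0 < base.

Notation wp := (wp w q base).
Let wset := @wp_set w q base q16 qw base_gt0.
Let wput := @wp_put w q base q16 qw base_gt0.
Let wif := @wp_if w q base q16 qw base_gt0.
Let wwhile := @wp_while w q base q16 qw base_gt0.

Variables (n M h R i SB : nat) (e : rel 'I_n) (off nb : nat -> nat).
Hypothesis esym : symmetric e.
Hypothesis csr : adjacency_lists off nb e.
Hypothesis M4n : M < 4 * n.
Hypothesis hM : h + h <= M.
Hypothesis h0 : 0 < h.
Hypothesis hR : h + h <= R.+2.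
Hypothesis RM : R < M.
Hypothesis SBq : SB <= q.
Hypothesis space : 2 + n + \sum_(x < n) M * deg off x <= SB.
Hypothesis tixq : i.+1 * n.+1 <= q.

Notation static := (scale_static M h R i e off nb).

Lemma wp_advance st (x : 'I_n) : static st -> vars st 21 = x ->
  arrs st 5 (i * n + x) <= arrs st 4 i -> arrs st 4 i <= n ->
  (forall j, j < arrs st 5 (i * n + x) ->
     R < tL (tree_of n st (tix n i j)) x) ->
  wp advance st (fun t st' => exists2 c,
    [/\ arrs st' 5 = upd (arrs st 5) (i * n + x) c, c <= arrs st 4 i,
        forall j, j < c -> R < tL (tree_of n st (tix n i j)) x
      & c = arrs st 4 i \/ tL (tree_of n st (tix n i c)) x <= R]
    & t + 200 * (arrs st 4 i - c) <=
      200 * (arrs st 4 i - arrs st 5 (i * n + x)) + 100).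
Proof.
move=> hst Ex c0 cn far; have [En Ei Eh EM ER Eoff Enb Eadj] := hst.
apply: (wwhile (I := fun s => exists2 c,
    arrs s 5 = upd (arrs st 5) (i * n + x) c &
    c <= arrs st 4 i /\ forall j, j < c -> R < tL (tree_of n st (tix n i j)) x)
  (pot := fun s => 200 * (arrs st 4 i - arrs s 5 (i * n + x)))) => //.
- exists (arrs st 5 (i * n + x)) => //; apply: functional_extensionality => k.
  by rewrite /upd; case: eqP => // ->.
- move=> st1 [c A5 [cN fc]] [fv fa] bd1; asimp.
  move: (fv 7 erefl) (fv 3 erefl) (fv 10 erefl) (fv 21 erefl) (fa 4 erefl) (fa 8 erefl).
  rewrite En Ei ER Ex => E7 E3 E10 E21 A4 A8; rewrite E7 E3 E10 E21 A4 A8 A5.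
  have Ec : upd (arrs st 5) (i * n + x) c (i * n + x) = c by rewrite /upd eqxx.
  rewrite Ec addn1 -/(tix n i c) tree_L // => hc.
  have lt : c < arrs st 4 i by case: ltnP hc.
  have Rc : R < tL (tree_of n st (tix n i c)) x.
    by move: hc; rewrite lt mul1n; case: ltnP.
  apply: wput => //; asimp; rewrite E7 E3 E21 A5 Ec addn1.
    by move=> _; have := bd1.1 3; rewrite E3; lia.
  split; last by rewrite /upd eqxx; costs; lia.
  exists c.+1.
    apply: functional_extensionality => k.
    by rewrite /upd; case: eqP => // ->; rewrite ?eqxx.
  split=> // j; rewrite ltnS leq_eqVlt => /orP[/eqP->//|]; exact: fc.
- move=> t st1 [c A5 [cN fc]] [fv fa] bd1; asimp.
  move: (fv 7 erefl) (fv 3 erefl) (fv 10 erefl) (fv 21 erefl) (fa 4 erefl) (fa 8 erefl).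
  rewrite En Ei ER Ex => E7 E3 E10 E21 A4 A8; rewrite E7 E3 E10 E21 A4 A8 A5.
  have Ec : upd (arrs st 5) (i * n + x) c (i * n + x) = c by rewrite /upd eqxx.
  rewrite Ec addn1 -/(tix n i c) tree_L // => hc ht; exists c; last first.
    by move: ht; costs; lia.
  split=> //; move: hc; case: (ltngtP c (arrs st 4 i)) => // [lt|gt|]; last by left.
    by case: ltnP => // le _; right.
  by lia.
Qed.

(** At scale 0 the threshold is at most 1, which every component meets. Otherwise the previous scale
    is already full: if it covers [x], the size of the tree decides by [settled_size]; if not, an
    active [x] has a component smaller than the lower threshold [h']. *)
Lemma wp_test_big st (x : 'I_n) : static st -> vars st 21 = x ->
  (i = 0 -> h <= 1) ->
  (forall k, i = k.+1 -> exists M' h' : nat,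
    [/\ full_scale off nb M' h' (arrs st 12 k) e (scale_of n st k),
        h' <= h, h + h' <= M', arrs st 12 k < M' & arrs st 4 k <= n]) ->
  wp test_big st (fun t st' => t <= 300 /\
    (vars st' 22 != 0) = (x \in active n off) && (h <= #|comp e x|)).
Proof.
move=> hst Ex hi0 hi; have [En Ei Eh EM ER Eoff Enb Eadj] := hst.
have act : (x \in active n off) = (off x < off x.+1) by rewrite inE subn_gt0.
apply: wp_seq; apply: wset => //; apply: wif => //; asimp; rewrite Ex Eoff addn1 -act; last first.
  move=> na; apply: wp_skip; split; first by costs.
  by asimp; case: (x \in _) na.
move=> ha; have {}ha : x \in active n off by case: (x \in _) ha.
rewrite ha; apply: wif => //; asimp; rewrite Ei.
  move=> i0; have {}i0 : i = 0 by case: (eqVneq i 0) i0.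
  apply: wset => //; first by move=> _; asimp; lia.
  asimp; split; first by costs.
  rewrite /= (leq_trans (hi0 i0)) // card_gt0; apply/set0Pn; exists x.
  by rewrite inE connect0.
move=> i0; have {}i0 : 0 < i by case: posnP i0.
have [M' [h' [[[[Ret [good _ _]] _ _] cov] hh hM' RM' cn]]] := hi i.-1 (Logic.eq_sym (prednK i0)).
apply: wp_seq; apply: wset => //; first by case=> _ ba; exact: ba.
asimp; rewrite Ei En Ex subn1.
set c := arrs st 5 (i.-1 * n + x).
have Ec : sc_ctr (scale_of n st i.-1) x = c by rewrite scale_ctr.
have cE : (c < arrs st 4 i.-1) * (arrs st 8 (tix n i.-1 c * n + x) < (arrs st 12 i.-1).+1)
    = covered (arrs st 12 i.-1) (scale_of n st i.-1) x.
  rewrite /covered Ec /scale_of /=; case: ltnP => // cl; rewrite mul1n /=.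
  by rewrite (leq_trans (ltnW cl) cn) tree_L.
apply: wif => //; asimp; rewrite ?Ei ?En ?Ex ?subn1 ?addn1 -/(tix n i.-1 c) cE.
  move=> hc; have {hc} : covered (arrs st 12 i.-1) (scale_of n st i.-1) x.
    by case: covered hc.
  rewrite /covered Ec => /andP[cN cL].
  have cN' : c < arrs st 4 i.-1 by [].
  apply: wset => //; asimp; rewrite ?Ei ?En ?Ex ?subn1 ?addn1 -/(tix n i.-1 c) Eh.
    by move=> _; case: (_ < _); lia.
  split; first by costs.
  have [r hset _] := good c cN'.
  rewrite ltnS.
  have <- := settled_size esym hset (leq_ltn_trans cL RM') hM'.
  rewrite scale_tree; last by lia.
  by case: (h <= _).
move=> nc; apply: wp_skip; split; first by costs.
asimp; have := cov x; case: covered nc => //= _; rewrite /dead ha /=.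
by move=> sm; apply/Logic.eq_sym/negbTE; rewrite -ltnNge; exact: leq_trans sm hh.
Qed.

(** The full cost of a tree from its opening on: the potential of the tree with all levels 0, and
    the filling and emptying of the initial stack of [n] vertices. *)
Definition fresh_pot := 1200 * \sum_(x < n) M * (deg off x).+1 +
  400 * \sum_(x < n) deg off x + 500 * (h * n.+1) + 300 * n.+1.

Notation pot := (tree_pot n M h off).

Lemma fresh_potE C r k :
  pot (Tree (fun=> 0) (fun=> 0) C r k) + 300 * n.+1 = fresh_pot.
Proof.
rewrite /tree_pot /fresh_pot /= !subn0.
by rewrite [X in 400 * X](eq_bigr (fun x : 'I_n => deg off x)) => // y _; rewrite subn0.
Qed.

Lemma wp_fill_stack st : vars st 3 = n ->
  wp fill_stack st (fun t st' =>
    [/\ t <= 60 * n + 20, vars st' 13 = n & forall k, k < n -> arrs st' 11 k = k]).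
Proof.
move=> En; apply: wp_bounded => bd; apply: wp_seq; apply: wset => //; asimp.
apply: (wwhile (I := fun s => vars s 13 <= n /\ forall k, k < vars s 13 -> arrs s 11 k = k)
  (pot := fun s => 60 * (n - vars s 13))) => //.
- move=> st1 [i1 i2] [fv fa] bd1; asimp; rewrite (fv 3 erefl); asimp; rewrite En => c.
  have lt : vars st1 13 < n by case: ltnP c.
  apply: wp_seq; apply: wput => //; first by case=> bv _; exact: bv.
  asimp; apply: wset => //; asimp; first by move=> _; have := bd.1 3; lia.
  rewrite addn1; split; last by costs; lia.
  split=> // k; rewrite ltnS leq_eqVlt /upd => /orP[/eqP->|hk]; first by rewrite eqxx.
  by rewrite (ltn_eqF hk) i2.
- move=> t st1 [i1 i2] [fv fa] _; asimp; rewrite (fv 3 erefl); asimp; rewrite En => c ht.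
  have E : vars st1 13 = n by case: ltnP c => //; lia.
  by rewrite E in i2; split=> //; move: ht; costs; lia.
Qed.

Lemma wp_open_center st (x : 'I_n) : static st -> vars st 21 = x ->
  arrs st 4 i <= n -> fresh (tree_of n st (tix n i (arrs st 4 i))) ->
  wp open_center st (fun t st' =>
    [/\ arrs st' 4 = upd (arrs st 4) i (arrs st 4 i).+1,
        settled off nb M h e (tree_of n st' (tix n i (arrs st 4 i))) x,
        tL (tree_of n st' (tix n i (arrs st 4 i))) x = 0,
        forall T', T' != tix n i (arrs st 4 i) -> tree_of n st' T' = tree_of n st T'
      & t + pot (tree_of n st' (tix n i (arrs st 4 i))) <= fresh_pot]).
Proof.
move=> hst Ex cn [fL fP fC]; have [En Ei Eh EM ER Eoff Enb Eadj] := hst.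
apply: wp_bounded => bd.
set N := arrs st 4 i in cn fL fP fC *; set T := tix n i N in fL fP fC *.
have n0 : 0 < n by have := ltn_ord x; lia.
apply: wp_seq; apply: wset => //; asimp; rewrite Ei En addn1 -/N.
  by move: tixq; rewrite mulSn; lia.
rewrite -/(tix n i N) -/T.
apply: wp_seq; apply: wput => //; first by case=> bv _; exact: bv.
asimp; rewrite Ex.
apply: wp_seq; apply: wput => //; first by case=> bv _; exact: bv.
asimp; rewrite En.
apply: wp_seq; apply: wput => //; first by case=> bv _; exact: bv.
asimp; rewrite En.
set st1 := seta _ _ _ _.
have E1 : tree_of n st1 T = Tree (fun=> 0) (fun=> 0) (upd (fun=> 0) 0 n) x n.
  rewrite /st1 tree_put10; last by lia.
  rewrite eqxx tree_put7 eqxx tree_put6 eqxx tree_setv /set_tC /set_tN /set_tR.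
  cbn [tL tP tC tR tN].
  by rewrite fL fP fC.
have E1' T' : T' != T -> tree_of n st1 T' = tree_of n st T'.
  move=> nT; rewrite /st1 tree_put10; last by lia.
  by rewrite (negPf nT) tree_put7 (negPf nT) tree_put6 (negPf nT).
apply: wp_seq; apply: wp_conseq (wp_fill_stack (st := st1) En) _.
move=> t2 st2 [fv2 fa2] bd2 [ht2 E13 stk].
have E2 T' : tree_of n st2 T' = tree_of n st1 T'.
  by apply: tree_frame; exact: fa2.
apply: wp_seq; apply: wset => //; first by move=> _; asimp; lia.
asimp; apply: wp_seq; apply: wput => //; asimp; rewrite (fv2 7 erefl) (fa2 4 erefl);
  rewrite /st1; asimp; rewrite Ei -/N addn1.
  by move=> _; have := bd.1 3; rewrite En; have := ltn_ord x; move: tixq; rewrite mulSn; lia.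
set st3 := seta _ _ _ _.
have E3 T' : tree_of n st3 T' = tree_of n st1 T' by rewrite -E2.
have hst3 : tree_static M h T e off nb st3.
  split; rewrite /st3; asimp; rewrite ?(fv2 3 erefl) ?(fv2 8 erefl) ?(fv2 9 erefl)
    ?(fv2 12 erefl) ?(fa2 1 erefl) ?(fa2 2 erefl) ?(fa2 3 erefl) //; rewrite /st1; asimp => //.
have inv3 : run_inv M h e off nb (fun=> 0) x 1 SB (tree_of n st3 T) (vars st3 13)
    (arrs st3 11) (vars st3 14) x.
  rewrite E3 E1 /st3; asimp; rewrite E13.
  apply: start_open => //; first by lia.
    apply: leq_trans space; rewrite -addnA; apply: leq_trans (leq_addl _ _).
    by rewrite leq_add2l; exact: tree_space_le.
apply: wp_conseq (wp_run_tree q16 qw base_gt0 esym csr M4n SBq hst3 inv3) _.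
move=> t4 st4 [fv4 fa4] bd4 [F1 [r' I1 I2]].
have [S1 S2] := end_open I1.
split=> //.
- by rewrite (fa4 4 erefl) /st3; asimp; rewrite (fa2 4 erefl).
- by move=> T' nT; rewrite F1 // E3 E1'.
rewrite -(fresh_potE (upd (fun=> 0) 0 n) x n).
move: I2; rewrite E3 E1 /run_pot /st3; asimp; rewrite E13 subnn mul0n muln0.
move: (pot (tree_of n st4 T)) (pot (Tree _ _ _ _ _)) => p a.
move: ((1 - _) * _) => c; costs; lia.
Qed.

Ltac sccbn := cbn [sc_n sc_ctr sc_tree].

Let X := #|active n off| %/ h.

(** [X] bounds the number of centers at all times. Hence both the centers yet to be opened and the
    remaining advances of the pointers can be paid in advance. *)
Definition scale_pot (sc : scale) :=
  \sum_(j < sc_n sc) pot (sc_tree sc j) + (X - sc_n sc) * fresh_pot +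
  200 * \sum_(y < n) (X - sc_ctr sc y).

Notation gscale := (good_scale off nb M h R e).

Lemma good_scale_le sc : gscale sc -> sc_n sc <= X /\ sc_n sc <= n.
Proof.
case=> -[Ret ch] _ _; have le := charged_count esym ch.
have le' : sc_n sc <= X by rewrite leq_divRL.
split=> //; apply: leq_trans le' _; apply: leq_trans (leq_div _ _) _.
by rewrite -[X in _ <= X]card_ord max_card.
Qed.

Lemma scale_advance st st' (x : 'I_n) c :
  arrs st' 5 = upd (arrs st 5) (i * n + x) c ->
  (forall a, Nat.eqb a 5 = false -> arrs st' a = arrs st a) ->
  scale_of n st' i = Scale (arrs st 4 i) (upd (sc_ctr (scale_of n st i)) x c)
    (sc_tree (scale_of n st i)) /\
  forall i', i' != i -> scale_of n st' i' = scale_of n st i'.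
Proof.
move=> A5 fa; split=> [|i' ni].
  rewrite /scale_of (fa 4) // A5 /=; congr Scale.
    by rewrite guard_upd // eqxx.
  apply: functional_extensionality => j; case: ifP => // _.
  by apply: tree_frame; apply: fa.
apply: scale_of_eq; rewrite ?(fa 4) //.
  by move=> y hy; rewrite A5 /upd flat_eq // (negPf ni).
by move=> j _; apply: tree_frame; apply: fa.
Qed.

Lemma wp_cover st : static st -> gscale (scale_of n st i) ->
  (i = 0 -> h <= 1) ->
  (forall k, i = k.+1 -> exists M' h' : nat,
    [/\ full_scale off nb M' h' (arrs st 12 k) e (scale_of n st k),
        h' <= h, h + h' <= M', arrs st 12 k < M' & arrs st 4 k <= n]) ->
  wp cover st (fun t st' =>
    [/\ full_scale off nb M h R e (scale_of n st' i),
        forall i', i' != i -> scale_of n st' i' = scale_of n st i'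
      & t + scale_pot (scale_of n st' i) <=
        scale_pot (scale_of n st i) + 700 * n + 100]).
Proof.
move=> hst good0 hi0 hi; have [En Ei Eh EM ER Eoff Enb Eadj] := hst.
apply: wp_bounded => bd.
apply: wp_seq; apply: wset => //; set st0 := setv _ _ _.
apply: (wwhile (I := fun s => [/\ vars s 21 <= n, gscale (scale_of n s i),
    forall y : 'I_n, y < vars s 21 ->
      covered R (scale_of n s i) y || dead off h e y
    & forall i', i' != i -> scale_of n s i' = scale_of n st i'])
  (pot := fun s => scale_pot (scale_of n s i) + 700 * (n - vars s 21))) => //.
- move=> st1 [i1 i2 i3 i4] [fv fa] bd1; asimp.
  rewrite (fv 3 erefl) /st0; asimp; rewrite En => c0.
  have lt : vars st1 21 < n by case: ltnP c0.
  pose x := Ordinal lt.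
  have hst1 : static st1.
    by apply: (scale_static_frame hst); first [exact: fv|exact: fa].
  have Ex : vars st1 21 = x by [].
  set N := arrs st1 4 i.
  have [NX Nn] : N <= X /\ N <= n by exact: good_scale_le i2.
  have [[Ret ch] fr ptr] := i2.
  have Tj j : j <= N -> sc_tree (scale_of n st1 i) j = tree_of n st1 (tix n i j).
    by move=> jN; rewrite scale_tree //; lia.
  have [cN far] := ptr x; rewrite scale_ctr // in cN far.
  have cN1 : arrs st1 5 (i * n + x) <= N by [].
  apply: wp_seq; apply: wp_conseq (wp_advance hst1 Ex _ _ _) _ => //.
    by move=> j hj; rewrite -Tj; [exact: far|apply: leq_trans (ltnW hj) cN].
  move=> t2 st2 [fv2 fa2] bd2 [c [A5 cN' farc stop] ht2].
  have [sc2 oth2] := scale_advance A5 fa2.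
  have hst2 : static st2.
    by apply: (scale_static_frame hst1); first [exact: fv2|exact: fa2].
  have Ec : arrs st2 5 (i * n + x) = c by rewrite A5 /upd eqxx.
  have good2 : gscale (scale_of n st2 i).
    rewrite sc2; split; [by exists Ret|exact: fr|].
    move=> y; sccbn; rewrite /upd; case: (eqVneq (y : nat) x) => [/val_inj->|_].
      by split=> // j hj; rewrite Tj ?farc // ltnW // (leq_trans hj).
    exact: ptr.
  have pot2 : t2 + scale_pot (scale_of n st2 i) <= scale_pot (scale_of n st1 i) + 100.
    have := sum_upd (fun _ a => X - a) (sc_ctr (scale_of n st1 i)) x c.
    cbv beta; rewrite scale_ctr // /scale_pot sc2; sccbn; rewrite -/N.
    move: (\sum_(j < N) _) ((X - N) * _) (\sum_(y < n) (X - upd _ _ _ _)).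
    move: (\sum_(y < n) _) ht2 cN1 cN' NX; rewrite -/N; clear; lia.
  have E21 : vars st2 21 = x by rewrite (fv2 21 erefl).
  have cov2 (y : 'I_n) : y < x -> covered R (scale_of n st2 i) y || dead off h e y.
    move=> hy; have := i3 y hy; rewrite /covered sc2; sccbn; rewrite /upd.
    by case: (eqVneq (y : nat) x) hy => [->|]; rewrite ?ltnn.
  (* The three branches, namely covered by an open center, dead, and covered by a new center, end
     with the same increment; 450 is the time allowed to a branch beyond its potential. *)
  have fin t3 st3 : vars st3 21 = x -> vars st3 3 = n ->
      gscale (scale_of n st3 i) ->
      covered R (scale_of n st3 i) x || dead off h e x ->
      (forall y : 'I_n, y < x -> covered R (scale_of n st3 i) y || dead off h e y) ->
      (forall i', i' != i -> scale_of n st3 i' = scale_of n st2 i') ->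
      t3 + scale_pot (scale_of n st3 i) <= scale_pot (scale_of n st2 i) + 450 ->
      wp (ASet 21 ($21 + #1)) st3 (fun t4 st4 =>
        [/\ vars st4 21 <= n, gscale (scale_of n st4 i),
          forall y : 'I_n, y < vars st4 21 ->
            covered R (scale_of n st4 i) y || dead off h e y
        & forall i', i' != i -> scale_of n st4 i' = scale_of n st i'] /\
        acost ($21 < $3)%A + (t2 + (t3 + t4)) + (scale_pot (scale_of n st4 i) +
          700 * (n - vars st4 21)) <
        scale_pot (scale_of n st1 i) + 700 * (n - vars st1 21)).
    move=> F21 F3 g3 covx cov3 oth3 pot3; apply: wset => //; asimp; rewrite F21 addn1.
      by have := bd.1 3; rewrite En; have := ltn_ord x; lia.
    have -> r a : scale_of n (setv st3 r a) i = scale_of n st3 i by [].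
    split; last first.
      by rewrite Ex; move: pot2 pot3 (ltn_ord x); costs; lia.
    split=> // [y|i' ni].
      by rewrite ltnS leq_eqVlt => /orP[/eqP/val_inj->//|]; exact: cov3.
    by rewrite -[LHS]/(scale_of n st3 i') oth3 // oth2 // i4.
  have E3 : vars st2 3 = n by rewrite (ss_n hst2).
  have A4 : arrs st2 4 = arrs st1 4 by rewrite (fa2 4 erefl).
  apply: wp_seq; apply: wif => //; asimp;
    rewrite (ss_n hst2) (ss_i hst2) E21 Ec A4 -/N; last first.
    move=> cN0; have {}cN0 : c < N by rewrite ltn_neqAle cN' andbT; case: eqVneq cN0.
    apply: wp_skip; apply: fin => //; last by costs; lia.
    case: stop => [cE|Lc]; first by rewrite cE ltnn in cN0.
    by rewrite /covered sc2; sccbn; rewrite /upd eqxx cN0 Tj ?Lc // ltnW.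
  move=> cE; have {}cE : c = N by case: (eqVneq c N) cE.
  rewrite cE in Ec farc sc2 A5.
  apply: wp_seq; apply: wp_conseq (wp_test_big (x := x) hst2 E21 hi0 _) _.
    move=> k ik; have [M' [h' H]] := hi k ik; exists M', h'.
    have nk : k != i by rewrite ik; lia.
    have A12 : arrs st2 12 = arrs st 12 by rewrite (fa2 12 erefl) (fa 12 erefl).
    have Sk : scale_of n st2 k = scale_of n st k by rewrite oth2 // i4.
    have Ak : arrs st2 4 k = arrs st 4 k by exact: (congr1 sc_n Sk).
    by rewrite A12 Sk Ak.
  move=> t3 st3 [fv3 fa3] bd3 [ht3 big].
  have sc3 i' : scale_of n st3 i' = scale_of n st2 i'.
    apply: scale_of_eq; rewrite ?(fa3 4 erefl) ?(fa3 5 erefl) // => j _.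
    by apply: tree_frame; exact: fa3.
  have hst3 : static st3.
    by apply: (scale_static_frame hst2); first [exact: fv3|exact: fa3].
  have F21 : vars st3 21 = x by rewrite (fv3 21 erefl).
  apply: wif => //; asimp; last first.
    move=> nb0; apply: wp_skip; apply: fin; rewrite ?sc3 //.
    + by rewrite (ss_n hst3).
    + have : (x \in active n off) && (h <= #|comp e x|) = false by rewrite -big nb0.
      rewrite /dead; case: (x \in _) => //= nbig; last by rewrite orbT.
      by rewrite ltnNge nbig orbT.
    + by costs; lia.
  move=> b1; have /andP[xact xbig] : (x \in active n off) && (h <= #|comp e x|).
    by rewrite -big b1.
  have A43 : arrs st3 4 i = N by rewrite (fa3 4 erefl) A4.
  have T3 j : j <= N -> tree_of n st3 (tix n i j) = tree_of n st1 (tix n i j).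
    move=> jN; apply: Logic.eq_trans (_ : tree_of n st2 (tix n i j) = _).
      by apply: tree_frame; exact: fa3.
    by apply: tree_frame; exact: fa2.
  apply: wp_conseq (wp_open_center hst3 F21 _ _) _; rewrite ?A43 //.
    by rewrite T3 // -Tj //; apply: fr; rewrite leqnn.
  move=> t4 st4 [fv4 fa4] bd4 [B1 B2 B3 B4 B5].
  have A44 : arrs st4 4 i = N.+1 by rewrite B1 /upd eqxx.
  have T4 j : j <= n -> j != N -> sc_tree (scale_of n st4 i) j = sc_tree (scale_of n st2 i) j.
    move=> jn nj; rewrite !scale_tree // B4.
      by apply: tree_frame; exact: fa3.
    by rewrite tix_eq ?(negPf nj) ?andbF.
  have C4 y : sc_ctr (scale_of n st4 i) y = sc_ctr (scale_of n st2 i) y.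
    by rewrite /scale_of /= (fa4 5 erefl) (fa3 5 erefl).
  have N2 : sc_n (scale_of n st2 i) = N by rewrite sc2.
  have N4 : sc_n (scale_of n st4 i) = N.+1 by [].
  have TN : sc_tree (scale_of n st4 i) N = tree_of n st4 (tix n i N) by rewrite scale_tree.
  have [[Ret2 ch2] fr2 ptr2] := good2.
  have far2 j : j < N -> R < tL (sc_tree (scale_of n st2 i) j) x.
    by move=> jN; rewrite sc2; sccbn; rewrite Tj ?farc // ltnW.
  have ch4 := charged_open esym csr ch2 hR xact xbig.
  rewrite N2 in ch4; have {}ch4 := ch4 (scale_of n st4 i) far2 N4.
  have Tlt j : j < N -> sc_tree (scale_of n st4 i) j = sc_tree (scale_of n st2 i) j.
    by move=> jN; apply: T4; lia.
  rewrite TN in ch4; have {}ch4 := ch4 Tlt B2 B3 (leq_trans (leq_addr _ _) hM).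
  have good4 : gscale (scale_of n st4 i).
    split.
    + by exists (fun j => if j == N then set0 else Ret2 j).
    + move=> j; rewrite N4 => hj; rewrite T4; [|lia|lia].
      by apply: fr2; rewrite N2; lia.
    + move=> y; rewrite N4 C4; have [h1 h2] := ptr2 y; rewrite N2 in h1.
      split; first by lia.
      by move=> j hj; rewrite Tlt; [exact: h2|lia].
  have [NX4 Nn4] := good_scale_le good4; rewrite N4 in NX4 Nn4.
  apply: fin => //.
  + by rewrite (fv4 21 erefl).
  + by rewrite (fv4 3 erefl) (ss_n hst3).
  + by rewrite /covered C4 N4 sc2; sccbn; rewrite /upd eqxx ltnSn TN B3.
  + move=> y hy; have := cov2 y hy; rewrite /covered C4 N2 N4.
    case/orP=> [/andP[h1 h2]|->]; last by rewrite orbT.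
    by rewrite Tlt // h2 (ltn_trans h1).
  + move=> i' ni; rewrite -sc3; apply: scale_of_eq.
    * by rewrite B1 /upd (negPf ni).
    * by rewrite (fa4 5 erefl).
    * by move=> j hj; rewrite B4 // tix_eq // (negPf ni).
  have SN : \sum_(j < N.+1) pot (sc_tree (scale_of n st4 i) j) =
      \sum_(j < N) pot (sc_tree (scale_of n st2 i) j) + pot (tree_of n st4 (tix n i N)).
    rewrite big_ord_recr -TN; congr (_ + _).
    by apply: eq_bigr => j _; congr (tree_pot n M h off _); apply: (Tlt j); exact: ltn_ord.
  rewrite /scale_pot N4 N2 SN.
  rewrite (eq_bigr (fun y : 'I_n => X - sc_ctr (scale_of n st2 i) y)); last first.
    by move=> y _; rewrite C4.
  have -> : X - N = (X - N.+1).+1 by lia.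
  rewrite [(X - N.+1).+1 * _]mulSn; move: B5 ht3.
  move: (\sum_(j < N) _) (pot _) ((X - N.+1) * fresh_pot) (\sum_(y < n) _) fresh_pot.
  by move=> a b c' d f; costs; lia.
- move=> t st1 [i1 i2 i3 i4] [fv fa] _; asimp.
  rewrite (fv 3 erefl) /st0; asimp; rewrite En => c.
  have E : vars st1 21 = n by case: ltnP c => //; lia.
  rewrite E subnn muln0 addn0 subn0 => ht; split=> //.
    by split=> // x; apply: i3; rewrite E.
  move: ht; have -> : scale_of n (setv st 21 0) i = scale_of n st i by [].
  by move: (scale_pot _) (scale_pot _) => a b; costs; lia.
Qed.

End Cover.

(** * All scales *)

Definition refresh : acmd :=
  ASet 7 #0 ;;
  AWhile ($7 < $6)
    (ASet 8 (13@[$7]) ;; ASet 9 (14@[$7]) ;; ASet 10 (12@[$7]) ;;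
     update_trees ;; cover ;; ASet 7 ($7 + #1)).

Definition radius K i := 2 ^ i %/ K.
(** The largest [h] with [2 * h <= R + 2], as [charged_open] requires. *)
Definition half K i := (radius K i %/ 2).+1.
(** A vertex within the radius of the center and a vertex at the cap are more than [2 ^ i] apart.
    The summand [half K i] exceeds every root level, so each tree reaches more than
    [2 ^ i + radius K i] levels beyond its root. *)
Definition cap K i := 2 ^ i + radius K i + half K i.

Section RadiusBounds.

Variables (n K i : nat).
Hypothesis K4 : 4 <= K.

Lemma radius_le : radius K i <= 2 ^ i %/ 4.
Proof. exact: leq_div2l. Qed.

Lemma half2_le : half K i + half K i <= (radius K i).+2.
Proof. by rewrite /half; have := leq_divM (radius K i) 2; lia. Qed.

Lemma half2_cap : half K i + half K i <= cap K i.
Proof.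
have := half2_le; rewrite /cap; have : 0 < 2 ^ i by rewrite expn_gt0.
by rewrite /half; lia.
Qed.

Lemma radius_cap : radius K i < cap K i.
Proof. by rewrite /cap /half; lia. Qed.

Lemma cap_lt : 2 ^ i < 2 * n -> cap K i < 4 * n.
Proof.
move=> hi; have := radius_le; rewrite /cap /half.
move: (2 ^ i) (radius K i) hi => a b; lia.
Qed.

Lemma half_prev : half K i <= half K i.+1.
Proof. by rewrite /half ltnS; apply: leq_div2r; apply: leq_div2r; rewrite leq_exp2l. Qed.

(** The condition of [settled_size] under which scale [i] can decide the threshold of scale
    [i + 1]. *)
Lemma half_cap_prev : half K i.+1 + half K i <= cap K i.
Proof.
rewrite /cap leq_add2r /half.
have : radius K i.+1 <= 2 ^ i.+1 %/ 4 by exact: leq_div2l.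
have : 0 < 2 ^ i by rewrite expn_gt0.
by rewrite expnS; move: (2 ^ i) (radius K i.+1) (radius K i) => a b c; lia.
Qed.

End RadiusBounds.

Lemma half0 K : 4 <= K -> half K 0 <= 1.
Proof. by move=> K4; rewrite /half /radius expn0 divn_small //; lia. Qed.

Section Refresh.

Variables w q base : nat.
Hypothesis q16 : 16 <= q.
Hypothesis qw : forall x, x <= q ^ 50 -> x < 2 ^ w.
Hypothesis base_gt0 : 0 < base.

Notation wp := (wp w q base).
Let wset := @wp_set w q base q16 qw base_gt0.
Let wwhile := @wp_while w q base q16 qw base_gt0.

Variables (n K S : nat) (off nb : nat -> nat).
Hypothesis K4 : 4 <= K.
Hypothesis hS : forall i, i < S -> 2 ^ i < 2 * n.
Hypothesis space : 2 + n + 4 * n * \sum_(x < n) deg off x <= q.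
Hypothesis Sq : S * n.+1 <= q.

Notation good e i := (good_scale off nb (cap K i) (half K i) (radius K i) e).
Notation full e i := (full_scale off nb (cap K i) (half K i) (radius K i) e).
Notation spot i := (scale_pot n (cap K i) (half K i) off).

Record graph_static (e : rel 'I_n) (st : astate) : Prop := GraphStatic {
  gs_n : vars st 3 = n;
  gs_S : vars st 6 = S;
  gs_off : arrs st 1 = off;
  gs_nb : arrs st 2 = nb;
  gs_adj : forall x y : 'I_n, arrs st 3 (x * n + y) = e x y;
  gs_R : forall i, i < S -> arrs st 12 i = radius K i;
  gs_h : forall i, i < S -> arrs st 13 i = half K i;
  gs_M : forall i, i < S -> arrs st 14 i = cap K i
}.

Lemma graph_static_frame e st st' : graph_static e st ->
  vars st' 3 = vars st 3 -> vars st' 6 = vars st 6 ->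
  arrs st' 1 = arrs st 1 -> arrs st' 2 = arrs st 2 -> arrs st' 3 = arrs st 3 ->
  arrs st' 12 = arrs st 12 -> arrs st' 13 = arrs st 13 ->
  arrs st' 14 = arrs st 14 -> graph_static e st'.
Proof.
case=> ? ? ? ? ? ? ? ? h1 h2 h3 h4 h5 h6 h7 h8.
by split; rewrite ?h1 ?h2 ?h3 ?h4 ?h5 ?h6 ?h7 ?h8.
Qed.

(** Scales are processed upwards, since covering one scale consults the previous one, which must be
    full for the new graph. The overhead of order [n] per scale and deletion fits into
    [m n log n]. *)
Lemma wp_refresh st (e0 e : rel 'I_n) : symmetric e0 -> symmetric e ->
  adjacency_lists off nb e -> graph_static e st ->
  ((forall i, i < S -> arrs st 4 i = 0) \/ exists u v : 'I_n,
     [/\ vars st 0 = u, vars st 1 = v & del_edge e0 e u v]) ->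
  (forall i, i < S -> good e0 i (scale_of n st i)) ->
  wp refresh st (fun t st' =>
    (forall i, i < S -> full e i (scale_of n st' i)) /\
    t + \sum_(i < S) spot i (scale_of n st' i) <=
    \sum_(i < S) spot i (scale_of n st i) + S * (4000 * n.+1) + 20).
Proof.
move=> se0 se csr hst hdel hgood; have [En ES Eoff Enb Eadj ER Eh EM] := hst.
apply: wp_bounded => bd.
apply: wp_seq; apply: wset => //; set st0 := setv _ _ _.
apply: (wwhile (I := fun s => [/\ vars s 7 <= S,
    forall i, i < vars s 7 -> full e i (scale_of n s i)
    & forall i, vars s 7 <= i -> scale_of n s i = scale_of n st i])
  (pot := fun s => \sum_(i < S) spot i (scale_of n s i) +
    (S - vars s 7) * (4000 * n.+1))) => //.
- move=> st1 [i1 i2 i3] [fv fa] bd1; asimp.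
  rewrite (fv 6 erefl) /st0; asimp; rewrite ES => c.
  have lt : vars st1 7 < S by case: ltnP c.
  set i := vars st1 7 in i1 i2 i3 lt *.
  have gst1 : graph_static e st1.
    by apply: (graph_static_frame hst); first [exact: fv|exact: fa].
  have [E3 E6 A1 A2 A3 A12 A13 A14] := gst1.
  have n0 : 0 < n by have := hS lt; lia.
  apply: wp_seq; apply: wset => //; first by case=> _ ba; exact: ba.
  asimp; apply: wp_seq; apply: wset => //; first by case=> _ ba; exact: ba.
  asimp; apply: wp_seq; apply: wset => //; first by case=> _ ba; exact: ba.
  asimp; rewrite A13 // A14 // A12 //.
  set st2 := setv _ _ _.
  have M4 : cap K i < 4 * n by apply: cap_lt => //; exact: hS.
  have sst2 : scale_static (cap K i) (half K i) (radius K i) i e off nb st2.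
    by split.
  have hspace : 2 + n + \sum_(x < n) cap K i * deg off x <= q.
    apply: leq_trans space; rewrite leq_add2l -big_distrr /= leq_mul2r ltnW ?orbT //.
  have tixq : i.+1 * n.+1 <= q by apply: leq_trans Sq; rewrite leq_mul2r lt orbT.
  have Sc2 i' : scale_of n st2 i' = scale_of n st1 i' by [].
  have g2 : good e0 i (scale_of n st2 i) by rewrite Sc2 i3 //; exact: hgood.
  have [NX Nn] := good_scale_le se0 (isT : 0 < half K i) g2.
  have A4 : arrs st2 4 i = arrs st 4 i by exact: (congr1 sc_n (i3 i (leqnn _))).
  have Nn' : arrs st2 4 i <= n by exact: Nn.
  (* The update spends time of order [h] per tree beyond its potential; the disjoint used sets make
     this linear in [n] over all trees of the scale. *)
  have Nh : arrs st2 4 i * half K i <= n.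
    have [[Ret ch] _ _] := g2; apply: leq_trans (charged_count se0 ch) _.
    by rewrite -[X in _ <= X]card_ord max_card.
  apply: wp_seq; apply: wp_conseq (wp_update_trees q16 qw base_gt0 se csr M4
    (half2_cap i K4) (leqnn _) hspace tixq se0 sst2 Nn' _ g2) _.
    rewrite A4; case: hdel => [h|[u [v [h1 h2 h3]]]]; first by left; exact: h.
    by right; exists u, v; split; rewrite // /st2; asimp; rewrite ?(fv 0 erefl) ?(fv 1 erefl).
  move=> t3 st3 [fv3 fa3] bd3 [g3 oth3 pot3].
  have sst3 : scale_static (cap K i) (half K i) (radius K i) i e off nb st3.
    by apply: (scale_static_frame sst2); first [exact: fv3|exact: fa3].
  apply: wp_seq; apply: wp_conseq (wp_cover q16 qw base_gt0 se csr M4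
    (half2_cap i K4) (isT : 0 < half K i) (half2_le i K4) (radius_cap i K4) (leqnn _) hspace tixq sst3 g3 _ _) _.
  + by move=> ->; exact: half0.
  + move=> k ik; exists (cap K k), (half K k).
    have kS : k < S by rewrite -ik in lt *; lia.
    have nk : k != i by rewrite ik; lia.
    have Sk : scale_of n st3 k = scale_of n st1 k by rewrite oth3.
    have fk : full e k (scale_of n st1 k) by apply: i2; rewrite ik.
    have Rk : arrs st3 12 k = radius K k by rewrite (fa3 12 erefl) A12.
    rewrite Rk Sk ik; split=> //; [exact: half_prev|exact: half_cap_prev|exact: radius_cap|].
    have -> : arrs st3 4 k = sc_n (scale_of n st1 k) by rewrite -Sk.
    by case: fk => gk _; case: (good_scale_le se (isT : 0 < half K k) gk).
  move=> t4 st4 [fv4 fa4] bd4 [f4 oth4 pot4].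
  have E7 : vars st4 7 = i by rewrite (fv4 7 erefl) (fv3 7 erefl).
  have pot34 : t3 + spot i (scale_of n st3 i) <= spot i (scale_of n st2 i) +
      2700 * n + 100.
    have C3 : sc_ctr (scale_of n st3 i) = sc_ctr (scale_of n st2 i).
      by rewrite /scale_of (fa3 5 erefl).
    have N3 : sc_n (scale_of n st3 i) = arrs st2 4 i by rewrite /scale_of (fa3 4 erefl).
    have N2 : sc_n (scale_of n st2 i) = arrs st2 4 i by [].
    rewrite /scale_pot C3 N3 N2; move: pot3.
    have : arrs st2 4 i * (1000 * (half K i).+1 + 700) <= 2700 * n.
      have : arrs st2 4 i * (1000 * (half K i).+1 + 700) =
        1000 * (arrs st2 4 i * half K i) + 1700 * arrs st2 4 i by lia.
      by move: Nh Nn'; lia.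
    move: (arrs st2 4 i * _) (\sum_(j < _) _) (\sum_(j < _) _) => a b d.
    by move: ((_ - _) * _) (\sum_(y < n) _) => f g; lia.
  apply: wset => //; asimp; rewrite E7 addn1.
    move=> _; apply: leq_trans Sq; apply: leq_trans lt _.
    by rewrite leq_pmulr.
  have Sc4 i' : i' != i -> scale_of n st4 i' = scale_of n st1 i'.
    by move=> ni; rewrite oth4 // oth3.
  split; last first.
    have P1 : \sum_(j < S) spot j (scale_of n st4 j) + spot i (scale_of n st1 i) =
              \sum_(j < S) spot j (scale_of n st1 j) + spot i (scale_of n st4 i).
      rewrite (bigD1 (Ordinal lt)) // [in RHS](bigD1 (Ordinal lt)) //=.
      rewrite (eq_bigr (fun j : 'I_S => spot j (scale_of n st1 j))); first by lia.
      by move=> j nj; rewrite Sc4.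
    have -> : S - i = (S - i.+1).+1 by lia.
    rewrite [(S - i.+1).+1 * _]mulSn.
    have -> : \sum_(j < S) spot j (scale_of n (setv st4 7 i.+1) j) =
              \sum_(j < S) spot j (scale_of n st4 j) by [].
    rewrite Sc2 in pot34; move: P1 pot34 pot4 n0.
    move: (\sum_(j < S) _) (\sum_(j < S) _) ((S - i.+1) * _) => a b d.
    move: (spot i _) (spot i _) (spot i _) => f g k; clear; costs; lia.
  split=> [//|i'|i' hi'].
    rewrite ltnS leq_eqVlt => /orP[/eqP->//|hi'].
    by rewrite -[scale_of _ _ _]/(scale_of n st4 i') Sc4 ?(ltn_eqF hi') //; exact: i2.
  rewrite -[LHS]/(scale_of n st4 i') Sc4 ?gtn_eqF //; apply: i3; exact: ltnW.
- move=> t st1 [i1 i2 i3] [fv fa] _; asimp.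
  rewrite (fv 6 erefl) /st0; asimp; rewrite ES => c.
  have E : vars st1 7 = S by case: ltnP c => //; lia.
  rewrite E subnn mul0n addn0 subn0 => ht; split; first by rewrite -E.
  move: ht; have -> : \sum_(i < S) spot i (scale_of n (setv st 7 0) i) =
    \sum_(i < S) spot i (scale_of n st i) by [].
  by move: (\sum_(i < S) _) (\sum_(i < S) _) (S * _) => a b d; costs; lia.
Qed.

End Refresh.

(** * Initialization *)

Definition count_up : acmd := AIf ($5 < #4 * $3) (ASet 5 ($5 + #1)) ASkip.

Fixpoint arepeat k c := if k is k'.+1 then ASeq c (arepeat k' c) else ASkip.

(* [k] does not have to fit into a word, hence it is not a literal. *)
Definition set_K k : acmd := ASet 5 #0 ;; arepeat k count_up.

Definition set_parameters : acmd :=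
  ASet 7 #0 ;; ASet 23 #1 ;;
  AWhile ($23 < #2 * $3)
    (APut 12 $7 ($23 %/ $5) ;; APut 13 $7 (12@[$7] %/ #2 + #1) ;;
     APut 14 $7 ($23 + 12@[$7] + 13@[$7]) ;;
     ASet 23 ($23 * #2) ;; ASet 7 ($7 + #1)) ;;
  ASet 6 $7.

Definition set_matrix : acmd :=
  ASet 24 #0 ;;
  AWhile ($24 < $4)
    (APut 3 (0@[#2 * $24] * $3 + 0@[#2 * $24 + #1]) #1 ;;
     APut 3 (0@[#2 * $24 + #1] * $3 + 0@[#2 * $24]) #1 ;;
     ASet 24 ($24 + #1)).

(** Going through all edges for each vertex takes time of order [m n] in total, which the bound
    permits. *)
Definition list_neighbors : acmd :=
  APut 1 $15 $25 ;; ASet 24 #0 ;;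
  AWhile ($24 < $4)
    (AIf (0@[#2 * $24] == $15)
       (APut 2 $25 (0@[#2 * $24 + #1]) ;; ASet 25 ($25 + #1)) ASkip ;;
     AIf (0@[#2 * $24 + #1] == $15)
       (APut 2 $25 (0@[#2 * $24]) ;; ASet 25 ($25 + #1)) ASkip ;;
     ASet 24 ($24 + #1)).

Definition set_lists : acmd :=
  ASet 25 #0 ;; ASet 15 #0 ;;
  AWhile ($15 < $3) (list_neighbors ;; ASet 15 ($15 + #1)) ;;
  APut 1 $3 $25.

Definition init k : acmd :=
  ASet 3 $0 ;; ASet 4 $1 ;; set_K k ;; set_parameters ;; set_matrix ;;
  set_lists ;; refresh.

Section Init.

Variables w q base : nat.
Hypothesis q16 : 16 <= q.
Hypothesis qw : forall x, x <= q ^ 50 -> x < 2 ^ w.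
Hypothesis base_gt0 : 0 < base.

Notation wp := (wp w q base).
Let wset := @wp_set w q base q16 qw base_gt0.
Let wput := @wp_put w q base q16 qw base_gt0.
Let wif := @wp_if w q base q16 qw base_gt0.
Let wwhile := @wp_while w q base q16 qw base_gt0.

Variables n m : nat.
Hypothesis nq : 4 * n <= q.

Lemma wp_repeat k st : vars st 3 = n -> vars st 5 <= 4 * n ->
  wp (arepeat k count_up) st (fun t st' =>
    t <= 30 * k + 1 /\ vars st' 5 = minn (vars st 5 + k) (4 * n)).
Proof.
elim: k st => [|k IH] st En le5.
  by apply: wp_skip; rewrite addn0; split=> //; apply/Logic.eq_sym/minn_idPl.
apply: wp_seq; apply: wif => //; asimp; rewrite En => c.
  have lt : vars st 5 < 4 * n by case: ltnP c.
  apply: wset => //; asimp; first by move=> _; lia.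
  apply: wp_conseq (IH (setv st 5 (vars st 5 + 1)) _ _) _; asimp => //.
    by lia.
  by move=> t st' _ _ [h1 ->]; split; [costs; lia|congr minn; lia].
have ge : 4 * n <= vars st 5 by case: ltnP c.
apply: wp_skip; apply: wp_conseq (IH st En le5) _.
by move=> t st' _ _ [h1 ->]; split; [costs; lia|lia].
Qed.

Lemma wp_set_K k st : vars st 3 = n ->
  wp (set_K k) st (fun t st' => t <= 30 * k + 10 /\ vars st' 5 = minn k (4 * n)).
Proof.
move=> En; apply: wp_seq; apply: wset => //; asimp.
apply: wp_conseq (wp_repeat k (st := setv st 5 0) _ _) _; asimp => //.
by move=> t st' _ _ [h1 ->]; rewrite add0n; split=> //; costs; lia.
Qed.

Lemma wp_set_parameters st K : vars st 3 = n -> vars st 5 = K ->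
  (0 < n -> 4 <= K) ->
  wp set_parameters st (fun t st' => exists2 S,
    [/\ vars st' 6 = S, forall i, i < S -> 2 ^ i < 2 * n, 2 * n <= 2 ^ S
      & forall i, i < S -> [/\ arrs st' 12 i = radius K i,
          arrs st' 13 i = half K i & arrs st' 14 i = cap K i]]
    & t <= 400 * n + 100).
Proof.
move=> En EK K4; apply: wp_bounded => bd.
apply: wp_seq; apply: wset => //; asimp.
apply: wp_seq; apply: wset => //; asimp; first by move=> _; lia.
apply: wp_seq; set st0 := setv _ _ _.
apply: (wwhile (I := fun s => [/\ vars s 23 = 2 ^ vars s 7,
    forall i, i < vars s 7 -> 2 ^ i < 2 * n
    & forall i, i < vars s 7 -> [/\ arrs s 12 i = radius K i,
          arrs s 13 i = half K i & arrs s 14 i = cap K i]])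
  (pot := fun s => 150 * (2 * n - vars s 7))) => //.
- move=> st1 [i1 i2 i3] [fv fa] bd1; rewrite /st0 in fv fa *; asimp.
  move: (fv 3 erefl) (fv 5 erefl); asimp; rewrite En EK => E3 E5.
  rewrite E3 i1 => c; have lt : 2 ^ vars st1 7 < 2 * n by case: ltnP c.
  set i := vars st1 7 in i1 i2 i3 lt *.
  have n0 : 0 < n by lia.
  have Mn := cap_lt (K4 n0) lt.
  have il : i < 2 ^ i by exact: ltn_expl.
  apply: wp_seq; apply: wput => //; asimp; rewrite i1 E5 -/(radius K i).
    by move=> _; move: Mn; rewrite /cap; lia.
  apply: wp_seq; apply: wput => //; asimp; rewrite -/i /upd eqxx addn1 -/(half K i).
    by move=> _; move: Mn; rewrite /cap; lia.
  apply: wp_seq; apply: wput => //; asimp; rewrite -/i i1 /upd !eqxx -/(cap K i).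
    by move=> _; lia.
  apply: wp_seq; apply: wset => //; asimp; rewrite i1 -expnSr.
    by move=> _; rewrite expnS; lia.
  apply: wset => //; asimp; rewrite -/i addn1; first by move=> _; lia.
  split; last by costs; lia.
  split=> // j; rewrite ltnS leq_eqVlt => /orP[/eqP->|hj] //; first exact: i2.
    by rewrite /upd !eqxx.
  by rewrite /upd !(ltn_eqF hj); exact: i3.
- move=> t st1 [i1 i2 i3] [fv fa] bd1; rewrite /st0 in fv fa *; asimp.
  move: (fv 3 erefl); asimp; rewrite En => E3; rewrite E3 i1 => c ht.
  apply: wset => //; first by case=> bv _; exact: bv.
  asimp; exists (vars st1 7).
    by split=> //; case: ltnP c.
  by move: ht; costs; lia.
Qed.

Variables (fst_end snd_end : nat -> nat).
Hypothesis base_m : 2 * m < base.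
Hypothesis ends_lt : forall k, k < m -> fst_end k < n /\ snd_end k < n.

Definition joins (x y k : nat) :=
  (fst_end k == x) && (snd_end k == y) || (fst_end k == y) && (snd_end k == x).

Definition listed (x y : nat) := has (joins x y) (iota 0 m).

Definition input_ok (st : astate) :=
  [/\ vars st 3 = n, vars st 4 = m,
      forall k, k < m -> arrs st 0 ((2 * k) %% base) = fst_end k
    & forall k, k < m -> arrs st 0 ((2 * k + 1) %% base) = snd_end k].

Lemma input_frame st st' : input_ok st -> vars st' 3 = vars st 3 ->
  vars st' 4 = vars st 4 -> arrs st' 0 = arrs st 0 -> input_ok st'.
Proof. by case=> h1 h2 h3 h4 e1 e2 e3; split; rewrite ?e1 ?e2 ?e3. Qed.

Lemma has_iotaS (p : pred nat) k : has p (iota 0 k.+1) = has p (iota 0 k) || p k.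
Proof. by rewrite -addn1 iotaD has_cat /= orbF add0n. Qed.

Lemma wp_set_matrix st : input_ok st -> arrs st 3 = (fun=> 0) ->
  wp set_matrix st (fun t st' => t <= 150 * m + 20 /\
    forall x y, x < n -> y < n -> arrs st' 3 (x * n + y) = listed x y).
Proof.
move=> hin A3; have [En Em Ea Eb] := hin; apply: wp_bounded => bd.
apply: wp_seq; apply: wset => //; asimp; set st0 := setv _ _ _.
apply: (wwhile (I := fun s => vars s 24 <= m /\
    forall x y, x < n -> y < n ->
      arrs s 3 (x * n + y) = has (joins x y) (iota 0 (vars s 24)))
  (pot := fun s => 150 * (m - vars s 24))) => //.
- by rewrite /st0; asimp; rewrite A3.
- move=> st1 [i1 i2] [fv fa] bd1; asimp.
  have hin1 : input_ok st1.
    by apply: (input_frame hin); first [exact: fv|exact: fa].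
  have [E3 E4 Ea1 Eb1] := hin1; rewrite E4 => c.
  have lt : vars st1 24 < m by case: ltnP c.
  set k := vars st1 24 in i1 i2 lt *.
  have [an bn] := ends_lt lt.
  apply: wp_seq; apply: wput => //; asimp; first by move=> _; lia.
  apply: wp_seq; apply: wput => //; asimp; first by move=> _; lia.
  apply: wset => //; asimp; rewrite -/k addn1.
    by move=> _; have := bd1.1 4; rewrite E4; lia.
  rewrite E3 Ea1 // Eb1 //; split; last by costs; lia.
  split=> // x y xn yn; rewrite has_iotaS /upd !flat_eq // i2 //.
  rewrite /joins (eq_sym x (snd_end k)) (eq_sym y (fst_end k)).
  rewrite (eq_sym x (fst_end k)) (eq_sym y (snd_end k)).
  by case: (_ == _); case: (_ == _); case: (_ == _); case: (_ == _); case: (has _ _).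
- move=> t st1 [i1 i2] [fv fa] _; asimp; rewrite (fv 4 erefl) /st0; asimp.
  rewrite Em => c ht; have E : vars st1 24 = m by case: ltnP c => //; lia.
  by rewrite E in i2; split=> //; move: ht; costs; lia.
Qed.

Definition ndeg (k v : nat) := \sum_(l < k) ((fst_end l == v) + (snd_end l == v)).
Definition start v := \sum_(u < v) ndeg m u.

Lemma startS v : start v.+1 = start v + ndeg m v.
Proof. by rewrite /start big_ord_recr. Qed.

Lemma start_mono v v' : v <= v' -> start v <= start v'.
Proof. by move=> h; rewrite -(subnKC h) /start big_split_ord leq_addr. Qed.

Lemma start_n : start n = 2 * m.
Proof.
rewrite /start /ndeg exchange_big /= (eq_bigr (fun=> 2)) => [|l _].
  by rewrite sum_nat_const card_ord mulnC.
have [a b] := ends_lt (ltn_ord l); rewrite big_split /=.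
rewrite (bigD1 (Ordinal a)) //= eqxx big1 => [|u nu]; last first.
  by apply/eqP; rewrite eqb0 eq_sym; apply: contraNN nu => /eqP E; apply/eqP/val_inj.
rewrite (bigD1 (Ordinal b)) //= eqxx big1 // => u nu.
by apply/eqP; rewrite eqb0 eq_sym; apply: contraNN nu => /eqP E; apply/eqP/val_inj.
Qed.

Lemma ndeg_mono k v : k <= m -> ndeg k v <= ndeg m v.
Proof. by move=> h; rewrite /ndeg -(subnKC h) big_split_ord leq_addr. Qed.

(** The list of [v] after the first [k] edges, which is the loop invariant of [list_neighbors]. *)
Definition row v k := flatten
  [seq nseq (fst_end l == v) (snd_end l) ++ nseq (snd_end l == v) (fst_end l)
     | l <- iota 0 k].
Definition rows v := flatten [seq row u m | u <- iota 0 v].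

Lemma rowS v k : row v k.+1 = row v k ++
  nseq (fst_end k == v) (snd_end k) ++ nseq (snd_end k == v) (fst_end k).
Proof. by rewrite /row -addn1 iotaD map_cat flatten_cat /= cats0 add0n. Qed.

Lemma rowsS v : rows v.+1 = rows v ++ row v m.
Proof. by rewrite /rows -addn1 iotaD map_cat flatten_cat /= cats0 add0n. Qed.

Lemma size_row v k : size (row v k) = ndeg k v.
Proof.
elim: k => [|k IH]; first by rewrite /ndeg big_ord0.
by rewrite rowS !size_cat !size_nseq IH /ndeg big_ord_recr.
Qed.

Lemma size_rows v : size (rows v) = start v.
Proof.
elim: v => [|v IH]; first by rewrite /start big_ord0.
by rewrite rowsS size_cat IH size_row startS.
Qed.

Lemma mem_row v k y : y \in row v k -> k <= m -> y < n.
Proof.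
elim: k => // k IH; rewrite rowS !mem_cat => /orP[/IH h /ltnW//|+ lt].
have [a b] := ends_lt lt.
by case/orP; rewrite mem_nseq => /andP[_ /eqP->].
Qed.

Lemma row_joins x y k l : l < k -> joins x y l -> y \in row x k.
Proof.
elim: k => // k IH; rewrite rowS !mem_cat ltnS leq_eqVlt => /orP[/eqP->|/IH h /h->//].
case/orP=> /andP[/eqP-> /eqP->]; rewrite !mem_nseq !eqxx.
  by rewrite orbT.
by rewrite !orbT.
Qed.

Lemma rows_cat v : v <= n -> exists s, rows n = rows v ++ s.
Proof.
move=> h; rewrite -(subnKC h) /rows iotaD map_cat flatten_cat.
by eexists.
Qed.

Lemma rows_adjacency off nb (e : rel 'I_n) :
  (forall v, v <= n -> off v = start v) ->
  (forall l, l < start n -> nb l = nth 0 (rows n) l) ->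
  (forall x y : 'I_n, e x y -> listed x y) -> adjacency_lists off nb e.
Proof.
move=> hoff hnb he.
have nbE v j : v < n -> j < ndeg m v -> nb (start v + j) = nth 0 (row v m) j.
  move=> vn jd; have [s E] := rows_cat vn.
  have lt : start v + j < start n.
    by apply: leq_trans (start_mono vn); rewrite startS ltn_add2l.
  rewrite hnb // E nth_cat size_rows startS ltn_add2l jd rowsS nth_cat size_rows.
  by rewrite ltnNge leq_addr /= addKn.
split.
- by move=> x xn; rewrite (hoff _ (ltnW xn)) (hoff _ xn) start_mono.
- move=> x k xn; rewrite (hoff _ (ltnW xn)) (hoff _ xn) startS => /andP[h1 h2].
  rewrite -(subnKC h1) nbE //; last by lia.
  apply: (@mem_row x m) => //; apply: mem_nth; rewrite size_row; lia.
- move=> x y /he/hasP[l]; rewrite mem_iota add0n => /andP[_ lm] jl.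
  have yr := row_joins lm jl; exists (index (y : nat) (row x m)).
    rewrite /deg (hoff _ (ltn_ord x)) (hoff _ (ltnW (ltn_ord x))).
    by rewrite startS addKn -size_row index_mem.
  by rewrite (hoff _ (ltnW (ltn_ord x))) nbE ?nth_index // -size_row index_mem.
Qed.

Lemma wp_push_end st (v c : nat) (acc : seq nat) (src cnd : aexpr) (P : nat -> astate -> Prop) :
  okexpr cnd -> okexpr src -> acost cnd + pcost 2 ($25)%A src <= 80 ->
  (bounded q st -> aeval base st src <= q) ->
  aeval base st cnd = (c == v) -> 
  vars st 25 = size acc -> size acc < q ->
  (forall l, l < size acc -> arrs st 2 l = nth 0 acc l) ->
  (forall t st', aframe (AIf cnd (APut 2 ($25)%A src ;; ASet 25 ($25 + #1)) ASkip) st st' ->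
     let acc' := acc ++ nseq (c == v) (aeval base st src) in
     t <= 100 -> vars st' 25 = size acc' ->
     (forall l, l < size acc' -> arrs st' 2 l = nth 0 acc' l) -> P t st') ->
  wp (AIf cnd (APut 2 ($25)%A src ;; ASet 25 ($25 + #1)) ASkip) st P.
Proof.
move=> okc oks cst sb Ec E25 sq hacc fin.
apply: wp_conseq (_ : wp _ _ (fun t st' =>
  let acc' := acc ++ nseq (c == v) (aeval base st src) in
  [/\ t <= 100, vars st' 25 = size acc'
    & forall l, l < size acc' -> arrs st' 2 l = nth 0 acc' l])) _; last first.
  by move=> t st' fr _ [h1 h2 h3]; apply: fin.
apply: wif => //; rewrite Ec; last first.
  move=> c0; have -> : (c == v) = false by case: (c == v) c0.
  by apply: wp_skip; rewrite cats0; split=> //; lia.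
move=> c1; have -> : (c == v) = true by case: (c == v) c1.
apply: wp_seq; apply: wput; [by rewrite oks|exact: sb|asimp; rewrite E25].
apply: wset => //; asimp; rewrite E25; first by move=> _; lia.
split; first by move: cst; costs; lia.
  by rewrite size_cat /= addn1.
move=> l; rewrite size_cat /= addn1 ltnS leq_eqVlt /upd nth_cat.
by case/orP=> [/eqP->|hl]; rewrite ?eqxx ?ltnn ?subnn // (ltn_eqF hl) hl hacc.
Qed.

Lemma start_le v k : v < n -> k <= m -> start v + ndeg k v <= 2 * m.
Proof.
move=> vn km; rewrite -start_n; apply: leq_trans (start_mono vn).
by rewrite startS leq_add2l ndeg_mono.
Qed.

Hypothesis base_q : base <= q.

Lemma wp_list_neighbors st v : input_ok st -> v < n -> vars st 15 = v ->
  vars st 25 = start v ->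
  (forall l, l < start v -> arrs st 2 l = nth 0 (rows v) l) ->
  wp list_neighbors st (fun t st' => [/\ t <= 300 * m + 50,
    arrs st' 1 = upd (arrs st 1) v (start v), vars st' 25 = start v.+1
    & forall l, l < start v.+1 -> arrs st' 2 l = nth 0 (rows v.+1) l]).
Proof.
move=> hin vn Ev E25 hnb; have [En Em Ea Eb] := hin; apply: wp_bounded => bd.
apply: wp_seq; apply: wput => //; asimp; first by move=> _; exact: bd.1.
rewrite Ev E25; apply: wp_seq; apply: wset => //; asimp; set st0 := setv _ _ _.
apply: (wwhile (I := fun s => [/\ vars s 24 <= m,
    vars s 25 = size (rows v ++ row v (vars s 24))
    & forall l, l < size (rows v ++ row v (vars s 24)) ->
        arrs s 2 l = nth 0 (rows v ++ row v (vars s 24)) l])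
  (pot := fun s => 300 * (m - vars s 24))) => //.
- by rewrite /st0; asimp; rewrite cats0 size_rows.
- move=> st1 [i1 i2 i3] [fv fa] bd1; asimp.
  have hin1 : input_ok st1.
    by apply: (input_frame hin); first [exact: fv|exact: fa].
  have [E3 E4 Ea1 Eb1] := hin1; rewrite E4 => c.
  have lt : vars st1 24 < m by case: ltnP c.
  have E15 : vars st1 15 = v by rewrite (fv 15 erefl) /st0; asimp.
  set k := vars st1 24 in i1 i2 i3 lt *.
  have sz : size (rows v ++ row v k) + ((fst_end k == v) + (snd_end k == v)) <= 2 * m.
    rewrite size_cat size_rows size_row -addnA.
    have := start_le vn lt; rewrite /ndeg big_ord_recr /=.
    by move: (\sum_(l < k) _) => a; lia.
  apply: wp_seq; apply: (wp_push_end (v := v) (c := fst_end k) (acc := rows v ++ row v k)) => //.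
  + by asimp; rewrite -/k -?Eb1 // => b; exact: b.2.
  + by asimp; rewrite -/k Ea1 // E15.
  + by move: sz; lia.
  move=> t2 st2 [fv2 fa2]; asimp; rewrite -/k Eb1 // => ht2 s2 n2.
  have K2 : vars st2 24 = k by rewrite (fv2 24 erefl).
  have E15' : vars st2 15 = v by rewrite (fv2 15 erefl).
  have A0 : arrs st2 0 = arrs st1 0 by rewrite (fa2 0 erefl).
  apply: wp_seq; apply: (wp_push_end (v := v) (c := snd_end k)
    (acc := (rows v ++ row v k) ++ nseq (fst_end k == v) (snd_end k))) => //.
  + by move=> b; exact: b.2.
  + by asimp; rewrite K2 A0 Eb1 // E15'.
  + by rewrite size_cat size_nseq; move: sz; lia.
  move=> t3 st3 [fv3 fa3]; asimp; rewrite K2 A0 Ea1 // => ht3 s3 n3.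
  have K3 : vars st3 24 = k by rewrite (fv3 24 erefl).
  have ES : ((rows v ++ row v k) ++ nseq (fst_end k == v) (snd_end k)) ++
      nseq (snd_end k == v) (fst_end k) = rows v ++ row v k.+1.
    by rewrite rowS -!catA.
  rewrite ES in s3 n3.
  apply: wset => //; asimp; rewrite K3 addn1.
    by move=> _; have := bd1.1 4; rewrite E4; lia.
  by split; [split|costs; lia].
- move=> t st1 [i1 i2 i3] [fv fa] _; asimp; rewrite (fv 4 erefl) /st0; asimp.
  rewrite Em => c ht; have E : vars st1 24 = m by case: ltnP c => //; lia.
  rewrite E -rowsS size_rows in i2 i3; split=> //.
    by move: ht; costs; lia.
  by rewrite (fa 1 erefl) /st0; asimp.
Qed.

Lemma wp_set_lists st : input_ok st ->
  wp set_lists st (fun t st' => t <= n * (300 * m + 100) + 100 /\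
    forall e : rel 'I_n, (forall x y : 'I_n, e x y -> listed x y) ->
      adjacency_lists (arrs st' 1) (arrs st' 2) e /\
      \sum_(x < n) deg (arrs st' 1) x = 2 * m).
Proof.
move=> hin; have [En Em Ea Eb] := hin; apply: wp_bounded => bd.
apply: wp_seq; apply: wset => //; asimp.
apply: wp_seq; apply: wset => //; asimp; apply: wp_seq; set st0 := setv _ _ _.
apply: (wwhile (I := fun s => [/\ vars s 15 <= n, vars s 25 = start (vars s 15),
    forall v, v < vars s 15 -> arrs s 1 v = start v
    & forall l, l < start (vars s 15) -> arrs s 2 l = nth 0 (rows (vars s 15)) l])
  (pot := fun s => (n - vars s 15) * (300 * m + 100))) => //.
- by rewrite /st0; asimp; split=> //; rewrite /start big_ord0.
- move=> st1 [i1 i2 i3 i4] [fv fa] bd1; asimp.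
  have hin1 : input_ok st1.
    by apply: (input_frame hin); first [exact: fv|exact: fa].
  have [E3 _ _ _] := hin1; rewrite E3 => c.
  have lt : vars st1 15 < n by case: ltnP c.
  set v := vars st1 15 in i1 i2 i3 i4 lt *.
  apply: wp_seq; apply: wp_conseq (wp_list_neighbors hin1 lt erefl i2 i4) _.
  move=> t2 st2 [fv2 fa2] _ [ht2 A1 s2 n2].
  have K2 : vars st2 15 = v by rewrite (fv2 15 erefl).
  apply: wset => //; asimp; rewrite K2 addn1; first by move=> _; lia.
  split; last first.
    have -> : n - v = (n - v.+1).+1 by lia.
    by rewrite [(n - v.+1).+1 * _]mulSn; move: ((n - v.+1) * _) => a; costs; lia.
  split=> // u; rewrite ltnS A1 /upd leq_eqVlt => /orP[/eqP->|hu].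
    by rewrite eqxx.
  by rewrite (ltn_eqF hu) i3.
- move=> t st1 [i1 i2 i3 i4] [fv fa] _; asimp; rewrite (fv 3 erefl) /st0; asimp.
  rewrite En => c ht; have E : vars st1 15 = n by case: ltnP c => //; lia.
  rewrite E in i2 i3 i4.
  apply: wput => //; asimp; first by case=> bv _; exact: bv.
  rewrite (fv 3 erefl) /st0; asimp; rewrite En i2; split.
    by move: ht; rewrite E subnn mul0n subn0; move: (n * _) => a; costs; lia.
  have hoff v : v <= n -> upd (arrs st1 1) n (start n) v = start v.
    by rewrite /upd; case: (eqVneq v n) => [->|nv] // hv; apply: i3; lia.
  move=> e he; split; first exact: rows_adjacency hoff i4 he.
  rewrite -start_n [start n]/start; apply: eq_bigr => x _.
  by rewrite /deg (hoff _ (ltn_ord x)) (hoff _ (ltnW (ltn_ord x))) startS addKn.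
Qed.

End Init.

(** * The invariant between operations *)

Definition delete_edge : acmd :=
  APut 3 ($0 * $3 + $1) #0 ;; APut 3 ($1 * $3 + $0) #0 ;; refresh.

Lemma vmod_set_K k r : vmod (set_K k) r = Nat.eqb r 5.
Proof.
rewrite /set_K /=; suff: vmod (arepeat k count_up) r -> Nat.eqb r 5.
  by case: (Nat.eqb r 5) => //; case: vmod => // /(_ isT).
by elim: k => //= k IH /orP[|/IH//]; rewrite orbF.
Qed.

Lemma amod_set_K k a : amod (set_K k) a = false.
Proof. by rewrite /set_K /=; elim: k => //= k ->. Qed.

Lemma S_bound n S : (forall i, i < S -> 2 ^ i < 2 * n) -> S <= 2 * n.
Proof.
case: S => // S /(_ S (ltnSn _)); apply: leq_trans.
by have := ltn_expl S (isT : 1 < 2); lia.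
Qed.

Section Updates.

Variables w q base : nat.
Hypothesis q16 : 16 <= q.
Hypothesis qw : forall x, x <= q ^ 50 -> x < 2 ^ w.
Hypothesis base_gt0 : 0 < base.

Notation wp := (wp w q base).
Let wset := @wp_set w q base q16 qw base_gt0.
Let wput := @wp_put w q base q16 qw base_gt0.

Variables n m : nat.

(* Everything that the programs rely on between two operations. *)
Record structure_ok (K S : nat) (off nb : nat -> nat) (e : rel 'I_n) (st : astate)
    : Prop := StructureOk {
  so_static : graph_static K S off nb e st;
  so_lists : adjacency_lists off nb e;
  so_sum : \sum_(x < n) deg off x = 2 * m;
  so_S : forall i, i < S -> 2 ^ i < 2 * n;
  so_S' : 2 * n <= 2 ^ S;
  so_full : forall i, i < S ->
    full_scale off nb (cap K i) (half K i) (radius K i) e (scale_of n st i)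
}.

Definition total_pot K S off st :=
  \sum_(i < S) scale_pot n (cap K i) (half K i) off (scale_of n st i).

Definition initial_pot K S off := \sum_(i < S)
  (#|active n off| %/ half K i) * (fresh_pot n (cap K i) (half K i) off + 200 * n).

Lemma good_blank M h R off nb (e : rel 'I_n) st i :
  arrs st 4 = (fun=> 0) -> arrs st 5 = (fun=> 0) -> arrs st 8 = (fun=> 0) ->
  arrs st 9 = (fun=> 0) -> arrs st 10 = (fun=> 0) ->
  good_scale off nb M h R e (scale_of n st i).
Proof.
move=> A4 A5 A8 A9 A10.
have g0 b : guard b (fun=> 0) = (fun=> 0).
  by apply: functional_extensionality => x; rewrite /guard if_same.
have N0 : sc_n (scale_of n st i) = 0 by rewrite /scale_of A4.
split.
- by exists (fun=> set0); split; rewrite N0.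
- move=> j /andP[_ jn]; rewrite scale_tree // /tree_of A8 A9 A10 !g0.
  by split.
- by move=> x; rewrite scale_ctr // N0 A5.
Qed.

Lemma blank_pot K S off st : arrs st 4 = (fun=> 0) -> arrs st 5 = (fun=> 0) ->
  total_pot K S off st = initial_pot K S off.
Proof.
move=> A4 A5; apply: eq_bigr => i _; rewrite /scale_pot.
have N0 : sc_n (scale_of n st i) = 0 by rewrite /scale_of A4.
rewrite N0 big_ord0 subn0 (eq_bigr (fun=> #|active n off| %/ half K i)) => [|y _].
  by rewrite sum_nat_const card_ord; lia.
by rewrite scale_ctr // A5 subn0.
Qed.

Hypothesis nq : 4 * n <= q.
Hypothesis mq : 2 + n + 4 * n * (2 * m) <= q.
Hypothesis Sq : 2 * n * n.+1 <= q.

(** Only the adjacency matrix records the deletion. The lists keep their entries, and [relax]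
    consults the matrix before it uses one. *)
Lemma wp_delete st K S off nb (e0 e : rel 'I_n) (u v : 'I_n) : 4 <= K ->
  symmetric e0 -> symmetric e -> structure_ok K S off nb e0 st ->
  vars st 0 = u -> vars st 1 = v ->
  (forall x y, e x y = e0 x y && ~~ ((x == u) && (y == v) || (x == v) && (y == u))) ->
  wp delete_edge st (fun t st' => structure_ok K S off nb e st' /\
    t + total_pot K S off st' <= total_pot K S off st + S * (4000 * n.+1) + 60).
Proof.
move=> K4 se0 se [hst csr hsum hS hS' hfull] E0 E1 he.
have [E3 E6 A1 A2 A3 A12 A13 A14] := hst.
have sub x y : e x y -> e0 x y by rewrite he => /andP[].
have csr' : adjacency_lists off nb e.
  by case: csr => h1 h2 h3; split=> // x y /sub; exact: h3.
apply: wp_seq; apply: wput => //; asimp; rewrite E0 E1 E3.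
apply: wp_seq; apply: wput => //; asimp; rewrite E0 E1 E3.
set st1 := seta _ _ _ _.
have gst1 : graph_static K S off nb e st1.
  split=> // x y; rewrite /st1; asimp; rewrite /upd !flat_eq //.
  rewrite A3 he.
  rewrite -[(x : nat) == v]/(x == v) -[(y : nat) == u]/(y == u).
  rewrite -[(x : nat) == u]/(x == u) -[(y : nat) == v]/(y == v).
  by move: (e0 x y) ((x == v) && (y == u)) ((x == u) && (y == v)) => -[] [] [].
have S2 := S_bound hS.
have mq' : 2 + n + 4 * n * \sum_(x < n) deg off x <= q by rewrite hsum.
have Sq' : S * n.+1 <= q by apply: leq_trans Sq; rewrite leq_mul2r S2 orbT.
apply: wp_conseq (wp_refresh q16 qw base_gt0 K4 hS mq' Sq' se0 se csr' gst1 _ _) _.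
- right; exists u, v; split=> //; split=> // x y xy.
  case: (boolP (e x y)) => [|]; first by constructor 1.
  rewrite he xy /= negbK => /orP[/andP[/eqP-> /eqP->]|/andP[/eqP-> /eqP->]].
    by constructor 2.
  by constructor 3.
- by move=> i hi; case: (hfull i hi).
move=> t st2 [fv fa] _ [f2 ht]; split.
  split=> //; apply: (graph_static_frame gst1); first [exact: fv|exact: fa].
have Et : total_pot K S off st1 = total_pot K S off st by [].
move: ht; rewrite -/(total_pot K S off st2) -/(total_pot K S off st1) Et.
by move: (S * _) => a; costs; lia.
Qed.

Variables (fst_end snd_end : nat -> nat).
Hypothesis base_m : 2 * m < base.
Hypothesis base_q : base <= q.
Hypothesis ends_lt : forall k, k < m -> fst_end k < n /\ snd_end k < n.

Notation listed := (listed m fst_end snd_end).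

(** Capping the parameter at [4 * n] makes it storable however small [eps] is. The outer [maxn]
    provides [4 <= K] also for [n = 0]. *)
Lemma wp_init st k (e : rel 'I_n) : 4 <= k ->
  vars st 0 = n -> vars st 1 = m ->
  (forall l, l < m -> arrs st 0 (2 * l) = fst_end l) ->
  (forall l, l < m -> arrs st 0 (2 * l + 1) = snd_end l) ->
  (forall a, 0 < a -> arrs st a = (fun=> 0)) ->
  symmetric e -> (forall x y : 'I_n, e x y = listed x y) ->
  let K := maxn 4 (minn k (4 * n)) in
  wp (init k) st (fun t st' => exists S off nb,
    structure_ok K S off nb e st' /\
    t + total_pot K S off st' <= initial_pot K S off +
      30 * k + n * (300 * m + 100) + 150 * m + 400 * n + S * (4000 * n.+1) + 500).
Proof.
move=> k4 E0 E1 Ea Eb A0 se he K.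
apply: wp_seq; apply: wset => //; asimp; first by case=> bv _; exact: bv.
rewrite E0; apply: wp_seq; apply: wset => //; first by case=> bv _; exact: bv.
asimp; rewrite E1; set st1 := setv _ _ _.
apply: wp_seq; apply: wp_conseq (wp_set_K q16 qw base_gt0 nq k (st := st1) erefl) _.
move=> t2 st2 [fv2 fa2] _ [ht2 K2].
have {}fv2 r : Nat.eqb r 5 = false -> vars st2 r = vars st1 r.
  by move=> hr; apply: fv2; rewrite vmod_set_K.
have {}fa2 a : arrs st2 a = arrs st1 a by apply: fa2; rewrite amod_set_K.
have E3 : vars st2 3 = n by rewrite (fv2 3 erefl).
have K4n : 0 < n -> 4 <= minn k (4 * n) by lia.
apply: wp_seq; apply: wp_conseq (wp_set_parameters q16 qw base_gt0 nq E3 K2 K4n) _.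
move=> t3 st3 [fv3 fa3] _ [S [P1 P2 P3 P4] ht3].
have S2 := S_bound P2.
have KE i : i < S -> K = minn k (4 * n) by move=> hi; rewrite /K; lia.
have hin : input_ok base n m fst_end snd_end st3.
  split; rewrite ?(fv3 3 erefl) ?(fv2 3 erefl) ?(fv3 4 erefl) ?(fv2 4 erefl) //;
  move=> l hl; rewrite (fa3 0 erefl) fa2 modn_small; try lia.
    exact: Ea.
  exact: Eb.
have Z3 : arrs st3 3 = (fun=> 0) by rewrite (fa3 3 erefl) fa2 A0.
apply: wp_seq; apply: wp_conseq (wp_set_matrix q16 qw base_gt0 nq base_m ends_lt hin Z3) _.
move=> t4 st4 [fv4 fa4] _ [ht4 hm].
have hin4 : input_ok base n m fst_end snd_end st4.
  by apply: (input_frame hin); first [exact: fv4|exact: fa4].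
apply: wp_seq; apply: wp_conseq (wp_set_lists q16 qw base_gt0 nq base_m ends_lt base_q hin4) _.
move=> t5 st5 [fv5 fa5] _ [ht5 /(_ e)].
case=> [x y|csr hsum]; first by rewrite he.
set off := arrs st5 1 in csr hsum *; set nb := arrs st5 2 in csr *.
have gst5 : graph_static K S off nb e st5.
  split=> //.
  - by rewrite (fv5 3 erefl) (fv4 3 erefl) (fv3 3 erefl).
  - by rewrite (fv5 6 erefl) (fv4 6 erefl).
  - by move=> x y; rewrite (fa5 3 erefl) hm // he.
  - by move=> i hi; rewrite (fa5 12 erefl) (fa4 12 erefl) (KE i hi); case: (P4 i hi).
  - by move=> i hi; rewrite (fa5 13 erefl) (fa4 13 erefl) (KE i hi); case: (P4 i hi).
  - by move=> i hi; rewrite (fa5 14 erefl) (fa4 14 erefl) (KE i hi); case: (P4 i hi).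
have K4 : 4 <= K by rewrite leq_maxl.
have mq' : 2 + n + 4 * n * \sum_(x < n) deg off x <= q by rewrite hsum.
have Sq' : S * n.+1 <= q by apply: leq_trans Sq; rewrite leq_mul2r S2 orbT.
have Zt a : amod (set_lists ;; set_matrix ;; set_parameters) a = false ->
    0 < a -> arrs st5 a = (fun=> 0).
  move=> /norP[/negPf h1 /norP[/negPf h2 /negPf h3]] a0.
  by rewrite fa5 // fa4 // fa3 // fa2 A0.
have Z4 : arrs st5 4 = (fun=> 0) by exact: Zt.
have Z5 : arrs st5 5 = (fun=> 0) by exact: Zt.
have Z8 : arrs st5 8 = (fun=> 0) by exact: Zt.
have Z9 : arrs st5 9 = (fun=> 0) by exact: Zt.
have Z10 : arrs st5 10 = (fun=> 0) by exact: Zt.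
apply: wp_conseq (wp_refresh q16 qw base_gt0 K4 P2 mq' Sq' se se csr gst5 _ _) _.
- by left=> i _; rewrite Z4.
- by move=> i _; apply: good_blank.
move=> t6 st6 [fv6 fa6] _ [f6 ht6]; exists S, off, nb; split.
  split=> //; apply: (graph_static_frame gst5); first [exact: fv6|exact: fa6].
move: ht6; rewrite -/(total_pot K S off st6) -/(total_pot K S off st5) (blank_pot K S off Z4 Z5).
move: (S * _) (initial_pot _ _ _) (total_pot _ _ _ _) ht5 ht4 ht3 ht2 => a b d.
by move: (n * _) => c; costs; lia.
Qed.

End Updates.

(** * Queries *)

Definition search : acmd :=
  ASet 26 #0 ;; ASet 27 $6 ;;
  AWhile ($26 < $27)
    (ASet 28 (($26 + $27) %/ #2) ;;
     ASet 17 (5@[$28 * $3 + $0]) ;;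
     AIf (($17 == 4@[$28]) +
          (12@[$28] < 8@[($28 * ($3 + #1) + $17) * $3 + $0]) +
          (8@[($28 * ($3 + #1) + $17) * $3 + $1] < 14@[$28]))
       (ASet 27 $28) (ASet 26 ($28 + #1))).

Definition read_distance : acmd :=
  AIf ($26 < $6)
    (ASet 17 (5@[$26 * $3 + $0]) ;;
     ASet 12 ($26 * ($3 + #1) + $17) ;;
     AIf (($17 < 4@[$26]) * (8@[$12 * $3 + $0] < 12@[$26] + #1))
       (ASet 1 (8@[$12 * $3 + $0] + 8@[$12 * $3 + $1] -
                8@[$12 * $3 + 6@[$12]] * #2) ;;
        ASet 0 #0)
       (ASet 0 #1))
    (ASet 0 #1).

Definition query : acmd :=
  AIf ($0 == $1) (ASet 0 #0 ;; ASet 1 #0) (search ;; read_distance).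

(** The value 0 on the empty interval lets each bisection step decrease it, including the last one
    from length 1. *)
Definition bits d := if d is 0 then 0 else (trunc_log 2 d).+1.

Lemma bits_half d d' : 0 < d -> d' <= d %/ 2 -> (bits d').+1 <= bits d.
Proof.
move=> d0 hd; have [d1|d1] := leqP d 1.
  have -> : d = 1 by lia.
  by have -> : d' = 0 by lia.
case: d d0 d1 hd => // d _ d1 hd; rewrite {2}/bits trunc_log2S // ltnS.
case: d' hd => //= d' hd; rewrite ltnS; apply: leq_trunc_log.
by rewrite divn2 in hd.
Qed.

Lemma half_small K i : 4 <= K -> half K i.+1 <= 2 ^ i.
Proof.
move=> K4; rewrite /half; have := radius_le i.+1 K4.
have : 0 < 2 ^ i by rewrite expn_gt0.
by rewrite expnS; move: (2 ^ i) (radius K i.+1) => a b; lia.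
Qed.

Section Query.

Variables w q base : nat.
Hypothesis q16 : 16 <= q.
Hypothesis qw : forall x, x <= q ^ 50 -> x < 2 ^ w.
Hypothesis base_gt0 : 0 < base.

Notation wp := (wp w q base).
Let wset := @wp_set w q base q16 qw base_gt0.
Let wif := @wp_if w q base q16 qw base_gt0.
Let wwhile := @wp_while w q base q16 qw base_gt0.

Variables (n m K S : nat) (off nb : nat -> nat) (e : rel 'I_n) (x y : 'I_n).
Hypothesis K4 : 4 <= K.
Hypothesis se : symmetric e.
Hypothesis nq : 8 * n <= q.
Hypothesis Sq : S * n.+1 <= q.

(** Scales at which [x] is not covered count as near, so that the negation certifies a distance of
    more than [2 ^ i]. *)
Definition near st i := ~~ covered (radius K i) (scale_of n st i) x ||
  (tL (sc_tree (scale_of n st i) (sc_ctr (scale_of n st i) x)) y < cap K i).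

(** The levels of [x] and [y] differ by at least [cap K i - radius K i], which exceeds [2 ^ i]. *)
Lemma far_walk st i k : structure_ok m K S off nb e st -> i < S ->
  ~~ near st i -> walk e x y k -> 2 ^ i < k.
Proof.
move=> [hst csr _ _ _ hfull] iS; rewrite negb_or negbK -leqNgt => /andP[/andP[cN cL] far] wk.
have [[[Ret [good _ _]] _ _] _] := hfull i iS.
have [r [[_ _ _ lip _ _] _] _] := good _ cN.
have := lipschitz_walk lip wk; move: far cL; rewrite /cap /half; lia.
Qed.

Lemma center_le st i : structure_ok m K S off nb e st -> i < S ->
  arrs st 4 i <= n /\ arrs st 5 (i * n + x) <= arrs st 4 i.
Proof.
move=> hs iS; have [gs _] := so_full hs iS.
have [_ h1] := good_scale_le se (isT : 0 < half K i) gs.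
by have [_ _ /(_ x)[h2 _]] := gs; rewrite scale_ctr // in h2.
Qed.

(** No monotonicity of [near] is required: bisection keeps [near] at the upper end, unless that is
    [S], and its negation just below the lower end. Such an adjacent pair is what the error analysis
    uses. *)
Lemma wp_search st : structure_ok m K S off nb e st -> vars st 0 = x -> vars st 1 = y ->
  wp search st (fun t st' => t <= 200 * bits S + 20 /\
    exists2 i, vars st' 26 = i & [/\ i <= S, i < S -> near st i
      & forall i', i = i'.+1 -> ~~ near st i']).
Proof.
move=> hs Ex Ey; have [hst csr _ _ _ _] := hs.
have [E3 E6 _ _ _ A12 A13 A14] := hst; apply: wp_bounded => bd.
apply: wp_seq; apply: wset => //; asimp.
apply: wp_seq; apply: wset => //; first by case=> bv _; exact: bv.
asimp; rewrite E6; set st0 := setv _ _ _.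
apply: (wwhile (I := fun s => [/\ vars s 26 <= vars s 27 <= S,
    vars s 27 < S -> near st (vars s 27)
    & forall i', vars s 26 = i'.+1 -> ~~ near st i'])
  (pot := fun s => 200 * bits (vars s 27 - vars s 26))) => //.
- by rewrite /st0; asimp; rewrite leqnn ltnn.
- move=> st1 [i1 i2 i3] [fv fa] bd1; rewrite /st0 in fv fa; asimp => c.
  have lt : vars st1 26 < vars st1 27 by case: ltnP c.
  set lo := vars st1 26 in i1 i2 i3 lt *; set hi := vars st1 27 in i1 i2 i3 lt *.
  apply: wp_seq; apply: wset => //; asimp.
    by move=> _; rewrite -/lo -/hi; have := bd1.1 27; rewrite -/hi; lia.
  rewrite -/lo -/hi; set mid := (lo + hi) %/ 2.
  have hmid : lo <= mid < hi by rewrite /mid; lia.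
  have mS : mid < S by lia.
  move: (fv 3 erefl) (fv 0 erefl) (fv 1 erefl) (fa 4 erefl) (fa 5 erefl) (fa 8 erefl)
    (fa 12 erefl) (fa 14 erefl).
  asimp; rewrite E3 Ex Ey => F3 F0 F1 B4 B5 B8 B12 B14.
  apply: wp_seq; apply: wset => //; first by case=> _ ba; exact: ba.
  asimp; rewrite F3 F0 B5; set ct := arrs st 5 _.
  have [cn cle] := center_le hs mS; rewrite -/ct in cle.
  have ctn : ct <= n by exact: leq_trans cle cn.
  have Hnear : ((ct == arrs st 4 mid) +
      (radius K mid < tL (tree_of n st (tix n mid ct)) x) +
      (tL (tree_of n st (tix n mid ct)) y < cap K mid) != 0) = near st mid.
    rewrite /near /covered scale_ctr // -/ct scale_tree //.
    have -> : sc_n (scale_of n st mid) = arrs st 4 mid by [].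
    case: (eqVneq ct (arrs st 4 mid)) => [->|nc].
      by rewrite ltnn; case: (_ < _); case: (_ < _).
    have -> : ct < arrs st 4 mid by lia.
    by rewrite /= -ltnNge; case: (_ < _); case: (_ < _).
  apply: wif => //; asimp; rewrite ?F3 ?F0 ?F1 B4 B8 B12 B14 A12 // A14 // addn1;
    rewrite -/(tix n mid ct) !tree_L //.
    rewrite Hnear => hn; apply: wset => //; asimp; first by move=> _; have := bd1.1 27; rewrite -/hi; lia.
    rewrite -/lo; split; first by split=> //; lia.
    have := @bits_half (hi - lo) (mid - lo).
    move: (bits _) (bits _) => a b; costs => /(_ ltac:(lia) ltac:(rewrite /mid; lia)); lia.
  move=> hn; have {}hn : ~~ near st mid by rewrite -Hnear hn.
  apply: wset => //; asimp; first by move=> _; have := bd1.1 27; rewrite -/hi; lia.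
  rewrite addn1 -/hi; split.
    by split=> [|//|i' [<-]//]; lia.
  have := @bits_half (hi - lo) (hi - mid.+1).
  move: (bits _) (bits _) => a b; costs => /(_ ltac:(lia) ltac:(rewrite /mid; lia)); lia.
- move=> t st1 [i1 i2 i3] [fv fa] _; asimp => c ht.
  have E : vars st1 26 = vars st1 27 by case: ltnP c => //; lia.
  split; first by move: ht; rewrite /st0; asimp; rewrite subn0; costs; lia.
  exists (vars st1 26) => //; split=> //; first by lia.
  by rewrite E.
Qed.

(** The additive error [2 * radius K i.+1] comes with the lower bound [2 ^ i] on the length, which
    makes it a relative error. *)
Definition answers (st : astate) :=
  (vars st 0 = 0 /\ walk e x y (vars st 1) /\
   forall k, walk e x y k -> vars st 1 <= k \/
     exists i, [/\ i.+1 < S, 2 ^ i < k & vars st 1 <= k + 2 * radius K i.+1]) \/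
  (vars st 0 = 1 /\ ~~ connect e x y).

(** In a component with fewer than [half K i.+1 <= 2 ^ i] vertices, a reachable [y] has a walk
    shorter than [2 ^ i], which the previous scale excludes. At scale 0 the component would be
    empty. *)
Lemma dead_unreachable st i : structure_ok m K S off nb e st -> x != y -> i < S ->
  (forall i', i = i'.+1 -> ~~ near st i') ->
  dead off (half K i) e x -> ~~ connect e x y.
Proof.
move=> hs xy iS hn; have [hst csr _ _ _ _] := hs.
case/orP=> [|sm].
  apply: contraNN => /connectP[[|z p] /=]; first by move=> _ E; rewrite E eqxx in xy.
  case/andP=> xz _ _; have [_ _ cpl] := csr; have [k kd _] := cpl _ _ xz.
  by rewrite inE; lia.
apply/negP=> /connect_small_walk[k kc wk].
case: i iS hn sm => [|i] iS hn sm.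
  have k0 : k = 0 by have := half0 K4; lia.
  by case: wk => -[|z p] _ [/= E sp]; [rewrite E eqxx in xy|rewrite k0 in sp].
have := far_walk hs (ltnW iS) (hn i erefl) wk; have := half_small i K4.
by lia.
Qed.

Lemma wp_query st : structure_ok m K S off nb e st -> vars st 0 = x -> vars st 1 = y ->
  wp query st (fun t st' => t <= 200 * bits S + 300 /\ answers st' /\
    structure_ok m K S off nb e st').
Proof.
move=> hs Ex Ey; have [hst csr hsum hS hS' hfull] := hs.
have [E3 E6 _ _ _ A12 A13 A14] := hst; apply: wp_bounded => bd.
(* [query] writes no array, so the structure survives by framing. *)
suff H : wp query st (fun t st' => t <= 200 * bits S + 300 /\ answers st').
  apply: wp_conseq H _ => t st' [fv fa] _ [h1 h2]; split=> //; split=> //.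
  have A a : arrs st' a = arrs st a by exact: fa.
  split=> //.
    by apply: (graph_static_frame hst); rewrite ?A //; exact: fv.
  move=> i hi; rewrite (_ : scale_of n st' i = scale_of n st i); first exact: hfull.
  apply: scale_of_eq; rewrite ?A // => j _.
  by apply: tree_frame; exact: A.
apply: wif => //; asimp; rewrite Ex Ey.
  move=> c; have xy : x = y by apply: val_inj; case: (eqVneq (x : nat) y) c.
  apply: wp_seq; apply: wset => //; asimp; apply: wset => //; asimp.
  split; first by costs; lia.
  left; split=> //; asimp; rewrite -xy; split; first exact: walk0.
  by move=> k _; left.
move=> c; have xy : x != y by apply/eqP => E; move: c; rewrite E eqxx.
apply: wp_seq; apply: wp_conseq (wp_search hs Ex Ey) _.
move=> t2 st2 [fv fa] _ [ht2 [i Ei [iS hnear hfar]]].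
have A a : arrs st2 a = arrs st a by exact: fa.
move: (fv 3 erefl) (fv 0 erefl) (fv 1 erefl) (fv 6 erefl).
rewrite E3 Ex Ey E6 => F3 F0 F1 F6.
apply: wif => //; asimp; rewrite Ei F6; last first.
  (* Even the last scale does not reach [y]: each walk would be longer than [2 ^ S.-1 >= n], but
     connected vertices have a walk of length less than [n]. *)
  move=> c2; have {iS hnear c2}iS : i = S by case: ltnP c2 => //; lia.
  apply: wset => //; asimp; first by move=> _; lia.
  split; first by costs; lia.
  right; split=> //; apply/negP=> /connect_small_walk[k kc wk].
  have n0 : 0 < n by have := ltn_ord x; lia.
  have S0 : 0 < S by case: (posnP S) hS' => // ->; rewrite expn0; lia.
  have SS : S.-1 < S by rewrite prednK.
  have ES : i = S.-1.+1 by rewrite iS prednK.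
  have := far_walk hs SS (hfar _ ES) wk.
  have : #|comp e x| <= n by rewrite -[X in _ <= X]card_ord max_card.
  have E2 : 2 ^ S = 2 * 2 ^ S.-1 by rewrite -expnS prednK.
  by move: hS' kc; rewrite E2; move: (2 ^ S.-1) (#|_|) => a b; lia.
move=> c2; have {c2}iS' : i < S by case: ltnP c2.
have [cn cle] := center_le hs iS'.
apply: wp_seq; apply: wset => //; first by case=> _ ba; exact: ba.
asimp; rewrite Ei F3 F0 A; set ct := arrs st 5 _ in cle *.
have ctn : ct <= n by exact: leq_trans cle cn.
apply: wp_seq; apply: wset => //; asimp; rewrite Ei F3 addn1 -/(tix n i ct).
  move=> _; apply: leq_trans Sq; apply: (@leq_trans (i.+1 * n.+1)).
    by rewrite /tix mulSn addnC leq_add2r; apply: leq_trans ctn (leqnSn _).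
  by rewrite leq_mul2r iS' orbT.
set T := tix n i ct.
have cE : (ct < arrs st 4 i) * (tL (tree_of n st T) x < (radius K i).+1)
    = covered (radius K i) (scale_of n st i) x.
  rewrite /covered scale_ctr // -/ct scale_tree // -/T.
  have -> : sc_n (scale_of n st i) = arrs st 4 i by [].
  by rewrite ltnS; case: (ct < _); case: (_ <= _).
apply: wif => //; asimp; rewrite ?Ei ?F3 ?F0 !A A12 // addn1 tree_L // cE; last first.
  move=> nc; apply: wset => //; asimp; first by move=> _; lia.
  split; first by costs; lia.
  right; split=> //; have [_ /(_ x)] := hfull i iS'.
  case: covered nc => //= _; exact: dead_unreachable hs xy iS' hfar.
move=> hc; have {hc}hc : covered (radius K i) (scale_of n st i) x by case: covered hc.
have := hnear iS'; rewrite /near hc orFb scale_ctr // -/ct scale_tree // -/T => yM.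
move: (hc); rewrite /covered scale_ctr // -/ct scale_tree // -/T => /andP[cN cL].
have [[[Ret [good _ _]] _ _] _] := hfull i iS'.
have [r hset _] := good _ cN; rewrite scale_tree // -/T in hset.
have [[hr _ low lip _ _] _] := hset.
have xM : tL (tree_of n st T) x < cap K i := leq_ltn_trans cL (radius_cap i K4).
have ltM := cap_lt K4 (hS i iS').
have ER : arrs st 6 T = r by exact: hr.
apply: wp_seq; apply: wset => //; asimp; rewrite ?F3 ?F0 ?F1 !A ER !tree_L //.
  move=> _; apply: leq_trans (leq_subr _ _) _.
  by move: xM yM ltM nq; lia.
apply: wset => //; asimp.
split; first by costs; lia.
left; split=> //; asimp.
have wx := settled_walk se hset xM erefl; have wy := settled_walk se hset yM erefl.
have /andP[lx _] := low x; have /andP[ly _] := low y.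
split.
  have := walk_cat (walk_sym se wx) wy.
  by congr (walk e x y _); lia.
move=> k wk; have := lipschitz_walk lip wk => hk.
(* There is no previous scale below scale 0, but there the radius is 0 and the answer is exact. *)
have [i0|i0] := posnP i.
  left; have R0 : radius K i = 0 by rewrite i0 /radius expn0 divn_small //; lia.
  by move: cL hk lx ly; rewrite R0; lia.
right; exists i.-1; rewrite prednK //; split=> //; last by move: cL hk lx ly; lia.
by apply: far_walk hs _ (hfar _ (Logic.eq_sym (prednK i0))) wk; lia.
Qed.

End Query.

(** * Total time and word size *)

(** From [2 ^ i < (radius + 1) * K <= 2 * h * K] follows [cap K i <= 3 * K * h]. Multiplied by the
    number of centers, at most [a / h], the factor [h] cancels, so that every scale costs of order
    [K m n] independently of [i]. *)
Lemma scale_trees_le n m K i off : 4 <= K -> \sum_(x < n) deg off x = 2 * m ->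
  (#|active n off| %/ half K i) *
    (fresh_pot n (cap K i) (half K i) off + 200 * n) <= 4000 * (4 * K * m * n).
Proof.
move=> K4 hsum; set a := #|active n off|.
have an : a <= n by rewrite -[X in _ <= X]card_ord max_card.
have am : a <= 2 * m.
  rewrite -hsum /a -sum1_card [X in _ <= X](bigID [pred x | x \in active n off]) /=.
  apply: leq_trans (leq_addr _ _); apply: leq_sum => x.
  by rewrite inE; apply.
have sumM M : \sum_(x < n) M * (deg off x).+1 = M * (2 * m + n).
  rewrite -big_distrr (eq_bigr (fun x : 'I_n => deg off x + 1)) /=; last first.
    by move=> x _; rewrite addn1.
  by rewrite big_split /= hsum sum_nat_const card_ord muln1.
rewrite /fresh_pot sumM hsum; set h := half K i; set d := a %/ h.
have dh : d * h <= a by exact: leq_divM.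
have Mh : cap K i <= 3 * K * h.
  have : 2 ^ i < (radius K i).+1 * K by rewrite ltn_ceil //; lia.
  have : (radius K i).+1 <= 2 * h by rewrite /h /half; lia.
  rewrite /cap -/h; move: (2 ^ i) (radius K i) => p r; nia.
have dM : d * cap K i <= 3 * K * a.
  apply: leq_trans (_ : d * (3 * K * h) <= _); first by rewrite leq_mul2l Mh orbT.
  by rewrite mulnCA leq_mul2l dh orbT.
have h1 : 0 < h by [].
have da : d <= a by exact: leq_div.
move: (cap K i) dM => M dM {Mh sumM hsum}.
have a1 : a * (2 * m + n) <= 4 * (m * n) by nia.
have a2 : a * n.+1 <= 4 * (m * n) by case: (posnP n) an => [->|n0] an; nia.
have d1 : d * M * (2 * m + n) <= 12 * K * (m * n).
  by apply: leq_trans (_ : 3 * K * a * (2 * m + n) <= _); [rewrite leq_mul2r dM orbT|nia].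
have d2 : d * (2 * m) <= 2 * (m * n) by nia.
have d3 : d * h * n.+1 <= 4 * (m * n).
  by apply: leq_trans a2; rewrite leq_mul2r dh orbT.
have d4 : d * n.+1 <= 4 * (m * n).
  by apply: leq_trans a2; rewrite leq_mul2r da orbT.
have d5 : d * n <= 4 * (m * n).
  by apply: leq_trans d4; rewrite leq_mul2l leqnSn orbT.
have -> : d * (1200 * (M * (2 * m + n)) + 400 * (2 * m) + 500 * (h * n.+1) +
   300 * n.+1 + 200 * n) = 1200 * (d * M * (2 * m + n)) + 400 * (d * (2 * m)) +
   500 * (d * h * n.+1) + 300 * (d * n.+1) + 200 * (d * n) by lia.
have K1 : 4 * (m * n) <= K * (m * n) by rewrite leq_mul2r K4 orbT.
have -> : 4000 * (4 * K * m * n) = 4000 * (4 * (K * (m * n))) by lia.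
move: d1; rewrite -[12 * K * _]mulnA.
move: (K * (m * n)) (m * n) (d * M * _) (d * (2 * m)) (d * h * _) (d * n.+1) (d * n)
  d2 d3 d4 d5 K1 => A B x1 x2 x3 x4 x5.
by lia.
Qed.

Lemma initial_pot_le n m K S off : 4 <= K -> \sum_(x < n) deg off x = 2 * m ->
  initial_pot n K S off <= S * (4000 * (4 * K * m * n)).
Proof.
move=> K4 hsum; rewrite /initial_pot.
apply: leq_trans (_ : \sum_(i < S) 4000 * (4 * K * m * n) <= _).
  by apply: leq_sum => i _; exact: scale_trees_le.
by rewrite sum_nat_const card_ord.
Qed.

(* The programs store numbers up to [quota n], and the 50th power of it, which
   bounds all intermediate results, still fits into a word. *)
Definition quota n := 2 ^ ((trunc_log 2 n).+1 * 8).

(** The 50th power of the quota is 2 to the power [400 * (trunc_log 2 n).+1]; the factor 401 makes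
    the inequality strict. *)
Lemma quota_word n w : 401 * (trunc_log 2 n).+1 <= w ->
  forall x, x <= quota n ^ 50 -> x < 2 ^ w.
Proof.
move=> hw x; rewrite /quota -expnM => /leq_ltn_trans; apply.
by rewrite ltn_exp2l //; lia.
Qed.

(** The largest stored quantity, the size of the stack, is cubic in [n]. The quota is [b ^ 8] for a
    power of two [b > n], and [b ^ 5 >= 32] absorbs the constants. *)
Lemma quota_large n : exists b, [/\ n < b, 1 < b & 32 * (b * b * b) <= quota n].
Proof.
exists (2 ^ (trunc_log 2 n).+1); split; first exact: trunc_log_ltn.
  by rewrite -{1}(expn0 2) ltn_exp2l.
rewrite /quota expnM; set b := 2 ^ _.
have b2 : 1 < b by rewrite -{1}(expn0 2) ltn_exp2l.
have -> : b ^ 8 = b * b * b * (b * b * b * (b * b)) by rewrite !expnS expn0; lia.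
rewrite mulnC leq_mul2l; apply/orP; right.
by apply: (leq_trans (_ : _ <= 2 * 2 * 2 * (2 * 2))) => //; rewrite !leq_mul.
Qed.

Lemma scales_le n S : (forall i, i < S -> 2 ^ i < 2 * n) ->
  S <= 2 * (trunc_log 2 n).+1.
Proof.
case: S => // S /(_ S (ltnSn _)) hS.
have : S <= (trunc_log 2 n).+1.
  have := trunc_log_ltn n (isT : 1 < 2) => /ltnW hn.
  rewrite -ltnS -(ltn_exp2l _ _ (isT : 1 < 2)); apply: leq_trans hS _.
  by rewrite [2 ^ _.+2]expnS leq_mul2l.
by lia.
Qed.

(** * Graphs and operations *)

Lemma edge_eq n (x y u v : 'I_n) :
  (edge x y == edge u v) = (x == u) && (y == v) || (x == v) && (y == u).
Proof.
apply/eqP/idP => [E|/orP[]/andP[/eqP-> /eqP->] //]; last by rewrite /edge setUC.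
have := set21 x y; have := set22 x y; have := set21 u v; have := set22 u v.
rewrite -/(edge x y) -/(edge u v) E -{1 2}E !inE !(eq_sym u) !(eq_sym v).
by do 4 case: eqP => _ //=.
Qed.

Lemma adj_sym n (G : graph n) : symmetric (adj G).
Proof. by move=> x y; rewrite /adj /edge setUC. Qed.

Lemma adj_delete n (G : graph n) (u v x y : 'I_n) : adj (G :\ edge u v) x y =
  adj G x y && ~~ ((x == u) && (y == v) || (x == v) && (y == u)).
Proof. by rewrite /adj in_setD1 edge_eq andbC. Qed.

Section Input.

Variables (n : nat) (G : graph n) (es : seq ('I_n * 'I_n)).
Let flat := flatten [seq [:: val e.1; val e.2] | e <- es].

Lemma size_input : size flat = 2 * size es.
Proof. by rewrite /flat; elim: es => //= e l IH; rewrite IH; lia. Qed.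

Lemma nth_input0 x0 l : l < size es -> nth 0 flat (2 * l) = (nth x0 es l).1.
Proof.
rewrite /flat; elim: es l => // e s IH [|l] hl //.
by rewrite (_ : 2 * l.+1 = (2 * l).+2); [exact: IH|lia].
Qed.

Lemma nth_input1 x0 l : l < size es -> nth 0 flat (2 * l + 1) = (nth x0 es l).2.
Proof.
rewrite /flat; elim: es l => // e s IH [|l] hl //.
by rewrite (_ : 2 * l.+1 + 1 = (2 * l + 1).+2); [exact: IH|lia].
Qed.

Lemma input_lt k : nth 0 flat k <= n.
Proof.
have [hk|hk] := ltnP k (size flat); last by rewrite nth_default.
have : all (fun j => j <= n) flat.
  by rewrite /flat; elim: es => //= e l ->; rewrite (ltnW (ltn_ord e.1)) (ltnW (ltn_ord e.2)).
by move/all_nthP; apply.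
Qed.

Hypothesis hes : edge_listing G es.

Lemma listing_size : size es = #|G|.
Proof. by rewrite cardE -(perm_size hes) size_map. Qed.

Lemma listing_le : size es <= n * n.
Proof.
have : uniq es by apply: (@map_uniq _ _ (fun e => edge e.1 e.2)); rewrite (perm_uniq hes) enum_uniq.
by move/card_uniqP <-; apply: leq_trans (max_card _) _; rewrite card_prod !card_ord.
Qed.

Lemma listed_adj (x y : 'I_n) : adj G x y =
  listed (size es) (fun l => nth 0 flat (2 * l)) (fun l => nth 0 flat (2 * l + 1)) x y.
Proof.
have -> : adj G x y = (edge x y \in [seq edge e.1 e.2 | e <- es]).
  by rewrite (perm_mem hes) mem_enum.
apply/mapP/hasP => [[e ein E]|[l]].
  exists (index e es); first by rewrite mem_iota index_mem.
  rewrite /joins (nth_input0 e) ?(nth_input1 e) ?index_mem // nth_index //.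
  by have := edge_eq e.1 e.2 x y; rewrite -E eqxx -!(inj_eq val_inj) => <-.
rewrite mem_iota /= add0n => hl.
have [e0 _] : exists e0 : 'I_n * 'I_n, True by case: es hl => // e0; exists e0.
rewrite /joins (nth_input0 e0) ?(nth_input1 e0) // => h.
exists (nth e0 es l); first exact: mem_nth.
by apply/eqP; rewrite eq_sym edge_eq -!(inj_eq val_inj).
Qed.

End Input.

(** The logic presupposes that register 2 holds [base], so this assignment precedes the compiled
    code. The summand 1 keeps [base] positive for a graph without edges. *)
Definition initialize k : cmd :=
  Seq (Assign 2 (Bin Add (Bin Mul (Lit 2) (Reg 1)) (Lit 1))) (compile (init k)).

Section Transitions.

Variables w n m : nat.
Hypothesis hw : 401 * (trunc_log 2 n).+1 <= w.
Hypothesis hm : m <= n * n.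

Let qw := quota_word hw.
Notation q := (quota n).
Notation base := (2 * m + 1).

Lemma quota_bounds : [/\ 16 <= q, 8 * n <= q, 2 + n + 4 * n * (2 * m) <= q,
  2 * n * n.+1 <= q & base <= q].
Proof.
have [b [nb b1 hq]] := quota_large n.
have mb : m <= b * b by apply: leq_trans hm _; rewrite leq_mul // ltnW.
have c1 : b * b * 2 <= b * b * b by rewrite leq_mul2l b1 orbT.
have c2 : b * 2 <= b * b by rewrite leq_mul2l b1 orbT.
have nm : n * m <= b * b * b.
  by rewrite [X in X <= _]mulnC leq_mul // ltnW.
have nn : n * n.+1 <= b * b by rewrite leq_mul // ltnW.
have -> : 4 * n * (2 * m) = 8 * (n * m) by lia.
have -> : 2 * n * n.+1 = 2 * (n * n.+1) by lia.
move: (b * b * b) (b * b) (n * m) (n * n.+1) (quota n) hq mb c1 c2 nm nn nb b1.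
by move=> B3 B2 x1 x2 Q *; split; lia.
Qed.

Definition data_ok K S off nb (G : graph n) s pot := exists2 st,
  represents q base st s &
  structure_ok m K S off nb (adj G) st /\ total_pot n K S off st = pot.

Definition setup_cost k S := 30 * k + n * (300 * m + 100) + 150 * m + 400 * n +
  S * (4000 * n.+1) + 510.

Lemma initialize_ok k (G : graph n) es : 4 <= k -> edge_listing G es -> size es = m ->
  exists t s S off nb pot, [/\ exec w (initialize k) (input_state es) t s,
    data_ok (maxn 4 (minn k (4 * n))) S off nb G s pot
    & t + pot <= initial_pot n (maxn 4 (minn k (4 * n))) S off + setup_cost k S].
Proof.
move=> k4 hes Em; have [q16 n8 hq1 hq2 hq3] := quota_bounds.
have n4 : 4 * n <= q by lia.
have small x : x <= q -> x %% 2 ^ w = x.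
  move=> hx; apply/modn_small/qw; apply: leq_trans hx _.
  by rewrite -{1}(expn1 q) leq_pexp2l // (leq_trans _ q16).
set st := AState (upd (nth 0 [:: n; m]) 2 base) (fun a => if a is 0 then
  nth 0 (flatten [seq [:: val e.1; val e.2] | e <- es]) else fun=> 0).
set s1 := State (upd (nth 0 [:: n; m]) 2 base) (mem (input_state es)).
have hex : exec w (Assign 2 (Bin Add (Bin Mul (Lit 2) (Reg 1)) (Lit 1)))
    (input_state es) 6 s1.
  have -> : s1 = State (upd (regs (input_state es)) 2 (eval w (input_state es)
      (Bin Add (Bin Mul (Lit 2) (Reg 1)) (Lit 1)))) (mem (input_state es)).
    rewrite /s1 /= /binop_sem Em (small 2) ?(small 1) ?(small (2 * m)) ?small //; lia.
  exact: ExecAssign.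
have hrep : represents q base st s1.
  split=> //.
  - split=> [r|a k']; rewrite /st /=; last first.
      by case: a => // ; apply: leq_trans (input_lt es _) _; lia.
    rewrite /upd; case: eqP => // _; case: r => [|[|r]] /=; [lia|lia|].
    by rewrite nth_nil.
  - by move=> [|a] // k' _; rewrite /s1 [LHS]nth_default // size_input Em; lia.
have listed_m := listed_adj hes; rewrite Em in listed_m.
have [||k' km|||l hl|l hl|[|a]|t [s' [st' [ex rep _ [S [off [nb [hs ht]]]]]]]] := @wp_init w q base
  q16 qw _ n m n4 hq1 hq2 _ _ _ hq3 _ st k (adj G) k4 _ _ _ _ _ (adj_sym G) listed_m s1 hrep.
all: try by []; try lia.
  have [e0 _] : exists e0 : 'I_n * 'I_n, True.
    by move: km; rewrite -Em; case: (es) => // e0; exists e0.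
  by rewrite (nth_input0 e0) ?(nth_input1 e0) ?Em.
exists (6 + t), s', S, off, nb, (total_pot n (maxn 4 (minn k (4 * n))) S off st').
split; [exact: ExecSeq hex ex|by exists st'|].
by move: ht; rewrite /setup_cost; move: (_ * _) (n * _) (S * _) => a b c; lia.
Qed.


Lemma call_represents st s (u v : 'I_n) : n <= q -> represents q base st s ->
  represents q base (setv (setv st 0 u) 1 v) (call u v s).
Proof.
move=> nq [hr h2 [bv ba] h0 ha]; split=> //.
- by move=> r /=; rewrite /upd hr; case: r => [|[|r]].
- by split=> // -[|[|r]] //=; apply: leq_trans nq; exact: ltnW.
Qed.

Lemma call_ok K S off nb (e : rel 'I_n) st (u v : nat) :
  structure_ok m K S off nb e st -> structure_ok m K S off nb e (setv (setv st 0 u) 1 v).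
Proof. by case=> -[*] *; split. Qed.

Lemma delete_ok K S off nb (G : graph n) s pot (u v : 'I_n) : 4 <= K ->
  data_ok K S off nb G s pot -> edge u v \in G ->
  exists t s' pot', [/\ exec w (compile delete_edge) (call u v s) t s',
    data_ok K S off nb (G :\ edge u v)%SET s' pot' &
    t + pot' <= pot + (S * (4000 * n.+1) + 60)].
Proof.
move=> K4 [st rep [hs <-]] uv; have [q16 n8 hq1 hq2 hq3] := quota_bounds.
have n4 : 4 * n <= q by lia.
have nq : n <= q by lia.
have [|t [s' [st' [ex rep' _ [hs' ht]]]]] := @wp_delete w q base q16 qw _ n m n4 hq1 hq2
  _ K S off nb (adj G) (adj (G :\ edge u v)%SET) u v K4 (adj_sym _) (adj_sym _)
  (call_ok u v hs) erefl erefl (adj_delete G u v) _ (call_represents u v nq rep).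
  by rewrite addn1.
exists t, s', (total_pot n K S off st'); split=> //; first by exists st'.
by rewrite addnA.
Qed.

Lemma distance_ok K S off nb (G : graph n) s pot (x y : 'I_n) : 4 <= K ->
  data_ok K S off nb G s pot ->
  exists t s', [/\ exec w (compile query) (call x y s) t s',
    data_ok K S off nb G s' pot,
    t <= 200 * bits S + 300 &
    exists2 st, answers K S (adj G) x y st & regs s' =1 vars st].
Proof.
move=> K4 [st rep [hs <-]]; have [q16 n8 hq1 hq2 hq3] := quota_bounds.
have nq : n <= q by lia.
have Sq : S * n.+1 <= q.
  by apply: leq_trans hq2; rewrite leq_mul2r (S_bound (so_S hs)) orbT.
have [|t [s' [st' [ex rep' [_ fa] [ht [ans hs']]]]]] := @wp_query w q base q16 qw _ n m K S
  off nb (adj G) x y K4 (adj_sym _) n8 Sq _ (call_ok x y hs) erefl erefl _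
  (call_represents x y nq rep).
  by rewrite addn1.
have A a : arrs st' a = arrs st a by exact: fa.
exists t, s'; split=> //; last by exists st' => //; case: rep'.
exists st' => //; split=> //; apply: eq_bigr => i _; congr (scale_pot _ _ _ _ _).
by apply: scale_of_eq; rewrite ?A // => j _; apply: tree_frame; exact: A.
Qed.

End Transitions.

Section Totals.

Variables w n m k : nat.
Hypothesis hw : 401 * (trunc_log 2 n).+1 <= w.
Hypothesis hm : m <= n * n.
Hypothesis k4 : 4 <= k.

Notation K := (maxn 4 (minn k (4 * n))).
Notation t := (trunc_log 2 n).+1.

(** The error [2 * radius] at scale [i + 1] is at most [4 * 2 ^ i / k], the origin of the 4 in
    [4 / eps]. If the parameter was capped at [4 * n], all radii are 0 because
    [2 ^ i.+1 < 2 * n]. *)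
Lemma radius_error i : 2 ^ i.+1 < 2 * n -> 2 * radius K i.+1 * k <= 4 * 2 ^ i.
Proof.
have [k4n|k4n] := leqP k (4 * n) => hi.
  have -> : maxn 4 k = k by lia.
  have := leq_divM (2 ^ i.+1) k; rewrite -/(radius k i.+1).
  by rewrite [2 ^ i.+1]expnS; move: (radius _ _) (2 ^ i) => a b; lia.
by rewrite /radius divn_small //; apply: leq_trans hi _; lia.
Qed.

Definition approximate_answer (G : graph n) (x y : 'I_n) (s : state) :=
  (regs s 0 = 0 /\ walk (adj G) x y (regs s 1) /\
   forall l, walk (adj G) x y l -> k * regs s 1 <= (k + 4) * l) \/
  (regs s 0 = 1 /\ ~~ connect (adj G) x y).

Lemma distance_approximate S off nb (G : graph n) s pot (x y : 'I_n) :
  data_ok m K S off nb G s pot ->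
  exists t' s', [/\ exec w (compile query) (call x y s) t' s',
    data_ok m K S off nb G s' pot, t' <= 200 * trunc_log 2 t + 700
    & approximate_answer G x y s'].
Proof.
move=> hd; have K4 : 4 <= K by rewrite leq_maxl.
have [t' [s' [ex hd' ht [st ans E]]]] := distance_ok hw hm x y K4 hd.
have [_ _ [[_ _ _ hS _ _] _]] := hd.
exists t', s'; split=> //.
  have : bits S <= (trunc_log 2 t).+2.
    case: S {hd hd' ans ht} hS => // S hS; rewrite /bits ltnS -trunc_log2_double //.
    by apply: leq_trunc_log; rewrite -mul2n; exact: scales_le.
  by move: ht; move: (bits S) (trunc_log 2 t) => a b; lia.
rewrite /approximate_answer !E; case: ans => [[-> [wxy hk]]|[-> hc]]; last by right.
left; split=> //; split=> // l wl; have [le|[i [iS il le]]] := hk l wl.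
  by rewrite leq_mul // leq_addr.
have := radius_error (hS _ iS); move: il le.
by move: (vars st 1) (radius _ _) (2 ^ i) => d r p; nia.
Qed.

(** The overhead of [m] deletions is included on the left, so this bounds the time of the whole
    sequence. Each summand is compared with the product of [k], the logarithm, [m] and [n]. *)
Lemma initialize_total (G : graph n) es : edge_listing G es -> size es = m ->
  exists t' s S off nb pot, [/\ exec w (initialize k) (input_state es) t' s,
    data_ok m K S off nb G s pot
    & 0 < n -> 0 < m -> t' + pot + m * (S * (4000 * n.+1) + 60) <=
      10 * (4100 * (k * t * m * n))].
Proof.
move=> hes Em; have K4 : 4 <= K by rewrite leq_maxl.
have [t' [s [S [off [nb [pot [ex hd ht]]]]]]] := initialize_ok hw hm k4 hes Em.
exists t', s, S, off, nb, pot; split=> // n0 m0.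
have [_ _ [[_ _ hsum hS _ _] _]] := hd.
have S2 := scales_le hS.
have := leq_trans ht (leq_add (initial_pot_le S K4 hsum) (leqnn _)).
rewrite /setup_cost.
have Kk : K <= k by lia.
have P1 : S * (K * (m * n)) <= 2 * (t * (k * (m * n))).
  by rewrite mulnA (mulnA 2) (mulnA (2 * t)) -(mulnA 2) leq_mul2r; apply/orP; right; nia.
have P2 : m * n * S <= 2 * (t * (m * n)) by rewrite [X in X <= _]mulnC (mulnA 2) leq_mul2r S2 orbT.
have P3 : n * S <= m * n * S by rewrite -mulnA leq_pmull.
have mn0 : m <= m * n by rewrite leq_pmulr.
have nm0 : n <= m * n by rewrite leq_pmull.
have P4 : k <= t * (k * (m * n)).
  by rewrite (leq_trans (_ : _ <= k * (m * n))) ?leq_pmulr ?leq_pmull // muln_gt0 m0.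
have P5 : 4 * (t * (m * n)) <= t * (k * (m * n)).
  by rewrite mulnCA leq_mul2l leq_mul2r k4 orbT.
have P6 : m * n <= t * (m * n) by rewrite leq_pmull.
have P7 : m * S <= m * n * S by rewrite leq_mul2r mn0 orbT.
have -> : S * (4000 * (4 * K * m * n)) = 4000 * (4 * (S * (K * (m * n)))) by lia.
have -> : k * t * m * n = t * (k * (m * n)) by lia.
have -> : S * (4000 * n.+1) = 4000 * (n * S) + 4000 * S by lia.
have -> : n * (300 * m + 100) = 300 * (m * n) + 100 * n by lia.
have -> : m * (4000 * (n * S) + 4000 * S + 60) =
  4000 * (m * n * S) + 4000 * (m * S) + 60 * m by lia.
have P8 : S <= n * S by rewrite leq_pmull.
move: (S * (K * _)) (t * (k * _)) (m * n * S) (n * S) (m * S) P1 P2 P3 P4 P5 P6 P7 P8.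
move: (t * (m * n)) (m * n) mn0 nm0 => a b mn0 nm0 c d e f g; lia.
Qed.

End Totals.

From mathcomp Require Import all_boot all_order all_algebra.
From mathcomp Require Import all_classical all_reals all_analysis.
From mathcomp Require Import ring lra.

Import Order.TTheory GRing.Theory Num.Theory.

(** * Runs *)

Definition apsp_structure k : data_structure :=
  DataStructure (initialize k) (compile delete_edge) (compile query).

Section Runs.

Variables (R : realType) (n : nat).
Implicit Types (G : graph n) (L : seq (query_record R n)).

Lemma run_det D w G s ops T T' L L' :
  run D w G s ops T L -> run D w G s ops T' L' -> T = T' /\ L = L'.
Proof.
move=> h; elim: h T' L' => {G s ops T L}.
- by move=> G s T' L' h; inversion h.
- move=> G s u v ops t s' T L ex _ IH T' L' h.
  inversion h as [|? ? ? ? ? ? ? ? ? ex' r'|]; subst.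
  by have [? ?] := exec_det ex ex'; subst; have [-> ->] := IH _ _ r'.
- move=> G s x y ops t s' T L ex _ IH T' L' h.
  inversion h as [| |? ? ? ? ? ? ? ? ? ex' r']; subst.
  by have [? ?] := exec_det ex ex'; subst; have [-> ->] := IH _ _ r'.
Qed.

Lemma full_run_det D w G es ops T T' L L' :
  full_run D w G es ops T L -> full_run D w G es ops T' L' -> T = T' /\ L = L'.
Proof.
move=> [t [s [T1 [ex r ->]]]] [t' [s' [T1' [ex' r' ->]]]].
have [? ?] := exec_det ex ex'; subst.
by have [-> ->] := run_det r r'.
Qed.

Variables (w m k : nat).
Hypothesis hw : (401 * (trunc_log 2 n).+1 <= w)%N.
Hypothesis hm : (m <= n * n)%N.
Hypothesis k4 : (4 <= k)%N.

Definition good_record (r : query_record R n) :=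
  (q_time r <= 200 * trunc_log 2 (trunc_log 2 n).+1 + 700)%N /\
  exists2 s, approximate_answer k (q_graph r) (q_src r) (q_dst r) s &
    q_answer r = answer R s.

(** The potential telescopes over the deletions, and as each of them removes an edge of [G] there
    are at most [#|G|]. *)
Lemma run_ok S off nb G s pot ops :
  data_ok m (maxn 4 (minn k (4 * n))) S off nb G s pot -> valid_operations G ops ->
  exists T L, [/\ run (apsp_structure k) w G s ops T L, List.Forall good_record L
    & (T <= pot + #|G| * (S * (4000 * n.+1) + 60))%N].
Proof.
have K4 : (4 <= maxn 4 (minn k (4 * n)))%N by rewrite leq_maxl.
elim: ops G s pot => [|[u v|x y] ops IH] G s pot hd.
- by exists 0%N, [::]; split=> //; constructor.
- move=> /= /andP[uv val]; have [t [s' [pot' [ex hd' ht]]]] := delete_ok hw hm K4 hd uv.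
  have [T [L [r good hT]]] := IH _ _ _ hd' val.
  exists (t + T)%N, L; split=> //; first by apply: RunDelete r; exact: ex.
  have := cardsD1 (edge u v) G; rewrite uv => ->; move: hT ht.
  rewrite [((_ + _) * _)%N]mulnDl mul1n.
  by move: (_ + 60)%N (#|_| * _)%N => a b; lia.
- move=> /= val; have [t [s' [ex hd' ht ap]]] := distance_approximate hw hm k4 x y hd.
  have [T [L [r good hT]]] := IH _ _ _ hd' val.
  exists T, (QueryRecord G x y (answer R s') t :: L); split=> //.
    by apply: RunDistance r; exact: ex.
  by constructor=> //; split=> //; exists s'.
Qed.

End Runs.

Lemma full_run_ok (R : realType) w n (G : graph n) es ops k : (4 <= k)%N ->
  admissible 401 w G es ops ->
  exists T (L : seq (query_record R n)), [/\ full_run (apsp_structure k) w G es ops T L,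
    List.Forall (good_record k) L
    & (0 < n -> 0 < #|G| ->
       T <= 10 * (4100 * (k * (trunc_log 2 n).+1 * #|G| * n)))%N].
Proof.
move=> k4 [hw sG hes val].
have hm := listing_le hes; have Em := listing_size hes.
have [t [s [S [off [nb [pot [ex hd ht]]]]]]] := initialize_total hw hm k4 hes erefl.
have [T [L [r good hT]]] := run_ok R hw hm k4 hd val.
exists (t + T)%N, L; split=> //; first by exists t, s, T.
move=> n0 m0; rewrite -Em in hT m0 *; apply: leq_trans (ht n0 m0).
by rewrite -addnA leq_add2l.
Qed.

(** * The approximation factor and the asymptotic bounds *)

Local Open Scope ring_scope.
Local Open Scope classical_set_scope.

Lemma good_record_approximates (R : realType) (eps : R) n k (r : query_record R n) :
  0 < eps -> 4 / eps <= k%:R -> good_record k r -> approximates (1 + eps) 0 r.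
Proof.
move=> e0 hk [_ [s]]; case: r => G x y a t /= ap ->; rewrite /approximates /= /answer /dist.
have e1 : 0 < 1 + eps by rewrite addr_gt0.
case: ap => [[-> [wxy lb]]|[-> nc]] /=; last first.
  rewrite (_ : mkset _ = set0) ?image_set0 ?ereal_inf0 ?gt0_muley ?lte_fin //.
  apply/seteqP; split=> // p /= [hp E]; case/negP: nc.
  by apply/connectP; exists p.
rewrite adde0; split.
  by apply: ereal_inf_lbound; case: wxy => p hp [lp <-]; exists p.
set d := regs s 1 in wxy lb *.
(* Dividing by [1 + eps] on the side of the finite answer turns the claim into a lower bound on the
   infimum over paths. *)
have -> : (d%:R%:E = (1 + eps)%:E * (d%:R / (1 + eps))%:E :> \bar R)%E.
  by rewrite -EFinM mulrCA divff ?mulr1 ?gt_eqF.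
apply: lee_wpmul2l; first by rewrite lee_fin ltW.
apply: le_ereal_inf_tmp => _ [p [hp E] <-]; rewrite lee_fin ler_pdivrMr //.
have /lb : walk (adj G) x y (size p) by exists p.
rewrite -(ler_nat R) !natrM natrD => h.
have k0 : 0 < k%:R :> R by apply: lt_le_trans hk; rewrite divr_gt0.
rewrite -(ler_pM2l k0); apply: le_trans h _.
rewrite [leRHS]mulrCA [leRHS]mulrC ler_wpM2r // mulrDr mulr1 lerD2l.
by rewrite -ler_pdivrMr.
Qed.

(** From [expR (- (1 / 6)) >= 5 / 6] and [(5 / 6) ^+ 6 > 1 / 3]. It makes [ln (ln 3)] positive, the
    least value of [ln (ln n)], by which additive constants are absorbed. *)
Lemma ln3_gt1 (R : realType) : 1 < ln (3 : R).
Proof.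
rewrite -[ltLHS]expRK ltr_ln ?posrE ?expR_gt0 //.
have h : 5 / 6 <= expR (- (1 / 6)) :> R.
  by apply: le_trans (expR_ge1Dx _); lra.
have : (5 / 6) ^+ 6 <= expR (- (1 / 6)) ^+ 6 :> R by rewrite ler_pXn2r ?nnegrE //; lra.
rewrite -expRM_natl (_ : 6%:R * - (1 / 6) = - 1 :> R); last by field.
rewrite expRN => h6; have : (expR 1)^-1 > 3^-1 :> R by apply: lt_le_trans h6; lra.
by rewrite ltf_pV2 ?posrE ?expR_gt0.
Qed.

Lemma trunc_log_ln (R : realType) j : (0 < j)%N ->
  (trunc_log 2 j)%:R * ln 2 <= ln (j%:R : R).
Proof.
move=> j0; have := trunc_logP (isT : (1 < 2)%N) j0.
rewrite -(ler_nat R) natrX mulrC mulr_natr -lnXn // => h.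
by rewrite ler_ln // posrE ?exprn_gt0 ?ltr0n.
Qed.

Theorem theorem4p1 (R : realType) :
  exists (c : nat) (C : R), forall eps : R, 0 < eps -> eps <= 1 ->
  exists D : data_structure,
    [/\ approx_decremental_APSP c (1 + eps) 0 D,
        forall n m : nat, (2 < n)%N -> (0 < m)%N ->
          total_update_time_le c D n m (C * ((m%:R * n%:R * ln n%:R) / eps))
      & forall n : nat, (2 < n)%N ->
          query_time_le c D n (C * ln (ln n%:R))].
Proof.
have l2 : 0 < ln (2 : R) by apply: ln_gt0; rewrite ltr1n.
have l3 := ln3_gt1 R; have ll3 : 0 < ln (ln 3 : R) by exact: ln_gt0.
have mono n : (2 < n)%N -> ln 3 <= ln (n%:R : R).
  by move=> n3; rewrite ler_ln ?posrE ?ltr0n ?ler_nat //; lia.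
(* [trunc_log 2 n] is at most [ln n / ln 2], and the summand 1 covers the successor because
   [ln n > 1]. *)
pose A : R := (ln 2)^-1 + 1.
have A1 : 1 < A by rewrite ltrDr invr_gt0.
have lA : 0 <= ln A by apply: ln_ge0; exact: ltW.
(* Opaque names for the large numerals, so that they are not unfolded. *)
have [N EN] : exists N, N = 4100%N by exists 4100%N.
have [N' EN'] : exists N', N' = 200%N by exists 200%N.
have [N'' EN''] : exists N'', N'' = 700%N by exists 700%N.
pose Cu : R := 10 * (N%:R * (5 * A)).
(* The quotients by [ln (ln 3)] express the additive terms [ln A] and [N''] as multiples of
   [ln (ln n)]. *)
pose Cq : R := N'%:R / ln 2 * (ln A / ln (ln 3) + 1) + N''%:R / ln (ln 3).
have A0 : 0 <= A by apply: ltW; exact: lt_trans A1.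
have Cu0 : 0 <= Cu by rewrite !mulr_ge0.
have Cq0 : 0 <= Cq.
  by rewrite addr_ge0 ?mulr_ge0 ?addr_ge0 ?divr_ge0 ?invr_ge0 // ltW.
have scales n : (2 < n)%N -> (trunc_log 2 n).+1%:R <= A * ln n%:R :> R.
  move=> n3; have := mono n n3 => h.
  rewrite /A mulrDl mul1r -addn1 natrD lerD //; last by lra.
  by rewrite mulrC ler_pdivlMr // trunc_log_ln //; lia.
exists 401%N, (Cu + Cq) => eps e0 e1.
(* The least integer above [4 / eps]. As [eps <= 1], it is at least 4 and at most [5 / eps]. *)
pose k := (Num.truncn (4 / eps)).+1.
have f4 : 4 <= 4 / eps by rewrite ler_pdivlMr //; lra.
have /andP[kl kg] := truncn_itv (le_trans (ler0n _ 4) f4).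
have k4 : (4 <= k)%N by rewrite -(ler_nat R) (le_trans f4) // ltW.
have k5 : k%:R <= 5 / eps.
  rewrite /k -addn1 natrD; apply: le_trans (lerD kl (lexx _)) _.
  have : 1 <= 1 / eps by rewrite ler_pdivlMr // mul1r.
  by rewrite (_ : 5 / eps = 4 / eps + 1 / eps); [lra|field; rewrite gt_eqF].
exists (apsp_structure k); split.
- move=> w n G es ops adm; have [T [L [r good _]]] := full_run_ok R k4 adm.
  exists T, L; split=> //; apply: List.Forall_impl good => q.
  by apply: good_record_approximates => //; exact: ltW.
- move=> n m n3 m0 w G es ops T L cG adm r; have [T' [L' [r' _]]] := full_run_ok R k4 adm.
  have [-> _] := full_run_det r r'; rewrite cG => /(_ (ltnW (ltnW n3)) m0).
  rewrite -EN -(ler_nat R) => /le_trans; apply; rewrite !natrM.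
  have kt : k%:R * (trunc_log 2 n).+1%:R <= 5 / eps * (A * ln n%:R) :> R.
    by rewrite ler_pM // scales.
  have U0 : 0 <= ln (n%:R : R) by apply: le_trans (mono n n3); apply: ltW; lra.
  apply: (@le_trans _ _ (Cu * (m%:R * n%:R * ln n%:R / eps))); last first.
    by rewrite ler_wpM2r ?lerDl // !mulr_ge0 // invr_ge0 ltW.
  rewrite /Cu -!mulrA ler_wpM2l // ler_wpM2l //.
  rewrite mulrA -[leLHS]mulrC.
  rewrite (_ : 5 * _ = m%:R * n%:R * (5 / eps * (A * ln n%:R))); last by ring.
  by rewrite ler_wpM2l.
- move=> n n3 w G es ops T L adm r; have [T' [L' [r' good _]]] := full_run_ok R k4 adm.
  have [_ ->] := full_run_det r r'; apply: List.Forall_impl good => q [+ _].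
  rewrite -EN'' -EN' -(ler_nat R) => /le_trans; apply; rewrite natrD natrM.
  have U3 := mono n n3; have U0 : 0 < ln (n%:R : R) by lra.
  have V0 : ln (ln 3) <= ln (ln (n%:R : R)) by rewrite ler_ln ?posrE //; lra.
  set V := ln (ln n%:R) in V0 *; set t := trunc_log 2 _.+1.
  have ht : t%:R <= (ln A + V) / ln 2.
    rewrite ler_pdivlMr //; apply: le_trans (trunc_log_ln _ _) _ => //.
    have Ap : A \is Num.pos by rewrite posrE; exact: lt_trans A1.
    have Up : ln (n%:R : R) \is Num.pos by rewrite posrE.
    have tp : (trunc_log 2 n).+1%:R \is @Num.pos R by rewrite posrE ltr0n.
    by rewrite /V -(lnM Ap Up) ler_ln ?scales // rpredM.
  have hA : ln A <= ln A / ln (ln 3) * V.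
    by rewrite mulrAC ler_pdivlMr // ler_wpM2l.
  have h7 : N''%:R <= N''%:R / ln (ln 3) * V by rewrite mulrAC ler_pdivlMr // ler_wpM2l.
  apply: (@le_trans _ _ (Cq * V)); last by rewrite ler_wpM2r ?lerDr //; lra.
  rewrite /Cq mulrDl lerD // -mulrA -mulrA ler_wpM2l //.
  apply: le_trans ht _; rewrite [leLHS]mulrC -mulrA.
  rewrite ler_wpM2l ?invr_ge0 ?(ltW l2) //.
  by rewrite mulrDl mul1r lerD.
Qed.
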